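(* Let $H=(H_R,H_L,\mathcal S)$ be a finite-dimensional Hopf algebroid over $\Bbbk$ whose base algebra $L$ is simple. Then any exact indecomposable module category over the category $H\text{-mod}$ of finite-dimensional left $H$-modules is equivalent, as an $H\text{-mod}$-module category, to ${}_K\mathcal M$ for some $H$-simple left $H$-comodule algebra $(K,s_K,\lambda)$.
   Context: $\Bbbk$ is an algebraically closed field of characteristic $0$; algebras and vector spaces are over $\Bbbk$. For an algebra $A$, ${}_A\mathcal M$ is the category of finite-dimensional left $A$-modules. Bialgebroids. A left bialgebroid with base $L$ is $(H,s,t,\Delta,\epsilon)$ where $H$ is an algebra, $s:L\to H$, $t:L^{op}\to H$ are algebra maps with commuting images, making $H$ an $L$-bimodule by $l\cdot x\cdot l'=s(l)t(l')x$; $\Delta:H\to H\otimes_LH$, $\epsilon:H\to L$ make $H$ a comonoid in $L$-bimodules; and $\Delta(x)(t(l)\otimes1)=\Delta(x)(1\otimes s(l))$, $\Delta(1)=1\otimes1$, $\Delta(xy)=\Delta(x)\Delta(y)$, $\epsilon(1)=1$, $\epsilon(xs(\epsilon(y)))=\epsilon(xy)=\epsilon(xt(\epsilon(y)))$. Right bialgebroids with base $R$ are defined symmetrically: $s:R\to H$, $t:R^{op}\to H$ with commuting images, bimodule structure $r\cdot x\cdot r'=x\,s(r')t(r)$, $(H,\Delta,\epsilon)$ a comonoid in $R$-bimodules, $(s(r)\otimes1)\Delta(x)=(1\otimes t(r))\Delta(x)$, $\Delta$ unital and multiplicative, $\epsilon(1)=1$, $\epsilon(s(\epsilon(x))y)=\epsilon(xy)=\epsilon(t(\epsilon(x))y)$.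 A Hopf algebroid $(H_R,H_L,\mathcal S)$ consists of a left bialgebroid $H_L=(H,s_L,t_L,\Delta_L,\epsilon_L)$ over $L$ and a right bialgebroid $H_R=(H,s_R,t_R,\Delta_R,\epsilon_R)$ over $R$ on the same algebra $H$, and a linear map $\mathcal S:H\to H$, such that: $s_L\epsilon_Lt_R=t_R$, $t_L\epsilon_Ls_R=s_R$, $s_R\epsilon_Rt_L=t_L$, $t_R\epsilon_Rs_L=s_L$; $(\Delta_L\otimes\mathrm{id})\Delta_R=(\mathrm{id}\otimes\Delta_R)\Delta_L$, $(\Delta_R\otimes\mathrm{id})\Delta_L=(\mathrm{id}\otimes\Delta_L)\Delta_R$; $\mathcal S(t_L(l)ht_L(l'))=s_L(l')\mathcal S(h)s_L(l)$, $\mathcal S(t_R(r)ht_R(r'))=s_R(r')\mathcal S(h)s_R(r)$; and $m_H(\mathcal S\otimes\mathrm{id})\Delta_L=s_R\epsilon_R$, $m_H(\mathrm{id}\otimes\mathcal S)\Delta_R=s_L\epsilon_L$. Write $s,t,\Delta,\epsilon$ for the data of $H_L$. $H$-modules are $L$-bimodules via $l\cdot x\cdot l'=s(l)t(l')x$, and $H\text{-mod}$ is monoidal with tensor product $\otimes_L$, $H$ acting through $\Delta$. Comodule algebras. A left $H$-comodule algebra is a triple $(K,s_K,\lambda)$: an algebra $K$, an algebra map $s_K:L\to K$ (making $K$ an $L$-bimodule by $l\cdot k\cdot l'=s_K(l)ks_K(l')$) and a left $L$-linear map $\lambda:K\to H\otimes_LK$, $\lambda(k)=k_{(-1)}\otimes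 k_{(0)}$, such that $(\epsilon\otimes\mathrm{id})\lambda=\mathrm{id}$, $(\mathrm{id}\otimes\lambda)\lambda=(\Delta\otimes\mathrm{id})\lambda$, $\lambda(K)\subseteq\{x\in H\otimes_LK: x(t(l)\otimes1)=x(1\otimes s_K(l))\ \forall l\in L\}$, $\lambda(1)=1\otimes1$ and $\lambda(xy)=\lambda(x)\lambda(y)$. It is $H$-simple if $K$ has no non-trivial $H$-costable (two-sided) ideals, i.e. ideals $I$ with $\lambda(I)\subseteq H\otimes_LI$. The $H\text{-mod}$-module structure of ${}_K\mathcal M$ is $X\overline\otimes M=X\otimes_LM$, with $M$ a left $L$-module via $s_K$ and action $k\cdot(x\otimes m)=k_{(-1)}\cdot x\otimes k_{(0)}\cdot m$, with canonical associativity and unit. A module category $\mathcal M$ over a finite tensor category $\mathcal D$ is a $\Bbbk$-linear abelian category with a bilinear bi-exact action $\overline\otimes:\mathcal D\times\mathcal M\to\mathcal M$ and coherent associativity and unit isomorphisms. It is exact if $\mathcal M$ is finite and $P\overline\otimes M$ is projective for all projective $P\in\mathcal D$ and all $M\in\mathcal M$; it is indecomposable if it is not equivalent to a direct sum of two non-trivial module categories. *)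

(* Defs.v *)
From HB Require Import structures.
From mathcomp Require Import all_boot all_algebra all_field.
From mathcomp Require Import boolp functions.

Set Implicit Arguments.
Unset Strict Implicit.
Unset Printing Implicit Defensive.
Import GRing.Theory.
Local Open Scope ring_scope.
Local Open Scope quotient_scope.

Section Lin.
Variables (k : fieldType).
Lemma lin0 (U V : lmodType k) (F : U -> V) : linear F -> F 0 = 0.
Proof. by move=> h; have := h (-1) 0 0; rewrite scaler0 addr0 scaleN1r addNr. Qed.
Lemma linZ (U V : lmodType k) (F : U -> V) : linear F ->
  forall a u, F (a *: u) = a *: F u.
Proof. by move=> h a u; have := h a u 0; rewrite addr0 (lin0 h) addr0. Qed.
Lemma linD (U V : lmodType k) (F : U -> V) : linear F ->
  forall u v, F (u + v) = F u + F v.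
Proof. by move=> h u v; have := h 1 u v; rewrite !scale1r. Qed.
Lemma linsum (U V : lmodType k) (F : U -> V) : linear F ->
  forall I (r : seq I) (P : pred I) (E : I -> U),
  F (\sum_(i <- r | P i) E i) = \sum_(i <- r | P i) F (E i).
Proof.
move=> h I r P E; apply: (big_morph F (linD h) (lin0 h)).
Qed.

End Lin.

(* X (x)_L Y, for ra the right action of L on X (with the scalar written first)
   and la the left action of L on Y: finite formal sums of pairs, two of them
   being identified when every L-balanced k-bilinear map into a k-vector space
   takes the same value on both. *)
Section Tensor.
Variables (k : fieldType) (L : Type) (X Y : lmodType k).
Variables (ra : L -> X -> X) (la : L -> Y -> Y).

Definition balanced (V : lmodType k) (f : X -> Y -> V) : Prop :=
  [/\ forall y, linear (f^~ y), forall x, linear (f x)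
    & forall l x y, f (ra l x) y = f x (la l y)].

Definition tsum (V : lmodType k) (f : X -> Y -> V) (s : seq (X * Y)) : V :=
  \sum_(p <- s) f p.1 p.2.

Definition teq (s1 s2 : seq (X * Y)) : bool :=
  `[< forall (V : lmodType k) (f : X -> Y -> V),
        balanced f -> tsum f s1 = tsum f s2 >].

Lemma teq_equiv : equiv_class_of teq.
Proof.
split=> [s|s1 s2|s1 s2 s3].
- by apply/asboolP.
- by apply/asbool_equiv_eq; split=> h V f bf; rewrite h.
- by move=> /asboolP h1 /asboolP h2; apply/asboolP=> V f bf; rewrite h1 // h2.
Qed.

Canonical teq_equivrel := EquivRelPack teq_equiv.

Definition tens := {eq_quot teq}.
HB.instance Definition _ : EqQuotient _ teq tens := EqQuotient.on tens.
HB.instance Definition _ := Choice.on tens.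

(* f is summed over a chosen representative of u. When f is balanced the value
   does not depend on it (tlift_pi), and tlift f is the induced linear map. *)
Definition tlift (V : lmodType k) (f : X -> Y -> V) (u : tens) : V :=
  tsum f (repr u).

Definition tpure (x : X) (y : Y) : tens := \pi_tens [:: (x, y)].

Lemma tlift_pi (V : lmodType k) (f : X -> Y -> V) s : balanced f ->
  tlift f (\pi_tens s) = tsum f s.
Proof.
move=> bf; rewrite /tlift.
have : repr (\pi_tens s) = s %[mod tens] by rewrite reprK.
by move=> /eqmodP /asboolP /(_ V f bf).
Qed.

Lemma tens_eqP (u v : tens) :
  (forall (V : lmodType k) (f : X -> Y -> V), balanced f -> tlift f u = tlift f v) -> u = v.
Proof.
move=> h; rewrite -[u]reprK -[v]reprK; apply/eqmodP/asboolP=> V f bf; exact: h.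
Qed.

Definition t0 : tens := \pi_tens [::].
Definition tadd (u v : tens) : tens := \pi_tens (repr u ++ repr v).
Definition tscale (a : k) (u : tens) : tens :=
  \pi_tens [seq (a *: p.1, p.2) | p <- repr u].
Definition topp (u : tens) : tens := tscale (-1) u.

Lemma tlift0 (V : lmodType k) (f : X -> Y -> V) : balanced f -> tlift f t0 = 0.
Proof. by move=> bf; rewrite tlift_pi // /tsum big_nil. Qed.

Lemma tliftD (V : lmodType k) (f : X -> Y -> V) u v : balanced f ->
  tlift f (tadd u v) = tlift f u + tlift f v.
Proof. by move=> bf; rewrite tlift_pi // /tsum big_cat. Qed.

Lemma tliftZ (V : lmodType k) (f : X -> Y -> V) a u : balanced f ->
  tlift f (tscale a u) = a *: tlift f u.
Proof.
move=> bf; rewrite tlift_pi // /tsum big_map scaler_sumr.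
by apply: eq_bigr => p _; case: bf => h _ _; rewrite /= (linZ (h _)).
Qed.

Let tac := (tliftD, tlift0, tliftZ).

Lemma taddA : associative tadd.
Proof. by move=> u v w; apply: tens_eqP => V f bf; rewrite !tac // addrA. Qed.
Lemma taddC : commutative tadd.
Proof. by move=> u v; apply: tens_eqP => V f bf; rewrite !tac // addrC. Qed.
Lemma tadd0 : left_id t0 tadd.
Proof. by move=> u; apply: tens_eqP => V f bf; rewrite !tac // add0r. Qed.
Lemma taddN : left_inverse t0 topp tadd.
Proof.
by move=> u; apply: tens_eqP => V f bf; rewrite !tac // scaleN1r addNr.
Qed.
HB.instance Definition _ := GRing.isZmodule.Build tens taddA taddC tadd0 taddN.

Lemma tscaleA a b v : tscale a (tscale b v) = tscale (a * b) v.
Proof. by apply: tens_eqP => V f bf; rewrite !tac // scalerA. Qed.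
Lemma tscale1 : left_id 1 tscale.
Proof. by move=> v; apply: tens_eqP => V f bf; rewrite !tac // scale1r. Qed.
Lemma tscaleDr : right_distributive tscale +%R.
Proof. by move=> a u v; apply: tens_eqP => V f bf; rewrite !tac // scalerDr. Qed.
Lemma tscaleDl v : {morph tscale^~ v : a b / a + b}.
Proof. by move=> a b; apply: tens_eqP => V f bf; rewrite !tac // scalerDl. Qed.
HB.instance Definition _ :=
  GRing.Zmodule_isLmodule.Build k tens tscaleA tscale1 tscaleDr tscaleDl.

Lemma tlift_lin (V : lmodType k) (f : X -> Y -> V) : balanced f -> linear (tlift f).
Proof. by move=> bf a u v; rewrite tliftD // tliftZ. Qed.

Lemma tliftE (V : lmodType k) (f : X -> Y -> V) x y : balanced f -> tlift f (tpure x y) = f x y.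
Proof. by move=> bf; rewrite tlift_pi // /tsum big_seq1. Qed.

Lemma tpure_bal : balanced tpure.
Proof.
split=> [y a x x'|x a y y'|l x y]; apply: tens_eqP => V f bf.
- by rewrite tliftD // tliftZ // !tliftE //; case: bf => h _ _; rewrite h.
- by rewrite tliftD // tliftZ // !tliftE //; case: bf => _ h _; rewrite h.
- by rewrite !tliftE //; case: bf => _ _ h; rewrite h.
Qed.

Lemma tlift_pure u : tlift tpure u = u.
Proof.
apply: tens_eqP => V f bf; rewrite [tlift tpure u]/tlift /tsum (linsum (tlift_lin bf)).
by apply: eq_bigr => p _; rewrite tliftE.
Qed.

Lemma lin_tlift (V W : lmodType k) (F : V -> W) (f : X -> Y -> V) u :
  linear F -> F (tlift f u) = tlift (fun x y => F (f x y)) u.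
Proof. by move=> h; rewrite /tlift /tsum (linsum h). Qed.

Lemma tens_ext (V : lmodType k) (F G : tens -> V) : linear F -> linear G ->
  (forall x y, F (tpure x y) = G (tpure x y)) -> forall u, F u = G u.
Proof.
move=> hF hG e u; rewrite -(tlift_pure u) !lin_tlift //.
by rewrite /tlift /tsum; apply: eq_bigr.
Qed.

Lemma eq_tlift (V : lmodType k) (f g : X -> Y -> V) u : f =2 g -> tlift f u = tlift g u.
Proof. by move=> e; rewrite /tlift /tsum; apply: eq_bigr => p _; exact: e. Qed.

Lemma tlift_linf (U V : lmodType k) (f : U -> X -> Y -> V) u :
  (forall x y, linear (fun w => f w x y)) -> linear (fun w => tlift (f w) u).
Proof.
move=> h a v w; rewrite /tlift /tsum scaler_sumr -big_split.
by apply: eq_bigr => p _; exact: h.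
Qed.

End Tensor.

Definition fin_dim (k : fieldType) (V : lmodType k) : Prop :=
  exists (n : nat) (e : 'I_n -> V),
    forall v, exists c : 'I_n -> k, v = \sum_(i < n) c i *: e i.

Section FinDim.
Variable k : fieldType.

Lemma fin_dim_fin (V : lmodType k) (I : finType) (e : I -> V) :
  (forall v, exists c : I -> k, v = \sum_i c i *: e i) -> fin_dim V.
Proof.
move=> h; exists #|I|, (fun i => e (enum_val i)) => v; have [c ->] := h v.
exists (fun i => c (enum_val i)).
rewrite (reindex (fun i : 'I_#|I| => enum_val i)) //=.
by apply: onW_bij; exact: enum_val_bij.
Qed.

Lemma fin_dim_surj (V W : lmodType k) (F : V -> W) : linear F ->
  (forall w, exists v, w = F v) -> fin_dim V -> fin_dim W.
Proof.
move=> hF hs [n [e he]]; exists n, (fun i => F (e i)) => w.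
have [v ->] := hs w; have [c ->] := he v; exists c.
by rewrite (linsum hF); apply: eq_bigr => i _; rewrite (linZ hF).
Qed.

Lemma fin_dim_vect (V : vectType k) : fin_dim V.
Proof.
exists (\dim {:V}), (fun i => (vbasis {:V})`_i) => v.
exists (fun i => coord (vbasis {:V}) i v).
exact: (coord_vbasis (memvf v)).
Qed.

Lemma fin_dim_tens (L : Type) (X Y : lmodType k) (ra : L -> X -> X)
  (la : L -> Y -> Y) : fin_dim X -> fin_dim Y -> fin_dim (tens ra la).
Proof.
move=> [n [e he]] [m [e' he']].
apply: (@fin_dim_fin _ ('I_n * 'I_m)%type (fun p => tpure ra la (e p.1) (e' p.2))).
have [b1 b2 _] := tpure_bal ra la.
move=> u; rewrite -(tlift_pure u) /tlift /tsum.
elim: (repr u) => [|p s [c IH]].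
  by exists (fun=> 0); rewrite big_nil big1 // => i _; rewrite scale0r.
have [a ea] := he p.1; have [a' ea'] := he' p.2.
exists (fun q => a q.1 * a' q.2 + c q); rewrite big_cons IH.
under [RHS]eq_bigr do rewrite scalerDl.
rewrite big_split /=; congr (_ + _).
rewrite {1}ea (linsum (b1 _)) -(pair_bigA _ (fun i j => (a i * a' j) *: tpure ra la (e i) (e' j))) /=.
apply: eq_bigr => i _; rewrite (linZ (b1 _)) {1}ea' (linsum (b2 _)) scaler_sumr.
by apply: eq_bigr => j _; rewrite (linZ (b2 _)) scalerA.
Qed.
End FinDim.

Notation "x \ox y" := (tpure _ _ x y) (at level 40, left associativity).

Section Bialgebroids.
Variable k : fieldType.

Definition lmulact (L : Type) (A : algType k) (f : L -> A) (l : L) (x : A) : A :=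
  f l * x.
Definition rmulact (L : Type) (A : algType k) (f : L -> A) (l : L) (x : A) : A :=
  x * f l.

(* Left action on X (x) Y induced by one on X. *)
Definition tact1 (L : Type) (X Y : lmodType k) (ra : L -> X -> X)
    (la : L -> Y -> Y) (f : X -> X) (u : tens ra la) : tens ra la :=
  tlift (fun x y => f x \ox y) u.

(* Componentwise product. It is well defined only when u and v lie in the
   Takeuchi product: each multiplicativity axiom below comes with the
   corresponding Takeuchi condition. *)
Definition tmul (L : Type) (A B : algType k) (ra : L -> A -> A)
    (la : L -> B -> B) (u v : tens ra la) : tens ra la :=
  tlift (fun x y => tlift (fun x' y' => (x * x') \ox (y * y')) v) u.

(* The antimultiplicative map lb_t is the algebra map from the opposite of L.
   H (x)_L H identifies t(l) x (x) y with x (x) s(l) y. Both sides of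
   coassociativity are written in H (x)_L (H (x)_L H), the canonical
   reassociation being applied to (Delta (x) id) Delta. *)
Record lbialgebroid (L H : algType k) := LBialgebroid {
  lb_s : {lrmorphism L -> H};
  lb_t : {linear L -> H};
  lb_t1 : lb_t 1 = 1;
  lb_tM : forall a b, lb_t (a * b) = lb_t b * lb_t a;
  lb_stC : forall a b, lb_s a * lb_t b = lb_t b * lb_s a;
  lb_D : {linear H -> tens (lmulact lb_t) (lmulact lb_s)};
  lb_e : {linear H -> L};
  lb_D_bimod : forall l l' x,
    lb_D (lb_s l * lb_t l' * x) =
    tlift (fun x1 x2 => (lb_s l * x1) \ox (lb_t l' * x2)) (lb_D x);
  lb_e_bimod : forall l l' x, lb_e (lb_s l * lb_t l' * x) = l * lb_e x * l';
  lb_counitl : forall x, tlift (fun x1 x2 => lb_s (lb_e x1) * x2) (lb_D x) = x;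
  lb_counitr : forall x, tlift (fun x1 x2 => lb_t (lb_e x2) * x1) (lb_D x) = x;
  lb_coassoc : forall x,
    tlift (fun x1 x2 => tlift (fun y z => y \ox (z \ox x2)) (lb_D x1)) (lb_D x)
    = tlift (fun x1 x2 => x1 \ox lb_D x2) (lb_D x)
    :> tens (lmulact lb_t)
        (fun l => @tact1 _ _ _ (lmulact lb_t) (lmulact lb_s) (lmulact lb_s l));
  lb_takeuchi : forall x l,
    tlift (fun x1 x2 => (x1 * lb_t l) \ox x2) (lb_D x) =
    tlift (fun x1 x2 => x1 \ox (x2 * lb_s l)) (lb_D x)
    :> tens (lmulact lb_t) (lmulact lb_s);
  lb_D1 : lb_D 1 = 1 \ox 1;
  lb_DM : forall x y, lb_D (x * y) = tmul (lb_D x) (lb_D y);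
  lb_e1 : lb_e 1 = 1;
  lb_es : forall x y, lb_e (x * lb_s (lb_e y)) = lb_e (x * y);
  lb_et : forall x y, lb_e (x * lb_t (lb_e y)) = lb_e (x * y)
}.

(* H (x)_R H identifies x s(r) (x) y with x (x) y t(r). *)
Record rbialgebroid (R H : algType k) := RBialgebroid {
  rb_s : {lrmorphism R -> H};
  rb_t : {linear R -> H};
  rb_t1 : rb_t 1 = 1;
  rb_tM : forall a b, rb_t (a * b) = rb_t b * rb_t a;
  rb_stC : forall a b, rb_s a * rb_t b = rb_t b * rb_s a;
  rb_D : {linear H -> tens (rmulact rb_s) (rmulact rb_t)};
  rb_e : {linear H -> R};
  rb_D_bimod : forall r r' x,
    rb_D (x * rb_s r' * rb_t r) =
    tlift (fun x1 x2 => (x1 * rb_t r) \ox (x2 * rb_s r')) (rb_D x);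
  rb_e_bimod : forall r r' x, rb_e (x * rb_s r' * rb_t r) = r * rb_e x * r';
  rb_counitl : forall x, tlift (fun x1 x2 => x2 * rb_t (rb_e x1)) (rb_D x) = x;
  rb_counitr : forall x, tlift (fun x1 x2 => x1 * rb_s (rb_e x2)) (rb_D x) = x;
  rb_coassoc : forall x,
    tlift (fun x1 x2 => tlift (fun y z => y \ox (z \ox x2)) (rb_D x1)) (rb_D x)
    = tlift (fun x1 x2 => x1 \ox rb_D x2) (rb_D x)
    :> tens (rmulact rb_s)
        (fun r => @tact1 _ _ _ (rmulact rb_s) (rmulact rb_t) (rmulact rb_t r));
  rb_takeuchi : forall x r,
    tlift (fun x1 x2 => (rb_s r * x1) \ox x2) (rb_D x) =
    tlift (fun x1 x2 => x1 \ox (rb_t r * x2)) (rb_D x)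
    :> tens (rmulact rb_s) (rmulact rb_t);
  rb_D1 : rb_D 1 = 1 \ox 1;
  rb_DM : forall x y, rb_D (x * y) = tmul (rb_D x) (rb_D y);
  rb_e1 : rb_e 1 = 1;
  rb_es : forall x y, rb_e (rb_s (rb_e x) * y) = rb_e (x * y);
  rb_et : forall x y, rb_e (rb_t (rb_e x) * y) = rb_e (x * y)
}.

(* The mixed coassociativity laws are written in H (x)_L (H (x)_R H) and in
   H (x)_R (H (x)_L H). *)
Record hopf_algebroid (L R H : algType k) := HopfAlgebroid {
  ha_l :> lbialgebroid L H;
  ha_r : rbialgebroid R H;
  ha_S : {linear H -> H};
  ha_sletr : forall r, lb_s ha_l (lb_e ha_l (rb_t ha_r r)) = rb_t ha_r r;
  ha_tlesr : forall r, lb_t ha_l (lb_e ha_l (rb_s ha_r r)) = rb_s ha_r r;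
  ha_sretl : forall l, rb_s ha_r (rb_e ha_r (lb_t ha_l l)) = lb_t ha_l l;
  ha_tresl : forall l, rb_t ha_r (rb_e ha_r (lb_s ha_l l)) = lb_s ha_l l;
  ha_coassoc_lr : forall h,
    tlift (fun a b => tlift (fun x y => x \ox (y \ox b)) (lb_D ha_l a))
      (rb_D ha_r h)
    = tlift (fun a b => a \ox rb_D ha_r b) (lb_D ha_l h)
    :> tens (lmulact (lb_t ha_l))
        (fun l => @tact1 _ _ _ (rmulact (rb_s ha_r)) (rmulact (rb_t ha_r))
                    (lmulact (lb_s ha_l) l));
  ha_coassoc_rl : forall h,
    tlift (fun a b => tlift (fun x y => x \ox (y \ox b)) (rb_D ha_r a))
      (lb_D ha_l h)
    = tlift (fun a b => a \ox lb_D ha_l b) (rb_D ha_r h)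
    :> tens (rmulact (rb_s ha_r))
        (fun r => @tact1 _ _ _ (lmulact (lb_t ha_l)) (lmulact (lb_s ha_l))
                    (rmulact (rb_t ha_r) r));
  ha_S_l : forall l l' h, ha_S (lb_t ha_l l * h * lb_t ha_l l') =
    lb_s ha_l l' * ha_S h * lb_s ha_l l;
  ha_S_r : forall r r' h, ha_S (rb_t ha_r r * h * rb_t ha_r r') =
    rb_s ha_r r' * ha_S h * rb_s ha_r r;
  ha_antipode_l : forall h,
    tlift (fun x y => ha_S x * y) (lb_D ha_l h) = rb_s ha_r (rb_e ha_r h);
  ha_antipode_r : forall h,
    tlift (fun x y => x * ha_S y) (rb_D ha_r h) = lb_s ha_l (lb_e ha_l h)
}.

Record comod_alg (L H : algType k) (B : lbialgebroid L H) (K : algType k) :=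
  ComodAlg {
  ca_s : {lrmorphism L -> K};
  ca_lam : {linear K -> tens (lmulact (lb_t B)) (lmulact ca_s)};
  ca_lamL : forall l x, ca_lam (ca_s l * x) = tact1 (lmulact (lb_s B) l) (ca_lam x);
  ca_counit : forall x,
    tlift (fun h y => ca_s (lb_e B h) * y) (ca_lam x) = x;
  ca_coassoc : forall x,
    tlift (fun h y => tlift (fun h1 h2 => h1 \ox (h2 \ox y)) (lb_D B h)) (ca_lam x)
    = tlift (fun h y => h \ox ca_lam y) (ca_lam x)
    :> tens (lmulact (lb_t B))
        (fun l => @tact1 _ _ _ (lmulact (lb_t B)) (lmulact ca_s)
                    (lmulact (lb_s B) l));
  ca_takeuchi : forall x l,
    tlift (fun h y => (h * lb_t B l) \ox y) (ca_lam x) =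
    tlift (fun h y => h \ox (y * ca_s l)) (ca_lam x)
    :> tens (lmulact (lb_t B)) (lmulact ca_s);
  ca_lam1 : ca_lam 1 = 1 \ox 1;
  ca_lamM : forall x y, ca_lam (x * y) = tmul (ca_lam x) (ca_lam y)
}.

(* Such an I is a k-subspace, as A is unital. *)
Definition two_sided_ideal (A : algType k) (I : A -> Prop) : Prop :=
  [/\ I 0, forall x y, I x -> I y -> I (x + y)
    & forall a x b, I x -> I (a * x * b)].

Definition trivial_ideal (A : algType k) (I : A -> Prop) : Prop :=
  (forall x, I x -> x = 0) \/ (forall x, I x).

(* An algType is nonzero, so only the absence of ideals has to be stated. *)
Definition simple_alg (A : algType k) : Prop :=
  forall I : A -> Prop, two_sided_ideal I -> trivial_ideal I.

(* H (x)_L I is the span of the h (x) i with i in I. *)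
Definition costable (L H : algType k) (B : lbialgebroid L H) (K : algType k)
    (C : comod_alg B K) (I : K -> Prop) : Prop :=
  forall x, I x -> exists s : seq (H * K),
    (forall p, p \in s -> I p.2) /\ ca_lam C x = \sum_(p <- s) p.1 \ox p.2.

Definition H_simple (L H : algType k) (B : lbialgebroid L H) (K : algType k)
    (C : comod_alg B K) : Prop :=
  forall I : K -> Prop, two_sided_ideal I -> costable C I -> trivial_ideal I.

Lemma lb_DL (L H : algType k) (B : lbialgebroid L H) l x :
  lb_D B (lb_s B l * x) = tact1 (lmulact (lb_s B) l) (lb_D B x).
Proof.
have := lb_D_bimod B l 1 x; rewrite lb_t1 mulr1 => ->.
by apply: eq_tlift => a b; rewrite mul1r.
Qed.

Definition regular (L H : algType k) (B : lbialgebroid L H) : comod_alg B H :=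
  {| ca_s := lb_s B; ca_lam := lb_D B; ca_lamL := lb_DL B;
     ca_counit := lb_counitl B; ca_coassoc := lb_coassoc B;
     ca_takeuchi := lb_takeuchi B; ca_lam1 := lb_D1 B; ca_lamM := lb_DM B |}.

End Bialgebroids.

Record lincat (k : fieldType) := LinCat {
  ob :> Type;
  hom : ob -> ob -> lmodType k;
  idm : forall X, hom X X;
  comp : forall X Y Z, hom Y Z -> hom X Y -> hom X Z;
  comp1m : forall X Y (f : hom X Y), comp (idm Y) f = f;
  compm1 : forall X Y (f : hom X Y), comp f (idm X) = f;
  compA : forall X Y Z T (h : hom Z T) (g : hom Y Z) (f : hom X Y),
    comp h (comp g f) = comp (comp h g) f;
  comp_linl : forall X Y Z (f : hom X Y), linear (fun g : hom Y Z => comp g f);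
  comp_linr : forall X Y Z (g : hom Y Z), linear (fun f : hom X Y => comp g f)
}.
Arguments idm {k l} X.
Arguments comp {k l X Y Z} g f.
Notation "g \oc f" := (comp g f) (at level 40, left associativity).

Section LinCatTheory.
Variable k : fieldType.

Section Notions.
Variable C : lincat k.

Definition is_iso (X Y : C) (f : hom X Y) : Prop :=
  exists g : hom Y X, g \oc f = idm X /\ f \oc g = idm Y.

Definition isom (X Y : C) : Prop := exists f : hom X Y, is_iso f.

Definition mono (X Y : C) (f : hom X Y) : Prop :=
  forall T (g h : hom T X), f \oc g = f \oc h -> g = h.

Definition epi (X Y : C) (f : hom X Y) : Prop :=
  forall T (g h : hom Y T), g \oc f = h \oc f -> g = h.

Definition zero_ob (Z : C) : Prop :=
  forall X, (forall f : hom Z X, f = 0) /\ (forall f : hom X Z, f = 0).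

Definition is_biproduct (X Y P : C) (i1 : hom X P) (i2 : hom Y P)
    (p1 : hom P X) (p2 : hom P Y) : Prop :=
  [/\ p1 \oc i1 = idm X, p2 \oc i2 = idm Y, p1 \oc i2 = 0, p2 \oc i1 = 0
    & i1 \oc p1 + i2 \oc p2 = idm P].

Definition is_kernel (A X Y : C) (i : hom A X) (f : hom X Y) : Prop :=
  f \oc i = 0 /\
  forall T (h : hom T X), f \oc h = 0 -> exists! u : hom T A, i \oc u = h.

Definition is_cokernel (X Y Q : C) (f : hom X Y) (p : hom Y Q) : Prop :=
  p \oc f = 0 /\
  forall T (h : hom Y T), h \oc f = 0 -> exists! u : hom Q T, u \oc p = h.

Definition abelian : Prop :=
  [/\ exists Z : C, zero_ob Z,
      forall X Y : C, exists P (i1 : hom X P) (i2 : hom Y P) p1 p2,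
        is_biproduct i1 i2 p1 p2,
      forall (X Y : C) (f : hom X Y),
        (exists A (i : hom A X), is_kernel i f) /\
        (exists Q (p : hom Y Q), is_cokernel f p),
      forall (X Y : C) (f : hom X Y), mono f ->
        exists Z (g : hom Y Z), is_kernel f g
    & forall (X Y : C) (f : hom X Y), epi f ->
        exists Z (g : hom Z X), is_cokernel g f].

Definition short_exact (X Y Z : C) (f : hom X Y) (g : hom Y Z) : Prop :=
  is_kernel f g /\ is_cokernel f g.

Definition projective (P : C) : Prop :=
  forall (X Y : C) (p : hom X Y) (f : hom P Y), epi p ->
    exists g : hom P X, p \oc g = f.

Definition simple_ob (S : C) : Prop :=
  ~ zero_ob S /\
  forall A (i : hom A S), mono i -> zero_ob A \/ is_iso i.

Inductive finite_length : C -> Prop :=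
  | finite_length0 Z : zero_ob Z -> finite_length Z
  | finite_lengthS A X S (i : hom A X) (p : hom X S) :
      finite_length A -> short_exact i p -> simple_ob S -> finite_length X.

Definition finite_cat : Prop :=
  [/\ forall X Y : C, fin_dim (hom X Y),
      forall X : C, finite_length X,
      forall X : C, exists P (p : hom P X), projective P /\ epi p
    & exists n (S : 'I_n -> C), forall T, simple_ob T -> exists i, isom T (S i)].

End Notions.

Record functor (C D : lincat k) := Functor {
  fob :> C -> D;
  fmap : forall X Y : C, hom X Y -> hom (fob X) (fob Y);
  fmap1 : forall X, fmap (idm X) = idm (fob X);
  fmapM : forall X Y Z (g : hom Y Z) (f : hom X Y), fmap (g \oc f) = fmap g \oc fmap f;
  fmap_lin : forall X Y, linear (@fmap X Y)
}.

Definition id_functor (C : lincat k) : functor C C.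
Proof. by exists (fun X => X) (fun X Y f => f). Defined.

Definition comp_functor (C D E : lincat k) (G : functor D E) (F : functor C D) :
  functor C E.
Proof.
exists (fun X => G (F X)) (fun X Y f => fmap G (fmap F f)).
- by move=> X; rewrite !fmap1.
- by move=> X Y Z g f; rewrite !fmapM.
- by move=> X Y a f g; rewrite !fmap_lin.
Defined.

Definition nat_isom (C D : lincat k) (F G : functor C D) : Prop :=
  exists e : forall X, hom (F X) (G X),
    (forall X, is_iso (e X)) /\
    (forall X Y (f : hom X Y), e Y \oc fmap F f = fmap G f \oc e X).

Definition is_equivalence (C D : lincat k) (F : functor C D) : Prop :=
  exists G : functor D C,
    nat_isom (comp_functor G F) (id_functor C) /\
    nat_isom (comp_functor F G) (id_functor D).

Record bifunctor (D M : lincat k) := Bifunctor {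
  bob :> D -> M -> M;
  bmap : forall X X' Y Y', hom X X' -> hom Y Y' -> hom (bob X Y) (bob X' Y');
  bmap1 : forall X Y, bmap (idm X) (idm Y) = idm (bob X Y);
  bmapM : forall X X' X'' Y Y' Y'' (f' : hom X' X'') (f : hom X X')
    (g' : hom Y' Y'') (g : hom Y Y'),
    bmap (f' \oc f) (g' \oc g) = bmap f' g' \oc bmap f g;
  bmap_linl : forall X X' Y Y' (g : hom Y Y'),
    linear (fun f : hom X X' => bmap f g);
  bmap_linr : forall X X' Y Y' (f : hom X X'),
    linear (fun g : hom Y Y' => bmap f g)
}.

Record moncat := MonCat {
  mc_cat :> lincat k;
  mc_ten : bifunctor mc_cat mc_cat;
  mc_unit : mc_cat;
  mc_assoc : forall X Y Z, hom (mc_ten (mc_ten X Y) Z) (mc_ten X (mc_ten Y Z));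
  mc_assoc_iso : forall X Y Z, is_iso (mc_assoc X Y Z);
  mc_assoc_nat : forall X X' Y Y' Z Z' (f : hom X X') (g : hom Y Y') (h : hom Z Z'),
    mc_assoc X' Y' Z' \oc bmap mc_ten (bmap mc_ten f g) h =
    bmap mc_ten f (bmap mc_ten g h) \oc mc_assoc X Y Z;
  mc_lunit : forall X, hom (mc_ten mc_unit X) X;
  mc_lunit_iso : forall X, is_iso (mc_lunit X);
  mc_lunit_nat : forall X X' (f : hom X X'),
    mc_lunit X' \oc bmap mc_ten (idm mc_unit) f = f \oc mc_lunit X;
  mc_runit : forall X, hom (mc_ten X mc_unit) X;
  mc_runit_iso : forall X, is_iso (mc_runit X);
  mc_runit_nat : forall X X' (f : hom X X'),
    mc_runit X' \oc bmap mc_ten f (idm mc_unit) = f \oc mc_runit X;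
  mc_pentagon : forall X Y Z T,
    mc_assoc X Y (mc_ten Z T) \oc mc_assoc (mc_ten X Y) Z T =
    bmap mc_ten (idm X) (mc_assoc Y Z T) \oc mc_assoc X (mc_ten Y Z) T
      \oc bmap mc_ten (mc_assoc X Y Z) (idm T);
  mc_triangle : forall X Y,
    bmap mc_ten (idm X) (mc_lunit Y) \oc mc_assoc X mc_unit Y =
    bmap mc_ten (mc_runit X) (idm Y)
}.

(* Only the k-linear category, the bilinear action and its coherent
   isomorphisms; the abelian and exactness axioms are in [module_category]. *)
Record modcat (D : moncat) := ModCat {
  md_cat :> lincat k;
  md_act : bifunctor D md_cat;
  md_assoc : forall X Y M,
    hom (md_act (mc_ten D X Y) M) (md_act X (md_act Y M));
  md_assoc_iso : forall X Y M, is_iso (md_assoc X Y M);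
  md_assoc_nat : forall X X' Y Y' M M' (f : hom X X') (g : hom Y Y') (h : hom M M'),
    md_assoc X' Y' M' \oc bmap md_act (bmap (mc_ten D) f g) h =
    bmap md_act f (bmap md_act g h) \oc md_assoc X Y M;
  md_unit : forall M, hom (md_act (mc_unit D) M) M;
  md_unit_iso : forall M, is_iso (md_unit M);
  md_unit_nat : forall M M' (f : hom M M'),
    md_unit M' \oc bmap md_act (idm (mc_unit D)) f = f \oc md_unit M;
  md_pentagon : forall X Y Z M,
    md_assoc X Y (md_act Z M) \oc md_assoc (mc_ten D X Y) Z M =
    bmap md_act (idm X) (md_assoc Y Z M) \oc md_assoc X (mc_ten D Y Z) M
      \oc bmap md_act (mc_assoc X Y Z) (idm M);
  md_triangle : forall X M,
    bmap md_act (idm X) (md_unit M) \oc md_assoc X (mc_unit D) M =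
    bmap md_act (mc_runit X) (idm M)
}.

Section ModCatNotions.
Variable D : moncat.

Definition biexact (M : modcat D) : Prop :=
  (forall (X : D) (A B C : M) (f : hom A B) (g : hom B C), short_exact f g ->
     short_exact (bmap (md_act M) (idm X) f) (bmap (md_act M) (idm X) g)) /\
  (forall (A : M) (X Y Z : D) (f : hom X Y) (g : hom Y Z), short_exact f g ->
     short_exact (bmap (md_act M) f (idm A)) (bmap (md_act M) g (idm A))).

Definition module_category (M : modcat D) : Prop := abelian M /\ biexact M.

Definition exact_modcat (M : modcat D) : Prop :=
  finite_cat M /\
  forall (P : D) (A : M), projective P -> projective (md_act M P A).

(* Module functors carry coherent isomorphisms F (X . A) -> X . F A. *)
Definition modcat_equiv (M N : modcat D) : Prop :=
  exists (F : functor M N)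
    (c : forall (X : D) (A : M), hom (F (md_act M X A)) (md_act N X (F A))),
  [/\ forall X A, is_iso (c X A),
      forall X X' A A' (f : hom X X') (g : hom A A'),
        c X' A' \oc fmap F (bmap (md_act M) f g) =
        bmap (md_act N) f (fmap F g) \oc c X A,
      forall X Y A,
        md_assoc X Y (F A) \oc c (mc_ten D X Y) A =
        bmap (md_act N) (idm X) (c Y A) \oc c X (md_act M Y A)
          \oc fmap F (md_assoc X Y A),
      forall A, md_unit (F A) \oc c (mc_unit D) A = fmap F (md_unit A)
    & is_equivalence F].

Definition nontrivial_modcat (M : modcat D) : Prop := exists A : M, ~ zero_ob A.

End ModCatNotions.

Section DirectSum.

Definition prodcat (C D : lincat k) : lincat k.
Proof.
exists (C * D)%type (fun X Y => (hom X.1 Y.1 * hom X.2 Y.2)%type : lmodType k)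
  (fun X => (idm X.1, idm X.2)) (fun X Y Z g f => (g.1 \oc f.1, g.2 \oc f.2)).
- by move=> X Y [f g]; rewrite /= !comp1m.
- by move=> X Y [f g]; rewrite /= !compm1.
- by move=> *; rewrite /= !compA.
- by move=> X Y Z f a g g'; rewrite /= !comp_linl.
- by move=> X Y Z f a g g'; rewrite /= !comp_linr.
Defined.

Lemma prodcat_iso (C D : lincat k) (X Y : prodcat C D) (f : hom X Y) :
  is_iso f.1 -> is_iso f.2 -> is_iso f.
Proof.
move=> [g [e1 e2]] [h [e3 e4]]; exists (g, h); split; congr pair => //.
Qed.

Definition prod_bifunctor (E C D : lincat k) (F : bifunctor E C)
  (G : bifunctor E D) : bifunctor E (prodcat C D).
Proof.
exists (fun X Y => (F X Y.1, G X Y.2) : prodcat C D)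
  (fun X X' Y Y' f g => (bmap F f g.1, bmap G f g.2)).
- by move=> X Y; rewrite /= !bmap1.
- by move=> *; rewrite /= !bmapM.
- by move=> X X' Y Y' g a f f'; rewrite /= !bmap_linl.
- by move=> X X' Y Y' g a f f'; rewrite /= !bmap_linr.
Defined.

Variable D : moncat.

Definition dsum (M N : modcat D) : modcat D.
Proof.
exists (prodcat M N) (prod_bifunctor (md_act M) (md_act N))
  (fun X Y A => (md_assoc X Y A.1, md_assoc X Y A.2))
  (fun A => (md_unit A.1, md_unit A.2)).
- by move=> *; apply: prodcat_iso; exact: md_assoc_iso.
- by move=> *; congr pair; exact: md_assoc_nat.
- by move=> *; apply: prodcat_iso; exact: md_unit_iso.
- by move=> *; congr pair; exact: md_unit_nat.
- by move=> *; congr pair; exact: md_pentagon.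
- by move=> *; congr pair; exact: md_triangle.
Defined.

End DirectSum.

Definition indecomposable (D : moncat) (M : modcat D) : Prop :=
  ~ exists M1 M2 : modcat D,
    [/\ module_category M1, module_category M2, nontrivial_modcat M1,
        nontrivial_modcat M2 & modcat_equiv M (dsum M1 M2)].

End LinCatTheory.

Section Modules.
Variables (k : fieldType) (A : algType k).

Record amod := AMod {
  msort :> lmodType k;
  mact : A -> msort -> msort;
  mact_linl : forall v, linear (mact^~ v);
  mact_linr : forall a, linear (mact a);
  mact1 : forall v, mact 1 v = v;
  mactM : forall a b v, mact (a * b) v = mact a (mact b v);
  mact_fin : fin_dim msort
}.

Section Hom.
Variables X Y : amod.

Definition ahomP : pred (X -> Y) :=
  fun f => `[< linear f /\ forall a v, f (mact a v) = mact a (f v) >].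

Lemma ahom_submod : submod_closed ahomP.
Proof.
have z w : (0 : X -> Y) w = 0 by [].
have e c (f g : X -> Y) w : (c *: f + g) w = c *: f w + g w by [].
split=> [|c f g]; first (apply/asboolP; split=> [a u v|a v]).
- by rewrite !z scaler0 addr0.
- by rewrite !z (lin0 (mact_linr a)).
move=> /asboolP [f1 f2] /asboolP [g1 g2]; apply/asboolP.
split=> [a u v|a v]; rewrite !e.
- by rewrite f1 g1 !scalerDr !scalerA [a * c]mulrC addrACA.
- by rewrite f2 g2 (mact_linr a).
Qed.
HB.instance Definition _ := GRing.isSubmodClosed.Build k (X -> Y) ahomP ahom_submod.

Record ahom := AHom { ahom_fun :> X -> Y; ahom_in : ahomP ahom_fun }.
HB.instance Definition _ := [isSub for ahom_fun].
HB.instance Definition _ := [Choice of ahom by <:].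
HB.instance Definition _ := [SubChoice_isSubLmodule of ahom by <:].

Lemma ahom_lin (f : ahom) : linear f.
Proof. exact: (proj1 (asboolW (ahom_in f))). Qed.
Lemma ahomE (f : ahom) a v : f (mact a v) = mact a (f v).
Proof. exact: (proj2 (asboolW (ahom_in f))). Qed.
Lemma ahom_ext (f g : ahom) : f =1 g -> f = g.
Proof. by move=> h; apply: val_inj; apply: funext. Qed.
Definition mk_ahom (f : X -> Y) (l : linear f)
  (e : forall a v, f (mact a v) = mact a (f v)) : ahom :=
  AHom (introT (asboolP _) (conj l e)).
End Hom.

Definition aid X : ahom X X.
Proof. by apply: (@mk_ahom X X id). Defined.

Definition acomp X Y Z (g : ahom Y Z) (f : ahom X Y) : ahom X Z.
Proof.
apply: (@mk_ahom X Z (g \o f)) => [a u v|a v] /=; first by rewrite !ahom_lin.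
by rewrite !ahomE.
Defined.

Definition mod_cat : lincat k.
Proof.
exists amod (fun X Y => ahom X Y : lmodType k) aid acomp.
- by move=> X Y f; apply: ahom_ext.
- by move=> X Y f; apply: ahom_ext.
- by move=> X Y Z T h g f; apply: ahom_ext.
- by move=> X Y Z f a g g'; apply: ahom_ext.
- move=> X Y Z g a f f'; apply: ahom_ext => v /=; exact: ahom_lin.
Defined.

Lemma mod_iso (X Y : mod_cat) (f : ahom X Y) (g : Y -> X) :
  linear g -> cancel f g -> cancel g f -> is_iso (f : hom X Y).
Proof.
move=> lg fg gf.
have eg a v : g (mact a v) = mact a (g v) by rewrite -{1}[v]gf -ahomE fg.
by exists (mk_ahom lg eg); split; apply: ahom_ext.
Qed.

End Modules.

Section ModuleTensor.
Variables (k : fieldType) (L H : algType k) (B : lbialgebroid L H).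

Lemma act_bal (X : amod H) (K : algType k) (C : comod_alg B K)
    (M : amod K) (x : X) (m : M) :
  balanced (lmulact (lb_t B)) (lmulact (ca_s C))
    (fun h y => (mact h x \ox mact y m)
       : tens (fun l => @mact _ _ X (lb_t B l)) (fun l => @mact _ _ M (ca_s C l))).
Proof.
set ra := fun l => _; set la := fun l => _.
have [b1 b2 b3] := tpure_bal ra la.
split=> [y a h h'|h a y y'|l h y].
- by rewrite mact_linl b1.
- by rewrite mact_linl b2.
- by rewrite /lmulact !mactM b3.
Qed.

Section OverK.
Variables (K : algType k) (C : comod_alg B K).

Definition mtens_sort (X : amod H) (M : amod K) : lmodType k :=
  tens (fun l => @mact _ _ X (lb_t B l)) (fun l => @mact _ _ M (ca_s C l)).

(* k . (x (x) m) = k_(-1) x (x) k_(0) m. *)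
Definition mtens_act (X : amod H) (M : amod K) (a : K) (u : mtens_sort X M) : mtens_sort X M :=
  tlift (fun x m => tlift (fun h y => mact h x \ox mact y m) (ca_lam C a)) u.

Section One.
Variables (X : amod H) (M : amod K).
Let ra := fun l => @mact _ _ X (lb_t B l).
Let la := fun l => @mact _ _ M (ca_s C l).
Let ibal (x : X) (m : M) := act_bal C x m.

Lemma mtens_act_bal a :
  balanced ra la (fun x m => tlift (fun h y => mact h x \ox mact y m) (ca_lam C a)
                    : mtens_sort X M).
Proof.
have [b1 b2 b3] := tpure_bal ra la.
split=> [m|x|l x m].
- apply: tlift_linf => h y c x x'; by rewrite mact_linr b1.
- apply: tlift_linf => h y c m m'; by rewrite mact_linr b2.
have := ca_takeuchi C a l.
move=> /(congr1 (tlift (fun h y => mact h x \ox mact y m : mtens_sort X M))).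
rewrite !(lin_tlift _ _ (tlift_lin (ibal x m))) => e.
transitivity (tlift (fun h y => tlift (fun h y => mact h x \ox mact y m : mtens_sort X M)
   ((h * lb_t B l) \ox y : tens (lmulact (lb_t B)) (lmulact (ca_s C)))) (ca_lam C a)).
  by apply: eq_tlift => h y; rewrite tliftE //= mactM.
by rewrite e; apply: eq_tlift => h y; rewrite tliftE //= mactM.
Qed.

Lemma mtens_actE a x m :
  mtens_act a (x \ox m : mtens_sort X M) =
  tlift (fun h y => mact h x \ox mact y m) (ca_lam C a).
Proof. exact: tliftE (mtens_act_bal a). Qed.

Lemma mtens_act_linr a : linear (@mtens_act X M a).
Proof. exact: tlift_lin (mtens_act_bal a). Qed.

Lemma mtens_act_linl (u : mtens_sort X M) : linear (fun a => mtens_act a u).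
Proof.
apply: tlift_linf => x m c a b.
by rewrite linearP (tlift_lin (ibal x m)).
Qed.

Lemma mtens_act1 (u : mtens_sort X M) : mtens_act 1 u = u.
Proof.
apply: (@tens_ext _ _ _ _ ra la _ (mtens_act 1) id) => // [|x m]; first exact: mtens_act_linr.
by rewrite mtens_actE ca_lam1 (tliftE _ _ (ibal x m)) !mact1.
Qed.

Lemma mtens_actM a b (u : mtens_sort X M) : mtens_act (a * b) u = mtens_act a (mtens_act b u).
Proof.
apply: (@tens_ext _ _ _ _ ra la _ (mtens_act (a * b)) (fun u => mtens_act a (mtens_act b u))).
- exact: mtens_act_linr.
- by move=> c v w; rewrite !mtens_act_linr.
move=> x m; rewrite !mtens_actE ca_lamM (lin_tlift _ _ (mtens_act_linr a)).
rewrite /tmul (lin_tlift _ _ (tlift_lin (ibal x m))).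
transitivity (tlift (fun h y => tlift (fun h' y' =>
    mact h (mact h' x) \ox mact y (mact y' m) : mtens_sort X M) (ca_lam C b)) (ca_lam C a)).
  apply: eq_tlift => h y; rewrite (lin_tlift _ _ (tlift_lin (ibal x m))).
  by apply: eq_tlift => h' y'; rewrite (tliftE _ _ (ibal x m)) !mactM.
transitivity (tlift (fun h' y' => tlift (fun h y =>
    mact h (mact h' x) \ox mact y (mact y' m) : mtens_sort X M) (ca_lam C a)) (ca_lam C b)).
  by rewrite /tlift /tsum exchange_big.
by apply: eq_tlift => h' y'; rewrite mtens_actE.
Qed.

Definition mtens : amod K :=
  AMod mtens_act_linl mtens_act_linr mtens_act1 mtens_actM (fin_dim_tens ra la (mact_fin X) (mact_fin M)).

Lemma mtens_act_s l x m : mact (ca_s C l) (x \ox m : mtens) = mact (lb_s B l) x \ox m.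
Proof.
have e : ca_lam C (ca_s C l) = lb_s B l \ox 1.
  have [b1 b2 b3] := tpure_bal (lmulact (lb_t B)) (lmulact (ca_s C)).
  have bal : balanced (lmulact (lb_t B)) (lmulact (ca_s C)) (fun h y =>
      lmulact (lb_s B) l h \ox y : tens (lmulact (lb_t B)) (lmulact (ca_s C))).
    split=> [y c h h'|h|l' h y]; first by rewrite /lmulact mulrDr -scalerAr b1.
      exact: b2.
    by rewrite -b3 /lmulact mulrA lb_stC -mulrA.
  rewrite -[ca_s C l]mulr1 ca_lamL ca_lam1 /tact1 (tliftE _ _ bal).
  by rewrite /lmulact mulr1.
by rewrite /= mtens_actE e (tliftE _ _ (ibal x m)) mact1.
Qed.

Lemma mtens_mactE a x m :
  mact a (x \ox m : mtens) = tlift (fun h y => mact h x \ox mact y m) (ca_lam C a).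
Proof. exact: mtens_actE. Qed.

End One.

Lemma mtens_ext (X : amod H) (M : amod K) (V : lmodType k) (F G : mtens X M -> V) :
  linear F -> linear G -> (forall x m, F (x \ox m) = G (x \ox m)) -> F =1 G.
Proof. exact: tens_ext. Qed.

Lemma mtens_ahom_ext (X : amod H) (M N : amod K) (F G : ahom (mtens X M) N) :
  (forall x m, F (x \ox m) = G (x \ox m)) -> F = G.
Proof. by move=> e; apply/ahom_ext/mtens_ext => //; exact: ahom_lin. Qed.

Section Maps.
Variables (X X' : amod H) (M M' : amod K) (f : ahom X X') (g : ahom M M').

Definition mtens_map_fun (u : mtens X M) : mtens X' M' := tlift (fun x m => f x \ox g m) u.

Lemma mtens_map_bal :
  balanced (fun l => @mact _ _ X (lb_t B l)) (fun l => @mact _ _ M (ca_s C l))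
    (fun x m => f x \ox g m : mtens X' M').
Proof.
have [b1 b2 b3] := tpure_bal (fun l => @mact _ _ X' (lb_t B l))
   (fun l => @mact _ _ M' (ca_s C l)).
split=> [m c x x'|x c m m'|l x m]; rewrite ?ahom_lin ?ahomE ?b1 ?b2 ?b3 //.
Qed.

Lemma mtens_map_lin : linear mtens_map_fun.
Proof. exact: tlift_lin mtens_map_bal. Qed.
Lemma mtens_map_funE x m : mtens_map_fun (x \ox m) = f x \ox g m.
Proof. exact: tliftE mtens_map_bal. Qed.

Lemma mtens_map_act a u : mtens_map_fun (mact a u) = mact a (mtens_map_fun u).
Proof.
apply: (@mtens_ext _ _ _ (fun u => mtens_map_fun (mact a u))
  (fun u => mact a (mtens_map_fun u))) => [c v w|c v w|x m].
- by rewrite mact_linr mtens_map_lin.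
- by rewrite mtens_map_lin mact_linr.
rewrite mtens_map_funE /= !mtens_actE (lin_tlift _ _ mtens_map_lin).
by apply: eq_tlift => h y; rewrite mtens_map_funE !ahomE.
Qed.

Definition mtens_map : ahom (mtens X M) (mtens X' M') := mk_ahom mtens_map_lin mtens_map_act.

Lemma mtens_mapE x m : mtens_map (x \ox m) = f x \ox g m.
Proof. exact: mtens_map_funE. Qed.

End Maps.

Definition mtens_bif : bifunctor (mod_cat H) (mod_cat K).
Proof.
exists (mtens : mod_cat H -> mod_cat K -> mod_cat K) mtens_map.
- by move=> X M; apply: mtens_ahom_ext => x m; rewrite mtens_mapE.
- by move=> *; apply: mtens_ahom_ext => x m; rewrite mtens_mapE /= !mtens_map_funE.
- move=> X X' M M' g a f f'; apply: mtens_ahom_ext => x m.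
  rewrite -[RHS]/(a *: mtens_map f g (x \ox m) + mtens_map f' g (x \ox m)) !mtens_mapE.
  by have [b _ _] := tpure_bal (fun l => @mact _ _ X' (lb_t B l))
    (fun l => @mact _ _ M' (ca_s C l)); rewrite -b.
- move=> X X' M M' f a g g'; apply: mtens_ahom_ext => x m.
  rewrite -[RHS]/(a *: mtens_map f g (x \ox m) + mtens_map f g' (x \ox m)) !mtens_mapE.
  by have [_ b _] := tpure_bal (fun l => @mact _ _ X' (lb_t B l))
    (fun l => @mact _ _ M' (ca_s C l)); rewrite -b.
Defined.

End OverK.
End ModuleTensor.

Section Coherence.
Variables (k : fieldType) (L H : algType k) (B : lbialgebroid L H).
Local Notation Rg := (regular B).

Lemma lb_D_t l : lb_D B (lb_t B l) = 1 \ox lb_t B l.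
Proof.
have [b1 b2 b3] := tpure_bal (lmulact (lb_t B)) (lmulact (lb_s B)).
have bal : balanced (lmulact (lb_t B)) (lmulact (lb_s B)) (fun h h' =>
    (lb_s B 1 * h) \ox (lb_t B l * h') : tens (lmulact (lb_t B)) (lmulact (lb_s B))).
  split=> [y' c h h'|h c y' y''|l' h h']; rewrite !rmorph1 !mul1r ?b1 //.
    by rewrite mulrDr -scalerAr b2.
  by rewrite b3 /lmulact !mulrA lb_stC.
rewrite -[lb_t B l]mulr1 -[lb_t B l]mul1r -{1}(rmorph1 (lb_s B)) lb_D_bimod lb_D1.
by rewrite (tliftE _ _ bal) rmorph1 !mulr1 !mul1r.
Qed.

Lemma mtens_act_t (X Y : amod H) l x y :
  mact (lb_t B l) (x \ox y : mtens Rg X Y) = x \ox mact (lb_t B l) y.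
Proof.
by rewrite mtens_mactE /= lb_D_t (tliftE _ _ (act_bal Rg x y)) mact1.
Qed.

Section OverK.
Variables (K : algType k) (C : comod_alg B K).

Lemma tact1_bal l : balanced (lmulact (lb_t B)) (lmulact (ca_s C)) (fun h y =>
  lmulact (lb_s B) l h \ox y : tens (lmulact (lb_t B)) (lmulact (ca_s C))).
Proof.
have [b1 b2 b3] := tpure_bal (lmulact (lb_t B)) (lmulact (ca_s C)).
split=> [y c h h'|h|l' h y]; first by rewrite /lmulact mulrDr -scalerAr b1.
  exact: b2.
by rewrite -b3 /lmulact mulrA lb_stC -mulrA.
Qed.

Section Assoc.
Variables (X Y : amod H) (M : amod K).
Local Notation XYM1 := (mtens C (mtens Rg X Y) M).
Local Notation XYM2 := (mtens C X (mtens C Y M)).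

Lemma mtens_assoc_bal1 m : balanced (fun l => @mact _ _ X (lb_t B l))
  (fun l => @mact _ _ Y (lb_s B l))
  (fun x y => x \ox (y \ox m : mtens C Y M) : XYM2).
Proof.
have [b1 b2 b3] := tpure_bal (fun l => @mact _ _ X (lb_t B l))
  (fun l => @mact _ _ (mtens C Y M) (ca_s C l)).
have [c1 c2 c3] := tpure_bal (fun l => @mact _ _ Y (lb_t B l))
  (fun l => @mact _ _ M (ca_s C l)).
split=> [y|x a y y'|l x y]; first exact: b1; first by rewrite c1 b2.
by rewrite b3 mtens_act_s.
Qed.

Lemma mtens_assoc_bal : balanced (fun l => @mact _ _ (mtens Rg X Y) (lb_t B l))
  (fun l => @mact _ _ M (ca_s C l))
  (fun v m => tlift (fun x y => x \ox (y \ox m : mtens C Y M) : XYM2) v).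
Proof.
have [b1 b2 b3] := tpure_bal (fun l => @mact _ _ X (lb_t B l))
  (fun l => @mact _ _ (mtens C Y M) (ca_s C l)).
have [c1 c2 c3] := tpure_bal (fun l => @mact _ _ Y (lb_t B l))
  (fun l => @mact _ _ M (ca_s C l)).
have li m := tlift_lin (mtens_assoc_bal1 m).
split=> [m|v|l v m].
- exact: li.
- by apply: tlift_linf => x y a m m'; rewrite c2 b2.
move: v; apply: (@mtens_ext _ _ _ _ _ Rg X Y _
  (fun v => tlift _ (mact _ v)) (tlift _)) => [a v w||x y].
- by rewrite mact_linr (li m).
- exact: li.
by rewrite mtens_act_t (tliftE _ _ (mtens_assoc_bal1 m)) (tliftE _ _ (mtens_assoc_bal1 _)) c3.
Qed.

Definition mtens_assoc_fun (u : XYM1) : XYM2 :=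
  tlift (fun v m => tlift (fun x y => x \ox (y \ox m : mtens C Y M) : XYM2) v) u.

Lemma mtens_assoc_lin : linear mtens_assoc_fun.
Proof. exact: tlift_lin mtens_assoc_bal. Qed.

Lemma mtens_assoc_funE x y m :
  mtens_assoc_fun ((x \ox y : mtens Rg X Y) \ox m) = x \ox (y \ox m : mtens C Y M).
Proof. by rewrite [LHS](tliftE _ _ mtens_assoc_bal) (tliftE _ _ (mtens_assoc_bal1 m)). Qed.

Lemma mtens_assoc_ext (V : lmodType k) (F G : XYM1 -> V) : linear F -> linear G ->
  (forall x y m, F ((x \ox y : mtens Rg X Y) \ox m) =
                 G ((x \ox y : mtens Rg X Y) \ox m)) -> F =1 G.
Proof.
move=> lF lG e; apply: mtens_ext => // v m.
have [c1 c2 c3] := tpure_bal (fun l => @mact _ _ (mtens Rg X Y) (lb_t B l))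
  (fun l => @mact _ _ M (ca_s C l)).
by move: v; apply: mtens_ext => // a v w; rewrite c1 ?lF ?lG.
Qed.

Lemma mtens_assoc_ext2 (V : lmodType k) (F G : XYM2 -> V) : linear F -> linear G ->
  (forall x y m, F (x \ox (y \ox m : mtens C Y M)) =
                 G (x \ox (y \ox m : mtens C Y M))) -> F =1 G.
Proof.
move=> lF lG e; apply: mtens_ext => // x w.
have [c1 c2 c3] := tpure_bal (fun l => @mact _ _ X (lb_t B l))
  (fun l => @mact _ _ (mtens C Y M) (ca_s C l)).
by move: w; apply: mtens_ext => // a v w; rewrite c2 ?lF ?lG.
Qed.

Lemma mtens_assoc_act a u : mtens_assoc_fun (mact a u) = mact a (mtens_assoc_fun u).
Proof.
apply: (@mtens_assoc_ext _ (fun u => mtens_assoc_fun (mact a u))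
  (fun u => mact a (mtens_assoc_fun u))) => [c v w|c v w|x y m].
- by rewrite mact_linr mtens_assoc_lin.
- by rewrite mtens_assoc_lin mact_linr.
pose psi (v : tens (lmulact (lb_t B)) (lmulact (ca_s C))) : mtens C Y M :=
  tlift (fun h k' => mact h y \ox mact k' m) v.
have lpsi : linear psi := tlift_lin (act_bal C y m).
have psiE h k' : psi (h \ox k') = mact h y \ox mact k' m.
  exact: tliftE (act_bal C y m).
have [b1 b2 b3] := tpure_bal (fun l => @mact _ _ X (lb_t B l))
  (fun l => @mact _ _ (mtens C Y M) (ca_s C l)).
have [c1 c2 c3] := tpure_bal (fun l => @mact _ _ (mtens Rg X Y) (lb_t B l))
  (fun l => @mact _ _ M (ca_s C l)).
have balPhi : balanced (lmulact (lb_t B))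
    (fun l => @tact1 _ _ _ _ (lmulact (lb_t B)) (lmulact (ca_s C)) (lmulact (lb_s B) l))
    (fun h v => mact h x \ox psi v : XYM2).
  split=> [v c h h'|h c v v'|l h v]; rewrite ?mact_linl ?lpsi ?b1 ?b2 //.
  rewrite /lmulact mactM b3; congr (_ \ox _).
  move: v; apply: (@tens_ext _ _ _ _ _ _ _ (fun v => mact _ (psi v))
    (fun v => psi (tact1 _ v))) => [c v w|c v w|h' k'].
  - by rewrite lpsi mact_linr.
  - by rewrite /tact1 (tlift_lin (tact1_bal l)) lpsi.
  by rewrite /tact1 (tliftE _ _ (tact1_bal l)) !psiE mtens_act_s mactM.
have lPhi := tlift_lin balPhi.
rewrite mtens_assoc_funE !mtens_mactE (lin_tlift _ _ mtens_assoc_lin).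
transitivity (tlift (fun h v => mact h x \ox psi v : XYM2)
  (tlift (fun h k' => h \ox ca_lam C k') (ca_lam C a)
   : tens (lmulact (lb_t B)) (fun l => @tact1 _ _ _ _ (lmulact (lb_t B))
       (lmulact (ca_s C)) (lmulact (lb_s B) l)))); last first.
  rewrite (lin_tlift _ _ lPhi); apply: eq_tlift => h k'.
  by rewrite (tliftE _ _ balPhi) mtens_mactE.
rewrite -ca_coassoc (lin_tlift _ _ lPhi); apply: eq_tlift => h k'.
rewrite (lin_tlift _ _ lPhi) mtens_mactE.
rewrite (@lin_tlift _ _ _ _ _ _ _ _
  (fun v : mtens Rg X Y => mtens_assoc_fun (v \ox mact k' m))); last first.
  by move=> c v w; rewrite c1 mtens_assoc_lin.
by apply: eq_tlift => h1 h2; rewrite (tliftE _ _ balPhi) psiE mtens_assoc_funE.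
Qed.

Definition mtens_assoc : ahom XYM1 XYM2 := mk_ahom mtens_assoc_lin mtens_assoc_act.

Lemma mtens_assocE x y m :
  mtens_assoc ((x \ox y : mtens Rg X Y) \ox m) = x \ox (y \ox m : mtens C Y M).
Proof. exact: mtens_assoc_funE. Qed.

Lemma mtens_assoc_ahom_ext (N : amod K) (F G : ahom XYM1 N) :
  (forall x y m, F ((x \ox y : mtens Rg X Y) \ox m) =
                 G ((x \ox y : mtens Rg X Y) \ox m)) -> F = G.
Proof. by move=> e; apply/ahom_ext/mtens_assoc_ext => //; exact: ahom_lin. Qed.

Lemma mtens_assoc_inv_bal1 x : balanced (fun l => @mact _ _ Y (lb_t B l))
  (fun l => @mact _ _ M (ca_s C l))
  (fun y m => (x \ox y : mtens Rg X Y) \ox m : XYM1).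
Proof.
have [b1 b2 b3] := tpure_bal (fun l => @mact _ _ X (lb_t B l))
  (fun l => @mact _ _ Y (ca_s Rg l)).
have [c1 c2 c3] := tpure_bal (fun l => @mact _ _ (mtens Rg X Y) (lb_t B l))
  (fun l => @mact _ _ M (ca_s C l)).
split=> [m a y y'|y|l y m]; first by rewrite b2 c1.
  exact: c2.
by rewrite -c3 mtens_act_t.
Qed.

Lemma mtens_assoc_inv_bal : balanced (fun l => @mact _ _ X (lb_t B l))
  (fun l => @mact _ _ (mtens C Y M) (ca_s C l))
  (fun x w => tlift (fun y m => (x \ox y : mtens Rg X Y) \ox m : XYM1) w).
Proof.
have [b1 b2 b3] := tpure_bal (fun l => @mact _ _ X (lb_t B l))
  (fun l => @mact _ _ Y (ca_s Rg l)).
have [c1 c2 c3] := tpure_bal (fun l => @mact _ _ (mtens Rg X Y) (lb_t B l))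
  (fun l => @mact _ _ M (ca_s C l)).
have li x := tlift_lin (mtens_assoc_inv_bal1 x).
split=> [w|x|l x w].
- by apply: tlift_linf => y m a x x'; rewrite b1 c1.
- exact: li.
move: w; apply: (@mtens_ext _ _ _ _ _ C Y M _
  (tlift _) (fun v => tlift _ (mact _ v))) => [|a v w|y m].
- exact: li.
- by rewrite mact_linr (li x).
by rewrite mtens_act_s (tliftE _ _ (mtens_assoc_inv_bal1 x)) (tliftE _ _ (mtens_assoc_inv_bal1 _)) b3.
Qed.

Lemma mtens_assoc_iso : is_iso (mtens_assoc : @hom _ (mod_cat K) XYM1 XYM2).
Proof.
pose g (u : XYM2) : XYM1 :=
  tlift (fun x w => tlift (fun y m => (x \ox y : mtens Rg X Y) \ox m : XYM1) w) u.
have lg : linear g := tlift_lin mtens_assoc_inv_bal.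
have gE x y m : g (x \ox (y \ox m : mtens C Y M)) = (x \ox y : mtens Rg X Y) \ox m.
  by rewrite /g (tliftE _ _ mtens_assoc_inv_bal) (tliftE _ _ (mtens_assoc_inv_bal1 x)).
apply: (@mod_iso _ _ _ _ _ g lg).
- apply: mtens_assoc_ext => // [a u v|x y m]; first by rewrite ahom_lin lg.
  by rewrite mtens_assocE gE.
- apply: mtens_assoc_ext2 => // [a u v|x y m]; first by rewrite lg ahom_lin.
  by rewrite gE mtens_assocE.
Qed.

End Assoc.
End OverK.
End Coherence.

Section BialgebroidFacts.
Variables (k : fieldType) (L H : algType k) (B : lbialgebroid L H).

Lemma lb_e_sM l x : lb_e B (lb_s B l * x) = l * lb_e B x.
Proof. by have := lb_e_bimod B l 1 x; rewrite lb_t1 !mulr1. Qed.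
Lemma lb_e_tM l x : lb_e B (lb_t B l * x) = lb_e B x * l.
Proof. by have := lb_e_bimod B 1 l x; rewrite rmorph1 !mul1r. Qed.
Lemma lb_e_s l : lb_e B (lb_s B l) = l.
Proof. by rewrite -[lb_s B l]mulr1 lb_e_sM lb_e1 mulr1. Qed.
Lemma lb_e_Mt l x : lb_e B (x * lb_t B l) = lb_e B (x * lb_s B l).
Proof. by rewrite -{1}[l](lb_e_s l) lb_et -lb_es lb_e_s. Qed.

Lemma counitr_bal : balanced (lmulact (lb_t B)) (lmulact (lb_s B))
  (fun x1 x2 => lb_t B (lb_e B x2) * x1).
Proof.
split=> [y a x x'|x a y y'|l x y]; first by rewrite mulrDr scalerAr.
  by rewrite !linearP mulrDl scalerAl.
by rewrite /lmulact lb_e_sM lb_tM mulrA.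
Qed.

Variables (K : algType k) (C : comod_alg B K).

Lemma counitl_bal : balanced (lmulact (lb_t B)) (lmulact (ca_s C))
  (fun h y => ca_s C (lb_e B h) * y).
Proof.
split=> [y a x x'|x a y y'|l x y].
- by rewrite !linearP mulrDl scalerAl.
- by rewrite mulrDr scalerAr.
by rewrite /lmulact lb_e_tM rmorphM -mulrA.
Qed.

Lemma rmul_bal (c : H) (d : K) : balanced (lmulact (lb_t B)) (lmulact (ca_s C))
  (fun h y => (h * c) \ox (y * d) : tens (lmulact (lb_t B)) (lmulact (ca_s C))).
Proof.
have [b1 b2 b3] := tpure_bal (lmulact (lb_t B)) (lmulact (ca_s C)).
split=> [y a x x'|x a y y'|l x y]; first by rewrite mulrDl -scalerAl b1.
  by rewrite mulrDl -scalerAl b2.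
by rewrite /lmulact -!mulrA b3.
Qed.

Lemma ca_lamM_pure (x y : K) c d : ca_lam C y = c \ox d ->
  ca_lam C (x * y) = tlift (fun h z => (h * c) \ox (z * d)) (ca_lam C x).
Proof.
move=> e; rewrite ca_lamM e /tmul.
have [b1 b2 b3] := tpure_bal (lmulact (lb_t B)) (lmulact (ca_s C)).
pose f (c : H) (d : K) := tlift (fun h z => (h * c) \ox (z * d)) (ca_lam C x)
  : tens (lmulact (lb_t B)) (lmulact (ca_s C)).
transitivity (tlift f (c \ox d : tens (lmulact (lb_t B)) (lmulact (ca_s C)))).
  by rewrite /f /tlift /tsum exchange_big.
apply: tliftE; split=> [d'|c'|l c' d'].
- by apply: tlift_linf => h z a u v; rewrite mulrDr -scalerAr b1.
- by apply: tlift_linf => h z a u v; rewrite mulrDr -scalerAr b2.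
have := congr1 (tlift (fun h y => (h * c') \ox (y * d')
   : tens (lmulact (lb_t B)) (lmulact (ca_s C)))) (ca_takeuchi C x l).
rewrite !(lin_tlift _ _ (tlift_lin (rmul_bal c' d'))) => e'.
rewrite /f; transitivity (tlift (fun h y => tlift (fun h y => (h * c') \ox (y * d')
   : tens (lmulact (lb_t B)) (lmulact (ca_s C)))
   ((h * lb_t B l) \ox y : tens (lmulact (lb_t B)) (lmulact (ca_s C))))
     (ca_lam C x)).
  by apply: eq_tlift => h z; rewrite (tliftE _ _ (rmul_bal c' d')) /lmulact mulrA.
rewrite e'; apply: eq_tlift => h z.
by rewrite (tliftE _ _ (rmul_bal c' d')) /lmulact mulrA.
Qed.

End BialgebroidFacts.

Section Unit.
Variables (k : fieldType) (L : algType k) (H : falgType k) (B : lbialgebroid L H).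

Lemma umod_fin : fin_dim L.
Proof.
apply: (@fin_dim_surj _ _ _ (lb_e B)); [exact: linearP | | exact: fin_dim_vect].
by move=> l; exists (lb_s B l); rewrite lb_e_s.
Qed.

(* L as an H-module, the unit object: h . l = epsilon(h s(l)). *)
Definition umod : amod H.
Proof.
apply: (@AMod _ _ L (fun h l => lb_e B (h * lb_s B l))) => [l a x y|h a x y|l|g h l|].
- by rewrite mulrDl -scalerAl linearP.
- by rewrite linearP mulrDr -scalerAr linearP.
- by rewrite mul1r lb_e_s.
- by rewrite lb_es mulrA.
- exact: umod_fin.
Defined.

Section OverK.
Variables (K : algType k) (C : comod_alg B K) (M : amod K).

Lemma lunit_bal : balanced (fun l => @mact _ _ umod (lb_t B l))
  (fun l => @mact _ _ M (ca_s C l)) (fun (l : umod) m => mact (ca_s C l) m).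
Proof.
split=> [m a l l'|l|l l' m]; first by rewrite linearP mact_linl.
  exact: mact_linr.
by rewrite /= lb_e_tM lb_e_s rmorphM mactM.
Qed.

Definition lunit_fun (u : mtens C umod M) : M :=
  tlift (fun (l : umod) m => mact (ca_s C l) m) u.

Lemma lunit_lin : linear lunit_fun.
Proof. exact: tlift_lin lunit_bal. Qed.
Lemma lunit_funE l m : lunit_fun (l \ox m) = mact (ca_s C l) m.
Proof. exact: tliftE lunit_bal. Qed.

Lemma lunit_act a u : lunit_fun (mact a u) = mact a (lunit_fun u).
Proof.
move: u; apply: (@mtens_ext _ _ _ _ _ C umod M _ (fun u => lunit_fun (mact a u))
  (fun u => mact a (lunit_fun u))) => [c v w|c v w|l m].
- by rewrite mact_linr lunit_lin.
- by rewrite lunit_lin mact_linr.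
rewrite lunit_funE mtens_mactE (lin_tlift _ _ lunit_lin) -mactM.
have e : ca_lam C (ca_s C l) = lb_s B l \ox 1.
  rewrite -[ca_s C l]mulr1 ca_lamL ca_lam1 /tact1 (tliftE _ _ (tact1_bal C l)).
  by rewrite /lmulact mulr1.
rewrite -[a * _](ca_counit C) (ca_lamM_pure a e).
rewrite (lin_tlift _ _ (tlift_lin (counitl_bal C))).
rewrite (@lin_tlift _ _ _ _ _ _ _ _ (fun y => mact y m)); last exact: mact_linl.
apply: eq_tlift => h y.
by rewrite lunit_funE (tliftE _ _ (counitl_bal C)) mulr1 mactM.
Qed.

Definition lunit : ahom (mtens C umod M) M := mk_ahom lunit_lin lunit_act.

Lemma lunit_iso : is_iso (lunit : @hom _ (mod_cat K) (mtens C umod M) M).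
Proof.
have [b1 b2 b3] := tpure_bal (fun l => @mact _ _ umod (lb_t B l))
  (fun l => @mact _ _ M (ca_s C l)).
pose g (m : M) : mtens C umod M := (1 : L) \ox m.
have lg : linear g by exact: b2.
apply: (@mod_iso _ _ _ _ _ g lg) => [|m].
  apply: (@mtens_ext _ _ _ _ _ C umod M _ (g \o lunit) id) => [a u v||l m] //.
    by rewrite /= lunit_lin lg.
  by rewrite /= lunit_funE /g -b3 /= rmorph1 mulr1 -[lb_t B l]mulr1 lb_e_tM lb_e1 mul1r.
by rewrite /= lunit_funE rmorph1 mact1.
Qed.

End OverK.

Section Right.
Variable X : amod H.
Local Notation Rg := (regular B).

Lemma runit_bal : balanced (fun l => @mact _ _ X (lb_t B l))
  (fun l => @mact _ _ umod (ca_s Rg l)) (fun x (l : umod) => mact (lb_t B l) x).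
Proof.
split=> [l|x a l l'|l x l']; first exact: mact_linr.
  by rewrite linearP mact_linl.
by rewrite /= lb_e_sM lb_e_s lb_tM mactM.
Qed.

Definition runit_fun (u : mtens Rg X umod) : X :=
  tlift (fun x (l : umod) => mact (lb_t B l) x) u.

Lemma runit_lin : linear runit_fun.
Proof. exact: tlift_lin runit_bal. Qed.
Lemma runit_funE x l : runit_fun (x \ox l) = mact (lb_t B l) x.
Proof. exact: tliftE runit_bal. Qed.

Lemma runit_act a u : runit_fun (mact a u) = mact a (runit_fun u).
Proof.
move: u; apply: (@mtens_ext _ _ _ _ _ Rg X umod _ (fun u => runit_fun (mact a u))
  (fun u => mact a (runit_fun u))) => [c v w|c v w|x l].
- by rewrite mact_linr runit_lin.
- by rewrite runit_lin mact_linr.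
rewrite runit_funE mtens_mactE (lin_tlift _ _ runit_lin) -mactM.
rewrite -[a * _](lb_counitr B).
rewrite (ca_lamM_pure (C := Rg) a (lb_D_t B l)).
rewrite (lin_tlift _ _ (tlift_lin (counitr_bal B))).
rewrite (@lin_tlift _ _ _ _ _ _ _ _ (fun y => mact y x)); last exact: mact_linl.
apply: eq_tlift => h y.
by rewrite runit_funE (tliftE _ _ (counitr_bal B)) mulr1 mactM lb_e_Mt.
Qed.

Definition runit : ahom (mtens Rg X umod) X := mk_ahom runit_lin runit_act.

Lemma runit_iso : is_iso (runit : @hom _ (mod_cat H) (mtens Rg X umod) X).
Proof.
have [b1 b2 b3] := tpure_bal (fun l => @mact _ _ X (lb_t B l))
  (fun l => @mact _ _ umod (ca_s Rg l)).
pose g (x : X) : mtens Rg X umod := x \ox (1 : L).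
have lg : linear g by exact: b1.
apply: (@mod_iso _ _ _ _ _ g lg) => [|x].
  apply: (@mtens_ext _ _ _ _ _ Rg X umod _ (g \o runit) id) => [a u v||x l] //.
    by rewrite /= runit_lin lg.
  by rewrite /= runit_funE /g b3 /= rmorph1 mulr1 lb_e_s.
by rewrite /= runit_funE lb_t1 mact1.
Qed.

End Right.

Section CoherenceLaws.
Variables (K : algType k) (C : comod_alg B K).
Local Notation Rg := (regular B).
Lemma mtens_assoc_nat (X X' Y Y' : mod_cat H) (M M' : mod_cat K)
    (f : hom X X') (g : hom Y Y') (h : hom M M') :
  (mtens_assoc C X' Y' M' : hom (mtens_bif C _ _) (mtens_bif C _ (mtens_bif C _ _)))
    \oc bmap (mtens_bif C) (bmap (mtens_bif Rg) f g) h =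
  bmap (mtens_bif C) f (bmap (mtens_bif C) g h) \oc mtens_assoc C X Y M.
Proof.
apply: mtens_assoc_ahom_ext => x y m.
by rewrite /= !mtens_map_funE mtens_mapE !mtens_assoc_funE mtens_map_funE mtens_mapE.
Qed.

Lemma lunit_nat (M M' : mod_cat K) (f : hom M M') :
  (lunit C M' : hom (mtens_bif C _ _) _) \oc bmap (mtens_bif C) (idm (umod : mod_cat H)) f =
  f \oc lunit C M.
Proof.
apply: mtens_ahom_ext => l m.
by rewrite /= mtens_map_funE !lunit_funE ahomE.
Qed.

Lemma mtens_assoc_ahom_ext3 (X Y Z : amod H) (M N : amod K)
    (F G : ahom (mtens C (mtens Rg (mtens Rg X Y) Z) M) N) :
  (forall x y z m,
     F (((x \ox y : mtens Rg X Y) \ox z : mtens Rg (mtens Rg X Y) Z) \ox m) =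
     G (((x \ox y : mtens Rg X Y) \ox z : mtens Rg (mtens Rg X Y) Z) \ox m)) -> F = G.
Proof.
move=> e; apply: mtens_assoc_ahom_ext => u z m.
have [b1 _ _] := tpure_bal (fun l => @mact _ _ (mtens Rg X Y) (lb_t B l))
  (fun l => @mact _ _ Z (ca_s Rg l)).
have [c1 _ _] := tpure_bal (fun l => @mact _ _ (mtens Rg (mtens Rg X Y) Z) (lb_t B l))
  (fun l => @mact _ _ M (ca_s C l)).
by move: u; apply: mtens_ext => // a v w; rewrite b1 c1 ahom_lin.
Qed.

Lemma mtens_pentagon (X Y Z : mod_cat H) (M : mod_cat K) :
  (mtens_assoc C X Y (mtens_bif C Z M) : hom (mtens_bif C _ _) (mtens_bif C _ (mtens_bif C _ _)))
    \oc mtens_assoc C (mtens_bif Rg X Y) Z M =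
  bmap (mtens_bif C) (idm X) (mtens_assoc C Y Z M) \oc mtens_assoc C X (mtens_bif Rg Y Z) M
    \oc bmap (mtens_bif C) (mtens_assoc Rg X Y Z) (idm M).
Proof.
apply: mtens_assoc_ahom_ext3 => x y z m.
by rewrite /= !(mtens_map_funE, mtens_assoc_funE, mtens_assocE, mtens_mapE).
Qed.

Lemma mtens_triangle (X : mod_cat H) (M : mod_cat K) :
  bmap (mtens_bif C) (idm X) (lunit C M) \oc mtens_assoc C X umod M =
  bmap (mtens_bif C) (runit X : hom (mtens_bif Rg _ _) _) (idm M).
Proof.
apply: mtens_assoc_ahom_ext => x l m.
rewrite /= mtens_assoc_funE !mtens_map_funE.
rewrite /= lunit_funE runit_funE.
have [b1 b2 b3] := tpure_bal (fun l => @mact _ _ X (lb_t B l))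
  (fun l => @mact _ _ M (ca_s C l)).
by rewrite b3.
Qed.

End CoherenceLaws.

Lemma runit_nat (X X' : mod_cat H) (f : hom X X') :
  (runit X' : hom (mtens_bif (regular B) _ _) _)
    \oc bmap (mtens_bif (regular B)) f (idm (umod : mod_cat H)) = f \oc runit X.
Proof.
apply: mtens_ahom_ext => x l.
by rewrite /= mtens_map_funE !runit_funE ahomE.
Qed.

Definition rep : moncat k :=
  @MonCat k (mod_cat H) (mtens_bif (regular B)) umod
    (mtens_assoc (regular B)) (mtens_assoc_iso (regular B)) (mtens_assoc_nat (regular B))
    (lunit (regular B)) (lunit_iso (regular B)) (lunit_nat (regular B))
    runit runit_iso runit_nat
    (mtens_pentagon (regular B)) (mtens_triangle (regular B)).

Definition comod_rep (K : algType k) (C : comod_alg B K) : modcat rep :=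
  @ModCat k rep (mod_cat K) (mtens_bif C)
    (mtens_assoc C) (mtens_assoc_iso C) (mtens_assoc_nat C)
    (lunit C) (lunit_iso C) (lunit_nat C)
    (mtens_pentagon C) (mtens_triangle C).

End Unit.

(* Main.v *)
(* Choose a projective generator M0 of M and put P = H (x) M0, again a projective
   generator. Then Hom(P, -) is an equivalence from M to the finite-dimensional
   modules over K = End(P)^op. The comultiplication of H induces a morphism
   delta : P -> H (x) P, and x (x) phi |-> (x (x) phi) delta, with x in X seen as
   the map h |-> h x, is a natural map X (x)_L Hom(P, A) -> Hom(P, X (x) A).
   It is invertible because H-modules have left duals: the dual of X consists of
   the right L-linear maps f : X -> L, h acting by
     (h f)(x) = eps_L(h^(1) s_L(f(S(h^(2)) x))),  Delta_R(h) = h^(1) (x) h^(2),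
   and L, being simple over an algebraically closed field, is separable, which gives
   dual bases. The coaction on K is the preimage of delta k.

   A costable ideal I of K corresponds to a subcategory N of M stable under the
   action. By exactness every object of N is a quotient of one that is projective
   in M, so I = e End(P) for an idempotent e. The objects orthogonal to N are stable
   too, by duality, and the same argument applied to them shows that e is central.
   So M splits as a direct sum, and indecomposability forces e = 0 or e = 1.

   If M is zero, K has to be a nonzero algebra without finite-dimensional modules:
   L (x) k(X) will do. *)
From HB Require Import structures.
From mathcomp Require Import all_boot all_algebra all_field.
From mathcomp Require Import boolp functions fraction.
Require Import Defs.

Set Implicit Arguments.
Unset Strict Implicit.
Unset Printing Implicit Defensive.
Import GRing.Theory.
Local Open Scope ring_scope.

(** * Linear and abelian categories *)

(** With its left regular action, [(H, Delta, eps)] is a comonoid in H-mod, and [delta] makes P the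
    cofree comodule on M0: this is the reason for replacing M0 by H (x) M0. The axioms of the
    comodule algebra K are checked through the comparison maps, which turn them into identities
    between morphisms out of P; those follow from the comonoid and Takeuchi identities of [Delta]. K
    acts on Hom(P, A) by precomposition, whence the opposite multiplication.

    The antipode is only assumed linear, twisted by the base maps and subject to the two antipode
    axioms; it need not be bijective. Its antimultiplicativity, without which the formula for the
    dual would not be an action, has to be derived, and only left duals are available. They suffice:
    with ev : X' (x) X -> L and coev : L -> X (x) X', acting by X' is left adjoint to acting by X,
    so a morphism B -> X . A vanishes as soon as its mate X' . B -> A does. *)

Section LinearCategories.
Variables (k : fieldType) (C : lincat k).
Implicit Types X Y Z T A B : C.

Lemma comp0l X Y Z (f : hom X Y) : (0 : hom Y Z) \oc f = 0.
Proof. exact: lin0 (comp_linl f). Qed.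
Lemma comp0r X Y Z (g : hom Y Z) : g \oc (0 : hom X Y) = 0.
Proof. exact: lin0 (comp_linr g). Qed.
Lemma compDl X Y Z (g h : hom Y Z) (f : hom X Y) : (g + h) \oc f = g \oc f + h \oc f.
Proof. exact: linD (comp_linl f) _ _. Qed.
Lemma compDr X Y Z (g : hom Y Z) (f h : hom X Y) : g \oc (f + h) = g \oc f + g \oc h.
Proof. exact: linD (comp_linr g) _ _. Qed.
Lemma compZl X Y Z a (g : hom Y Z) (f : hom X Y) : (a *: g) \oc f = a *: (g \oc f).
Proof. exact: linZ (comp_linl f) _ _. Qed.
Lemma compZr X Y Z a (g : hom Y Z) (f : hom X Y) : g \oc (a *: f) = a *: (g \oc f).
Proof. exact: linZ (comp_linr g) _ _. Qed.
Lemma compNl X Y Z (g : hom Y Z) (f : hom X Y) : (- g) \oc f = - (g \oc f).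
Proof. by rewrite -scaleN1r compZl scaleN1r. Qed.
Lemma compNr X Y Z (g : hom Y Z) (f : hom X Y) : g \oc (- f) = - (g \oc f).
Proof. by rewrite -scaleN1r compZr scaleN1r. Qed.
Lemma compBl X Y Z (g h : hom Y Z) (f : hom X Y) : (g - h) \oc f = g \oc f - h \oc f.
Proof. by rewrite compDl compNl. Qed.
Lemma compBr X Y Z (g : hom Y Z) (f h : hom X Y) : g \oc (f - h) = g \oc f - g \oc h.
Proof. by rewrite compDr compNr. Qed.
Lemma compsuml X Y Z (f : hom X Y) I (r : seq I) (P : pred I) (E : I -> hom Y Z) :
  (\sum_(i <- r | P i) E i) \oc f = \sum_(i <- r | P i) E i \oc f.
Proof. exact: linsum (comp_linl f) _ _ _ _. Qed.
Lemma compsumr X Y Z (g : hom Y Z) I (r : seq I) (P : pred I) (E : I -> hom X Y) :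
  g \oc (\sum_(i <- r | P i) E i) = \sum_(i <- r | P i) g \oc E i.
Proof. exact: linsum (comp_linr g) _ _ _ _. Qed.

Lemma mono_eq0 X Y Z (i : hom X Y) (h : hom Z X) : mono i -> i \oc h = 0 -> h = 0.
Proof. by move=> mi e; apply: mi; rewrite comp0r. Qed.
Lemma epi_eq0 X Y Z (p : hom X Y) (h : hom Y Z) : epi p -> h \oc p = 0 -> h = 0.
Proof. by move=> mp e; apply: mp; rewrite comp0l. Qed.
Lemma monoP X Y (i : hom X Y) : (forall Z (h : hom Z X), i \oc h = 0 -> h = 0) -> mono i.
Proof.
by move=> h Z f g e; apply/eqP; rewrite -subr_eq0; apply/eqP/h; rewrite compBr e subrr.
Qed.
Lemma epiP X Y (p : hom X Y) : (forall Z (h : hom Y Z), h \oc p = 0 -> h = 0) -> epi p.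
Proof.
by move=> h Z f g e; apply/eqP; rewrite -subr_eq0; apply/eqP/h; rewrite compBl e subrr.
Qed.

Lemma kernel_mono A X Y (i : hom A X) (f : hom X Y) : is_kernel i f -> mono i.
Proof.
move=> [e u]; apply: monoP => Z h ih.
have [v [_ uv]] := u Z 0 (comp0r _ f).
by rewrite -(uv h ih); apply: uv; rewrite comp0r.
Qed.
Lemma cokernel_epi Q X Y (p : hom Y Q) (f : hom X Y) : is_cokernel f p -> epi p.
Proof.
move=> [e u]; apply: epiP => Z h ih.
have [v [_ uv]] := u Z 0 (comp0l _ f).
by rewrite -(uv h ih); apply: uv; rewrite comp0l.
Qed.

Lemma zero_ob_idm X : zero_ob X <-> idm X = 0.
Proof.
split=> [z|e Y]; first exact: (proj1 (z X)).
by split=> f; [rewrite -(compm1 f) e comp0r|rewrite -(comp1m f) e comp0l].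
Qed.

Lemma iso_idm X : is_iso (idm X).
Proof. by exists (idm X); rewrite comp1m. Qed.
Lemma iso_epi X Y (f : hom X Y) : is_iso f -> epi f.
Proof. by move=> [g [_ e]] T h h' /(congr1 (fun u => u \oc g)); rewrite -!compA e !compm1. Qed.
Lemma iso_mono X Y (f : hom X Y) : is_iso f -> mono f.
Proof. by move=> [g [e _]] T h h' /(congr1 (comp g)); rewrite !compA e !comp1m. Qed.
Lemma epi_comp X Y Z (g : hom Y Z) (f : hom X Y) : epi g -> epi f -> epi (g \oc f).
Proof. by move=> eg ef T h h'; rewrite !compA => /ef /eg. Qed.

Definition inv_of X Y (f : hom X Y) (i : is_iso f) : hom Y X := sval (cid i).
Lemma inv_ofK X Y (f : hom X Y) (i : is_iso f) : inv_of i \oc f = idm X.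
Proof. by case: (svalP (cid i)). Qed.
Lemma inv_ofKr X Y (f : hom X Y) (i : is_iso f) : f \oc inv_of i = idm Y.
Proof. by case: (svalP (cid i)). Qed.
Lemma inv_of_iso X Y (f : hom X Y) (i : is_iso f) : is_iso (inv_of i).
Proof. by exists f; rewrite inv_ofK inv_ofKr. Qed.

Record copower (n : nat) X := Copower {
  cp_ob :> C;
  cp_in : 'I_n -> hom X cp_ob;
  cp_out : 'I_n -> hom cp_ob X;
  cp_io : forall i j, cp_out i \oc cp_in j = if i == j then idm X else 0;
  cp_sum : \sum_i cp_in i \oc cp_out i = idm cp_ob
}.

Definition cp_map n X Y (Xn : copower n X) (u : 'I_n -> hom X Y) : hom Xn Y :=
  \sum_i u i \oc cp_out Xn i.
Lemma cp_mapE n X Y (Xn : copower n X) (u : 'I_n -> hom X Y) i :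
  cp_map Xn u \oc cp_in Xn i = u i.
Proof.
rewrite compsuml (bigD1 i) //= big1 => [|j ne]; last first.
  by rewrite -compA cp_io (negbTE ne) comp0r.
by rewrite -compA cp_io eqxx compm1 addr0.
Qed.

Hypothesis abC : abelian C.

Lemma copower_exists n X : exists Xn : copower n X, True.
Proof.
have [[Z zZ] bip _ _ _] := abC.
elim: n => [|n [Xn _]].
  unshelve eexists; last by [].
  apply: (@Copower 0 X Z (fun=> 0) (fun=> 0)) => [[]//|].
  by rewrite big_ord0; apply/esym; rewrite -zero_ob_idm.
have [Q [i1 [i2 [p1 [p2 [e1 e2 e3 e4 e5]]]]]] := bip X Xn.
unshelve eexists; last by [].
apply: (@Copower n.+1 X Q
  (fun i => if unlift ord0 i is Some j then i2 \oc cp_in Xn j else i1)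
  (fun i => if unlift ord0 i is Some j then cp_out Xn j \oc p2 else p1)) => [i j|].
  case: (unliftP ord0 i) => [i'|] ->; case: (unliftP ord0 j) => [j'|] ->.
  - rewrite -compA (compA p2) e2 comp1m cp_io.
    by rewrite (inj_eq (@lift_inj _ _)).
  - by rewrite -compA e4 comp0r eq_sym eq_liftF.
  - by rewrite compA e3 comp0l eq_liftF.
  - by rewrite eqxx.
rewrite big_ord_recl unlift_none -e5; congr (_ + _).
rewrite -{2}(compm1 i2) -cp_sum compsumr compsuml; apply: eq_bigr => i _.
by rewrite liftK !compA.
Qed.

Lemma proj_lift P X Y (p : hom X Y) (f : hom P Y) : projective P -> epi p ->
  exists g, p \oc g = f.
Proof. by move=> pP ep; exact: pP. Qed.

(* In an abelian category every epimorphism is a cokernel, so a morphism killing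
   its kernel factors through it. *)
Lemma epi_factor X Y Z (p : hom X Y) (h : hom X Z) : epi p ->
  (forall T (g : hom T X), p \oc g = 0 -> h \oc g = 0) -> exists h', h' \oc p = h.
Proof.
have [_ _ _ _ ab] := abC; move=> /ab [T [g [e u]]] hk.
by have [v [ev _]] := u _ h (hk _ _ e); exists v.
Qed.

(** Exactness of Hom(P, -) at Y. With i the kernel of q, f factors as i p, and w factors through i.
    If h p = 0 and j is the kernel of h, then i j is the kernel of some g killing f; so g factors
    through q and kills i, j is split epi and h = 0. Thus p is epi and w lifts. *)
Lemma projective_exact P X Y Q (f : hom X Y) (q : hom Y Q) (w : hom P Y) :
  projective P -> is_cokernel f q -> q \oc w = 0 -> exists v, w = f \oc v.
Proof.
move=> pP [qf uq] qw; have [_ _ kc nm _] := abC.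
have [[I [i ki]] _] := kc _ _ q.
have mi := kernel_mono ki.
have [p [ep _]] := proj2 ki _ _ qf.
have [u [eu _]] := proj2 ki _ _ qw.
have epi_p : epi p.
  apply: epiP => Z h hp.
  have [[J [j kj]] _] := kc _ _ h.
  have [p' [ep' _]] := proj2 kj _ _ hp.
  have mij : mono (i \oc j).
    by move=> T a b; rewrite -!compA => /mi /(kernel_mono kj).
  have [W [g [gij ug]]] := nm _ _ _ mij.
  have [g' [eg _]] : exists! g', g' \oc q = g.
    by apply: uq; rewrite -ep -ep' compA compA -(compA g) gij comp0l.
  have [v [ev _]] : exists! v, i \oc j \oc v = i.
    by apply: ug; rewrite -eg -compA (proj1 ki) comp0r.
  have jv : j \oc v = idm I by apply: mi; rewrite compA ev compm1.
  by rewrite -(compm1 h) -jv compA (proj1 kj) comp0l.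
have [v ev] := proj_lift u pP epi_p.
by exists v; rewrite -eu -ev compA ep.
Qed.

(** Generator in the sense that Hom(P, -) is faithful; by linearity it is enough to test against
    0. *)
Definition generates P : Prop :=
  forall X Y (g : hom X Y), (forall u : hom P X, g \oc u = 0) -> g = 0.

Lemma generates_ext P X Y (g h : hom X Y) : generates P ->
  (forall u : hom P X, g \oc u = h \oc u) -> g = h.
Proof.
move=> gP e; apply/eqP; rewrite -subr_eq0; apply/eqP/gP => u.
by rewrite compBl e subrr.
Qed.

Lemma generates_epi P Q (q : hom Q P) : generates P -> epi q -> projective P -> generates Q.
Proof.
move=> gP eq pP X Y g h; apply: gP => u; apply: (epi_eq0 eq).
by rewrite -compA h.
Qed.

Hypothesis finC : finite_cat C.

(** P is the direct sum of projectives covering the simple objects. If g vanishes on all morphisms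
    from P, induct on the length of X: g vanishes on the subobject A, hence factors through the
    simple quotient T, and an epi P -> T lifts to X, so the induced map from T vanishes too. *)
Lemma generator_exists : exists P : C, projective P /\ generates P.
Proof.
have [_ fl ep [n [S hS]]] := finC.
have [[Z zZ] bip _ _ _] := abC.
have main m : (m <= n)%N -> exists P : C, projective P /\
    (forall i : 'I_n, (i < m)%N -> exists f : hom P (S i), epi f).
  elim: m => [_|m IH lt].
    by exists Z; split=> // X Y p f _; exists 0; rewrite comp0r (proj1 (zZ _) f).
  have [P [pP hP]] := IH (ltnW lt).
  have [P' [f' [pP' ef']]] := ep (S (Ordinal lt)).
  have [Q [i1 [i2 [p1 [p2 [e1 e2 e3 e4 e5]]]]]] := bip P P'.
  exists Q; split=> [X Y p f epp|i].
    have [g1 h1] := proj_lift (f \oc i1) pP epp.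
    have [g2 h2] := proj_lift (f \oc i2) pP' epp.
    exists (g1 \oc p1 + g2 \oc p2).
    by rewrite compDr !compA h1 h2 -!compA -compDr e5 compm1.
  rewrite ltnS leq_eqVlt => /orP [/eqP ei|/hP [f ef]]; last first.
    exists (f \oc p1) => T g h.
    move=> /(congr1 (fun u => u \oc i1)).
    by rewrite -!compA e1 !compm1 => /ef.
  have -> : i = Ordinal lt by apply: val_inj.
  exists (f' \oc p2) => T g h.
  move=> /(congr1 (fun u => u \oc i2)).
  by rewrite -!compA e2 !compm1 => /ef'.
have [P [pP hP]] := main n (leqnn n).
exists P; split=> // X Y g.
move: Y g; elim: (fl X) => [Z0 zZ' Y g _|A X0 T i p _ IH [ki cp] sT Y g hg].
  exact: (proj1 (zZ' Y)).
have [v [ev _]] : exists! v, v \oc p = g.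
  by apply: (proj2 cp); apply: IH => u; rewrite -compA.
have [j [f [f' [ff' f'f]]]] := hS _ sT.
have [q eq] := hP j (ltn_ord j).
have ep' := cokernel_epi cp.
have [u eu] := proj_lift (f' \oc q) pP ep'.
rewrite -ev; suff -> : v = 0 by rewrite comp0l.
have e' : epi (f' \oc q) by apply: epi_comp eq; apply: iso_epi; exists f.
by apply: (epi_eq0 e'); rewrite -eu compA ev.
Qed.

End LinearCategories.

(** * Fully faithful and essentially surjective functors *)

Section Equivalences.
Variables (k : fieldType) (C D : lincat k) (F : functor C D).

Lemma equivalence_of_ff :
  (forall X Y (f : hom X Y), fmap F f = 0 -> f = 0) ->
  (forall X Y (g : hom (F X) (F Y)), exists f : hom X Y, fmap F f = g) ->
  (forall Y : D, exists X : C, isom (F X) Y) ->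
  is_equivalence F.
Proof.
move=> faith0 full es.
have faith X Y (f g : hom X Y) : fmap F f = fmap F g -> f = g.
  move=> e; apply/eqP; rewrite -subr_eq0; apply/eqP/faith0.
  by rewrite -scaleN1r addrC (fmap_lin F) e scaleN1r addNr.
pose pre X Y (g : hom (F X) (F Y)) : hom X Y := sval (cid (full X Y g)).
have preE X Y g : fmap F (pre X Y g) = g by rewrite /pre; case: cid.
pose ob Y : C := sval (cid (es Y)).
have isoY Y : isom (F (ob Y)) Y by rewrite /ob; case: cid.
pose e Y : hom (F (ob Y)) Y := sval (cid (isoY Y)).
have eP Y : is_iso (e Y) by rewrite /e; case: cid.
pose mor Y Y' (g : hom Y Y') : hom (ob Y) (ob Y') := pre _ _ (inv_of (eP Y') \oc (g \oc e Y)).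
have morE Y Y' (g : hom Y Y') : e Y' \oc fmap F (mor _ _ g) = g \oc e Y.
  by rewrite preE compA inv_ofKr comp1m.
have morP Y Y' (g : hom Y Y') u : e Y' \oc fmap F u = g \oc e Y -> mor _ _ g = u.
  by move=> h; apply: faith; apply: (iso_mono (eP Y')); rewrite morE h.
unshelve eexists.
  apply: (@Functor k D C ob mor).
  - by move=> X; apply: morP; rewrite fmap1 compm1 comp1m.
  - by move=> X Y Z g f; apply: morP; rewrite fmapM compA morE -compA morE compA.
  - move=> X Y a f g; apply: morP.
    by rewrite (fmap_lin F) comp_linr !morE comp_linl.
split.
  exists (fun X => pre _ _ (e (F X))); split=> [X|X Y f] /=.
    have [e' [h1 h2]] := eP (F X).
    by exists (pre _ _ e'); split; apply: faith; rewrite fmapM !preE fmap1.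
  by apply: faith; rewrite !fmapM (preE _ _ (e _)) morE (preE _ _ (e _)).
by exists e; split=> [Y|Y Y' f] /=; [exact: eP|exact: morE].
Qed.

End Equivalences.

(** * Finite-dimensional simple algebras *)

Section FiniteDimension.
Variable k : fieldType.

(** A spanning family of minimal length is free; coordinates are then unique, hence linear. *)
Lemma fin_dim_basis (V : lmodType k) : fin_dim V ->
  exists (n : nat) (e : 'I_n -> V) (xi : 'I_n -> V -> k^o),
  [/\ forall i, linear (xi i), forall v, v = \sum_i xi i v *: e i
    & forall c : 'I_n -> k, \sum_i c i *: e i = 0 -> forall i, c i = 0].
Proof.
pose spans n (e : 'I_n -> V) := forall v, exists c : 'I_n -> k, v = \sum_i c i *: e i.
move=> [n0 [e0 h0]].
have ex : exists n, `[< exists e : 'I_n -> V, spans n e >].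
  by exists n0; apply/asboolP; exists e0.
have [n /asboolP [e he] nmin] := ex_minnP ex.
have free (c : 'I_n -> k) : \sum_i c i *: e i = 0 -> forall i, c i = 0.
  move=> s0 i; apply/eqP/negPn/negP => ci.
  case: n e he nmin c s0 i ci => [|n] e he nmin c s0 i ci; first by case: i ci.
  suff : (n.+1 <= n)%N by rewrite ltnn.
  apply: nmin; apply/asboolP; exists (fun j => e (lift i j)) => v.
  have [d ->] := he v.
  have ei : e i = \sum_j (- (c i)^-1 * c (lift i j)) *: e (lift i j).
    move: s0; rewrite (bigD1_ord i) //= => /eqP; rewrite addr_eq0 => /eqP s0.
    rewrite -[e i]scale1r -(mulVf ci) -scalerA s0 scalerN -scaleNr scaler_sumr.
    by apply: eq_bigr => j _; rewrite scalerA.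
  exists (fun j => d i * (- (c i)^-1 * c (lift i j)) + d (lift i j)).
  rewrite (bigD1_ord i) //= {1}ei scaler_sumr -big_split /=.
  by apply: eq_bigr => j _; rewrite scalerA scalerDl.
pose xi i v := sval (cid (he v)) i.
have xiE v : v = \sum_i xi i v *: e i by rewrite /xi; case: cid.
have uniq (c d : 'I_n -> k) : \sum_i c i *: e i = \sum_i d i *: e i -> c =1 d.
  move=> eq i; apply/eqP; rewrite -subr_eq0; apply/eqP.
  apply: (free (fun i => c i - d i)).
  by under eq_bigr do rewrite scalerBl; rewrite sumrB eq subrr.
exists n, e, xi; split=> // i a u v.
apply: (uniq (fun i => xi i (a *: u + v)) (fun i => a * xi i u + xi i v)).
rewrite -xiE {1}(xiE u) {1}(xiE v) scaler_sumr -big_split /=.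
by apply: eq_bigr => j _; rewrite scalerA scalerDl.
Qed.

(** [fin_dim] only gives a spanning family. Gaussian elimination, by induction on its length: a
    vector of U with nonzero coefficient on the first generator reduces the others to combinations
    of the remaining ones. *)
Lemma subspace_spanned (V : lmodType k) (U : V -> Prop) : fin_dim V ->
  U 0 -> (forall a u v, U u -> U v -> U (a *: u + v)) ->
  exists (m : nat) (r : 'I_m -> V), (forall j, U (r j)) /\
    forall u, U u -> exists c : 'I_m -> k, u = \sum_j c j *: r j.
Proof.
move=> [n [e he]].
have {he} : forall u, U u -> exists c : 'I_n -> k, u = \sum_j c j *: e j by move=> u _.
elim: n e U => [|n IH] e U he U0 Ulin.
  exists 0%N, e; split=> [[]//|]; exact: he.
pose U' u := U u /\ exists c : 'I_n -> k, u = \sum_j c j *: e (lift ord0 j).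
have [||| m [r [Ur hr]]] := IH (fun j => e (lift ord0 j)) U'.
- by move=> u [].
- by split=> //; exists (fun=> 0); rewrite big1 // => i _; rewrite scale0r.
- move=> a u v [Uu [c ec]] [Uv [d ed]]; split; first exact: Ulin.
  exists (fun j => a * c j + d j); rewrite ec ed scaler_sumr -big_split.
  by apply: eq_bigr => j _; rewrite /= scalerA scalerDl.
have [[u [Uu [c [c0 ec]]]]|no] := EM (exists u, U u /\ exists c : 'I_n.+1 -> k,
  c ord0 != 0 /\ u = \sum_j c j *: e j); last first.
  exists m, r; split=> [j|u Uu]; first by case: (Ur j).
  have [c ec] := he u Uu; apply: hr; split=> //.
  have [c0|c0] := eqVneq (c ord0) 0; last by case: no; exists u; split=> //; exists c.
  by exists (fun j => c (lift ord0 j)); rewrite ec big_ord_recl c0 scale0r add0r.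
exists m.+1, (fun j => if unlift ord0 j is Some j' then r j' else u); split.
  by move=> j; case: unliftP => // j' _; case: (Ur j').
move=> v Uv; have [d ed] := he v Uv.
have [|b eb] := hr (v - (d ord0 / c ord0) *: u).
  split; first by rewrite addrC -scaleNr; apply: Ulin.
  exists (fun j => d (lift ord0 j) - d ord0 / c ord0 * c (lift ord0 j)).
  rewrite ec {1}ed !big_ord_recl scalerDr scalerA divfK // opprD addrACA subrr add0r.
  rewrite scaler_sumr -sumrB; apply: eq_bigr => j _.
  by rewrite scalerA scalerBl.
exists (fun j => if unlift ord0 j is Some j' then b j' else d ord0 / c ord0).
rewrite big_ord_recl unlift_none -[LHS](subrK ((d ord0 / c ord0) *: u)) addrC eb.
by congr (_ + _); apply: eq_bigr => j _; rewrite liftK.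
Qed.

(** The coefficients are a nonzero row killed by the coordinate matrix of n + 1 vectors in dimension
    n. They are packaged as a polynomial because u will be a sequence of powers. *)
Lemma poly_relation (V : lmodType k) (u : nat -> V) : fin_dim V ->
  exists p : {poly k}, p != 0 /\ \sum_(i < size p) p`_i *: u i = 0.
Proof.
move=> /fin_dim_basis [n [e [xi [_ xiE _]]]].
pose A : 'M[k]_(n.+1, n) := \matrix_(i, j) xi j (u i).
have : kermx A != 0.
  rewrite kermx_eq0 /row_free; apply/negP => /eqP rA.
  by have := rank_leq_col A; rewrite rA ltnn.
case/rowV0Pn => w /sub_kermxP wA w0.
exists (rVpoly w); split.
  by apply/negP => /eqP /(congr1 (@poly_rV _ n.+1)); rewrite rVpolyK linear0; apply/eqP.
have coefw (i : 'I_n.+1) : (rVpoly w)`_i = w 0 i by rewrite coef_rVpoly_ord.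
transitivity (\sum_(i < n.+1) (rVpoly w)`_i *: u i).
  rewrite (big_ord_widen n.+1 (fun i => (rVpoly w)`_i *: u i) (size_poly _ _)).
  rewrite big_mkcond; apply: eq_bigr => i _.
  by case: ltnP => // h; rewrite nth_default // scale0r.
under eq_bigr => i _ do rewrite coefw {1}(xiE (u i)) scaler_sumr.
rewrite exchange_big big1 //= => j _.
have /matrixP/(_ 0 j) := wA; rewrite !mxE => h.
under eq_bigr do rewrite scalerA; rewrite -scaler_suml.
by under eq_bigr => i _ do [have -> : xi j (u i) = A i j by rewrite mxE]; rewrite h scale0r.
Qed.

End FiniteDimension.

(** * Density and separability of a simple algebra *)

Section SimpleAlgebras.
Variables (k : closedFieldType) (L : algType k).
Hypotheses (L_simple : simple_alg L) (L_fin : fin_dim L).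

(** Schur's lemma. A polynomial killing c splits; for each root a the ideal (c - a) L is zero or
    contains 1, so cancelling the invertible factors leaves some c = a. *)
Lemma simple_center (c : L) : (forall x, c * x = x * c) -> exists a : k, c = a%:A.
Proof.
move=> cen; have [p [p0 ps]] := poly_relation (fun i => c ^+ i) L_fin.
have {ps} ps : horner_alg c p = 0.
  rewrite /horner_alg /= /horner_morph /= (horner_coef_wide _ (size_poly _ _)).
  by rewrite -[RHS]ps; apply: eq_bigr => i _; rewrite coef_map /= mulr_algl.
have [r er] := closed_field_poly_normal p.
have cen' a x : (c - a%:A) * x = x * (c - a%:A).
  by rewrite mulrBl mulrBr cen mulr_algl mulr_algr.
have inv_or_eq a : c = a%:A \/ exists y, y * (c - a%:A) = 1.
  have : two_sided_ideal (fun x => exists y, x = (c - a%:A) * y).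
    split; first by exists 0; rewrite mulr0.
      by move=> _ _ [y ->] [z ->]; exists (y + z); rewrite mulrDr.
    by move=> x _ z [y ->]; exists (x * y * z); rewrite !mulrA cen'.
  move=> /L_simple [h|h]; last by right; have [y ey] := h 1; exists y; rewrite -cen' -ey.
  by left; apply/eqP; rewrite -subr_eq0; apply/eqP/h; exists 1; rewrite mulr1.
have hM q1 q2 : horner_alg c (q1 * q2) = horner_alg c q1 * horner_alg c q2 by exact: rmorphM.
have hB q1 q2 : horner_alg c (q1 - q2) = horner_alg c q1 - horner_alg c q2 by exact: rmorphB.
move: ps; rewrite er -mul_polyC hM horner_algC mulr_algl => /eqP.
rewrite scaler_eq0 lead_coef_eq0 (negbTE p0) /= => /eqP.
elim: r {er p p0} => [|a r IH].
  by rewrite big_nil -[X in horner_alg c X]/(1%:P) horner_algC scale1r => /eqP; rewrite oner_eq0.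
rewrite big_cons hM hB horner_algX horner_algC.
case: (inv_or_eq a) => [->|[y ey] e0]; first by exists a.
by apply: IH; rewrite -[LHS]mul1r -ey -mulrA e0 mulr0.
Qed.

(** A list of pairs stands for an element of the enveloping algebra, the tensor product of L and its
    opposite, which acts on L by multiplications on both sides. *)
Definition mulop (s : seq (L * L)) (v : L) : L := \sum_(p <- s) p.1 * v * p.2.

Lemma mulop_lin s : linear (mulop s).
Proof.
move=> a u v; rewrite /mulop scaler_sumr -big_split; apply: eq_bigr => p _.
by rewrite mulrDr mulrDl -scalerAr -scalerAl.
Qed.
Lemma mulop_cat s t v : mulop (s ++ t) v = mulop s v + mulop t v.
Proof. exact: big_cat. Qed.
Lemma mulop_sandwich x y s v :
  mulop [seq (x * p.1, p.2 * y) | p <- s] v = x * mulop s v * y.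
Proof.
rewrite /mulop big_map mulr_sumr mulr_suml; apply: eq_bigr => p _.
by rewrite /= !mulrA.
Qed.
Lemma mulop_comp s t : exists u, forall v, mulop u v = mulop s (mulop t v).
Proof.
exists (flatten [seq [seq (q.1 * p.1, p.2 * q.2) | p <- t] | q <- s]) => v.
elim: s => [|q s IH]; first by rewrite /mulop !big_nil.
by rewrite /= mulop_cat IH mulop_sandwich [RHS]/mulop big_cons.
Qed.
Lemma mulop_sum n (s : 'I_n -> seq (L * L)) :
  exists u, forall v, mulop u v = \sum_j mulop (s j) v.
Proof.
exists (flatten [seq s j | j <- enum 'I_n]) => v.
rewrite -big_enum /=.
elim: (enum 'I_n) => [|j r IH]; first by rewrite /mulop !big_nil.
by rewrite /= mulop_cat IH big_cons.
Qed.

(* The Artin-Whaples density theorem: otherwise some combination of the v_j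
   with central, hence scalar, coefficients would vanish. *)
Lemma mulop_density n (v : 'I_n -> L) :
  (forall c : 'I_n -> k, \sum_i c i *: v i = 0 -> forall i, c i = 0) ->
  forall i, exists s, forall j, mulop s (v j) = (j == i)%:R.
Proof.
elim: n v => [v _ [] //|n IH v free i].
pose w j := v (lift i j).
have freew (c : 'I_n -> k) : \sum_j c j *: w j = 0 -> forall j, c j = 0.
  move=> e j; have := free (fun i' => if unlift i i' is Some j' then c j' else 0).
  rewrite (bigD1_ord i) //= unlift_none scale0r add0r.
  under eq_bigr do rewrite liftK.
  by move=> /(_ e (lift i j)); rewrite liftK.
have {IH} /choice [s hs] := IH w freew.
have [t [tw tv]] : exists t, (forall j, mulop t (w j) = 0) /\ mulop t (v i) != 0.
  have [//|no] := EM (exists t, (forall j, mulop t (w j) = 0) /\ mulop t (v i) != 0).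
  have {}no t : (forall j, mulop t (w j) = 0) -> mulop t (v i) = 0.
    by move=> h; apply/eqP/negPn/negP => h'; apply: no; exists t.
  (* The operator v -> s_j(v) x - x s_j(v) kills every w, hence v_i as well: s_j(v_i) is central. *)
  have cen j : exists a : k, mulop (s j) (v i) = a%:A.
    apply: simple_center => x; apply/eqP; rewrite -subr_eq0; apply/eqP.
    have /no : forall j', mulop ([seq (1 * p.1, p.2 * x) | p <- s j] ++
        [seq (- x * p.1, p.2 * 1) | p <- s j]) (w j') = 0.
      move=> j'; rewrite mulop_cat !mulop_sandwich hs mul1r mulr1 mulNr.
      by rewrite mulr_natl mulr_natr subrr.
    by rewrite mulop_cat !mulop_sandwich mul1r mulr1 mulNr.
  have {cen} /choice [c hc] := cen.
  (* The operator v -> v - \sum_j w_j s_j(v) also kills every w; at v_i it gives v_i = \sum_j c_j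
     w_j, against freeness. *)
  have [u hu] := mulop_sum (fun j => [seq (- w j * p.1, p.2 * 1) | p <- s j]).
  have /no : forall j', mulop ((1, 1) :: u) (w j') = 0.
    move=> j'; rewrite -cat1s mulop_cat hu {1}/mulop big_seq1 /= mul1r mulr1.
    rewrite (bigD1 j') //= big1 => [|j ne].
      by rewrite mulop_sandwich hs eqxx !mulr1 addr0 subrr.
    by rewrite mulop_sandwich hs eq_sym (negbTE ne) mulr0 mul0r.
  rewrite -cat1s mulop_cat hu {1}/mulop big_seq1 /= mul1r mulr1.
  under eq_bigr do rewrite mulop_sandwich hc mulr1 mulNr mulr_algr.
  rewrite sumrN => e.
  have := free (fun i' => if unlift i i' is Some j' then - c j' else 1).
  rewrite (bigD1_ord i) //= unlift_none scale1r.
  under eq_bigr do rewrite liftK scaleNr.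
  rewrite sumrN => /(_ e i); rewrite unlift_none => /eqP.
  by rewrite oner_eq0.
(* The ideal generated by t(v_i) is nonzero, hence contains 1. *)
have : two_sided_ideal (fun z => exists u, z = mulop u (mulop t (v i))).
  split.
  - by exists [::]; rewrite /mulop big_nil.
  - by move=> _ _ [u ->] [u' ->]; exists (u ++ u'); rewrite mulop_cat.
  - by move=> a _ b [u ->]; eexists; rewrite -mulop_sandwich.
move=> /L_simple [h|/(_ 1) [u hu]].
  have /h e : exists u, mulop t (v i) = mulop u (mulop t (v i)).
    by exists [:: (1, 1)]; rewrite {2}/mulop big_seq1 /= mul1r mulr1.
  by rewrite e eqxx in tv.
have [r hr] := mulop_comp u t; exists r => j; rewrite hr.
case: (unliftP i j) => [j'|] ->; last by rewrite -hu eqxx.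
by rewrite tw eq_sym (negbTE (neq_lift _ _)) (lin0 (mulop_lin u)).
Qed.

(** Faithfulness of the enveloping algebra on L. If s isolates b_i, then evaluating at the left
    factors of s, multiplying by its right factors and summing leaves a_i. *)
Lemma mulop_faithful m (a b : 'I_m -> L) :
  (forall c : 'I_m -> k, \sum_i c i *: b i = 0 -> forall i, c i = 0) ->
  (forall v, \sum_i a i * v * b i = 0) -> forall i, a i = 0.
Proof.
move=> free e i; have [s hs] := mulop_density free i.
have : \sum_(p <- s) (\sum_j a j * p.1 * b j) * p.2 = 0.
  by rewrite big1 // => p _; rewrite e mul0r.
under eq_bigr do rewrite mulr_suml; rewrite exchange_big /=.
have aE j : \sum_(p <- s) a j * p.1 * b j * p.2 = a j * (j == i)%:R.
  by rewrite -hs mulr_sumr; apply: eq_bigr => p _; rewrite !mulrA.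
under eq_bigr do rewrite aE; rewrite (bigD1 i) //= eqxx mulr1 big1 ?addr0 // => j ne.
by rewrite (negbTE ne) mulr0.
Qed.

(** Density makes the coordinate xi_i, viewed as a map L -> k -> L, a multiplication operator; the
    index is chosen with xi_i(1) nonzero, for normalisation. Expanding the right factors in the
    basis b gives the a_j. As the values of this operator are scalars they commute with x, and
    faithfulness turns this into the Casimir identity, tested here by functionals f on the left
    factor. *)
Lemma separability_idempotent : exists (m : nat) (a b : 'I_m -> L),
  \sum_i a i * b i = 1 /\
  forall (f : L -> k^o) x, linear f ->
    \sum_i f (x * a i) *: b i = \sum_i f (a i) *: (b i * x).
Proof.
have [m [b [xi [xil bE free]]]] := fin_dim_basis L_fin.
have [i ci] : exists i, xi i 1 != 0.
  have [//|no] := EM (exists i, xi i 1 != 0).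
  have /eqP := bE 1; rewrite big1 ?oner_eq0 // => i _.
  have [->|h] := eqVneq (xi i 1) 0; first by rewrite scale0r.
  by case: no; exists i.
have [s hs] := mulop_density free i.
pose a j := (xi i 1)^-1 *: \sum_(p <- s) xi j p.2 *: p.1.
have aE v : \sum_j a j * v * b j = ((xi i 1)^-1 * xi i v)%:A.
  transitivity ((xi i 1)^-1 *: mulop s v).
    rewrite /mulop; under [in RHS]eq_bigr => p _ do rewrite {1}(bE p.2) mulr_sumr.
    rewrite exchange_big scaler_sumr; apply: eq_bigr => j _.
    rewrite -!scalerAl; congr (_ *: _); rewrite !mulr_suml; apply: eq_bigr => p _.
    by rewrite -!scalerAl -scalerAr.
  rewrite -scalerA; congr (_ *: _).
  rewrite {1}(bE v) (linsum (mulop_lin s)) (bigD1 i) //= big1 => [|j ne].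
    by rewrite addr0 (linZ (mulop_lin s)) hs eqxx.
  by rewrite (linZ (mulop_lin s)) hs (negbTE ne) scaler0.
have casimir x j : x * a j = \sum_l xi j (b l * x) *: a l.
  apply/eqP; rewrite -subr_eq0; apply/eqP; move: j.
  apply: (mulop_faithful free) => v.
  under eq_bigr do rewrite !mulrBl; rewrite sumrB.
  under eq_bigr do rewrite -!mulrA; rewrite -mulr_sumr.
  under eq_bigr do rewrite mulrA; rewrite aE mulr_algr -mulr_algl -aE mulr_suml.
  apply/eqP; rewrite subr_eq0; apply/eqP.
  under eq_bigr => j _ do rewrite -(mulrA _ (b j) x) (bE (b j * x)) mulr_sumr.
  rewrite exchange_big; apply: eq_bigr => j _; rewrite !mulr_suml.
  by apply: eq_bigr => l _; rewrite -scalerAr !scalerAl.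
exists m, a, b; split.
  have := aE 1; rewrite mulVf // scale1r => e; rewrite -[RHS]e.
  by apply: eq_bigr => j _; rewrite mulr1.
move=> f x fl; under eq_bigr => j _ do rewrite casimir (linsum fl) scaler_suml.
rewrite exchange_big; apply: eq_bigr => j _.
rewrite [b j * x in RHS]bE scaler_sumr; apply: eq_bigr => l _.
by rewrite (linZ fl) !scalerA mulrC.
Qed.

(** The separability element averages the coordinate functionals into right L-linear maps f_i(y) =
    \sum_j xi_i(y a_j) b_j. *)
Lemma dual_basis (X : lmodType k) (ra : L -> X -> X) : fin_dim X ->
  (forall x, linear (ra^~ x)) -> (forall l, linear (ra l)) ->
  (forall x, ra 1 x = x) -> (forall l l' x, ra (l * l') x = ra l' (ra l x)) ->
  exists (m : nat) (x : 'I_m -> X) (f : 'I_m -> X -> L),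
  [/\ forall i, linear (f i), forall i l y, f i (ra l y) = f i y * l
    & forall y, y = \sum_i ra (f i y) (x i)].
Proof.
move=> /fin_dim_basis [n [e [xi [xil eE _]]]] ll lr r1 rM.
have [m [a [b [ab1 cas]]]] := separability_idempotent.
exists n, e, (fun i y => \sum_j xi i (ra (a j) y) *: b j); split=> [i c y z|i l y|y].
- rewrite scaler_sumr -big_split; apply: eq_bigr => j _ /=.
  by rewrite lr xil scalerDl scalerA.
- under eq_bigr do rewrite -rM.
  rewrite (cas (fun z => xi i (ra z y))) => [|c z z']; last by rewrite ll xil.
  by rewrite mulr_suml; apply: eq_bigr => j _; rewrite scalerAl.
under eq_bigr do rewrite (linsum (ll _)).
rewrite exchange_big -{1}[y]r1 -ab1 (linsum (ll _)); apply: eq_bigr => j _.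
rewrite rM {1}[ra (a j) y]eE (linsum (lr _)); apply: eq_bigr => i _.
by rewrite (linZ (lr _)) (linZ (ll _)).
Qed.

End SimpleAlgebras.

(** * Trilinear maps and the antipode *)

Section TensorComplements.
Variable k : fieldType.

Lemma scalAl (A : algType k) a (x y : A) : (a *: x) * y = a *: (x * y).
Proof. by rewrite scalerAl. Qed.
Lemma scalAr (A : algType k) a (x y : A) : x * (a *: y) = a *: (x * y).
Proof. by rewrite scalerAr. Qed.

Lemma tlift_exchange (L1 L2 : Type) (X Y X' Y' V : lmodType k)
    (ra : L1 -> X -> X) (la : L1 -> Y -> Y) (ra' : L2 -> X' -> X') (la' : L2 -> Y' -> Y')
    (f : X -> Y -> X' -> Y' -> V) (u : tens ra la) (v : tens ra' la') :
  tlift (fun x y => tlift (f x y) v) u = tlift (fun x' y' => tlift (fun x y => f x y x' y') u) v.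
Proof. by rewrite /tlift /tsum exchange_big. Qed.

Section Associated.
Variables (L R : Type) (X Y Z V : lmodType k).
Variables (ra : L -> X -> X) (la : L -> Y -> Y) (ra' : R -> Y -> Y) (la' : R -> Z -> Z).
Variable f : X -> Y -> Z -> V.

Definition tribalanced : Prop :=
  [/\ forall y z, linear (fun x => f x y z), forall x z, linear (fun y => f x y z),
      forall x y, linear (f x y), forall l x y z, f (ra l x) y z = f x (la l y) z
    & forall r x y z, f x (ra' r y) z = f x y (la' r z)].

Lemma tribalanced_tlift :
  (forall l, linear (la l)) -> (forall l r y, la l (ra' r y) = ra' r (la l y)) ->
  tribalanced ->
  balanced ra (fun l => @tact1 _ _ _ _ ra' la' (la l)) (fun x w => tlift (f x) w)
  /\ forall x, balanced ra' la' (f x).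
Proof.
move=> lla comm [f1 f2 f3 f4 f5].
have bf x : balanced ra' la' (f x) by split.
split=> //; split=> [w|x|l x w].
- by apply: tlift_linf => y z; exact: f1.
- exact: tlift_lin (bf x).
have [b1 b2 b3] := tpure_bal ra' la'.
rewrite /tact1 (lin_tlift _ _ (tlift_lin (bf x))); apply: eq_tlift => y z.
by rewrite f4 (tliftE _ _ (bf x)).
Qed.

End Associated.

(* Evaluation of a trilinear map on the two sides of a coassociativity law. *)
Lemma coassoc_eval (L1 L2 L R : Type) (X Y Z X1 Y1 V : lmodType k)
    (ra : L -> X -> X) (la : L -> Y -> Y) (ra' : R -> Y -> Y) (la' : R -> Z -> Z)
    (ra1 : L1 -> X1 -> X1) (la1 : L1 -> Z -> Z) (ra2 : L2 -> X -> X) (la2 : L2 -> Y1 -> Y1)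
    (d : X1 -> tens ra la) (d' : Y1 -> tens ra' la') (u : tens ra1 la1) (v : tens ra2 la2)
    (f : X -> Y -> Z -> V) :
  (forall l, linear (la l)) -> (forall l r y, la l (ra' r y) = ra' r (la l y)) ->
  tribalanced ra la ra' la' f ->
  tlift (fun a b => tlift (fun x y => x \ox (y \ox b)) (d a)) u =
  tlift (fun a b => a \ox d' b) v
    :> tens ra (fun l => @tact1 _ _ _ _ ra' la' (la l)) ->
  tlift (fun a b => tlift (fun x y => f x y b) (d a)) u =
  tlift (fun a b => tlift (f a) (d' b)) v.
Proof.
move=> lla comm bf /(congr1 (tlift (fun x w => tlift (f x) w))).
have [bF bfx] := tribalanced_tlift lla comm bf.
rewrite !(lin_tlift _ _ (tlift_lin bF)) => e.
transitivity (tlift (fun a b => tlift (fun x w => tlift (f x) w)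
   (tlift (fun x y => x \ox (y \ox b)) (d a) :
     tens ra (fun l => @tact1 _ _ _ _ ra' la' (la l)))) u).
  apply: eq_tlift => a b; rewrite (lin_tlift _ _ (tlift_lin bF)); apply: eq_tlift => x y.
  by rewrite (tliftE _ _ bF) (tliftE _ _ (bfx x)).
by rewrite e; apply: eq_tlift => a b; rewrite (tliftE _ _ bF).
Qed.

End TensorComplements.

Ltac lin := let a := fresh in let u := fresh in let v := fresh in
  move=> a u v; rewrite /= ?linearP ?(mulrDr, mulrDl, scalAl, scalAr, linearP) //.

(** * Antimultiplicativity of the antipode *)

Section Antipode.
Variables (k : fieldType) (L R H : algType k) (HH : hopf_algebroid L R H).
Local Notation s := (lb_s HH).
Local Notation t := (lb_t HH).
Local Notation e := (lb_e HH).
Local Notation D := (lb_D HH).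
Local Notation sR := (rb_s (ha_r HH)).
Local Notation tR := (rb_t (ha_r HH)).
Local Notation eR := (rb_e (ha_r HH)).
Local Notation DR := (rb_D (ha_r HH)).
Local Notation S := (ha_S HH).
Local Notation TR := (tens (rmulact sR) (rmulact tR)).

Lemma S_tl l h : S (t l * h) = S h * s l.
Proof. by have := ha_S_l HH l 1 h; rewrite lb_t1 rmorph1 mulr1 mul1r. Qed.
Lemma S_tr l h : S (h * t l) = s l * S h.
Proof. by have := ha_S_l HH 1 l h; rewrite lb_t1 rmorph1 mulr1 mul1r. Qed.
Lemma S_tRl r h : S (tR r * h) = S h * sR r.
Proof. by have := ha_S_r HH r 1 h; rewrite rb_t1 rmorph1 mulr1 mul1r. Qed.
Lemma S_tRr r h : S (h * tR r) = sR r * S h.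
Proof. by have := ha_S_r HH 1 r h; rewrite rb_t1 rmorph1 mulr1 mul1r. Qed.

Lemma rb_e_Ms r x : eR (x * sR r) = eR x * r.
Proof. by have := rb_e_bimod (ha_r HH) 1 r x; rewrite rb_t1 mulr1 mul1r. Qed.

Lemma rb_D_Ms r x : DR (x * sR r) = tlift (fun x1 x2 => x1 \ox (x2 * sR r)) (DR x).
Proof.
have := rb_D_bimod (ha_r HH) 1 r x; rewrite rb_t1 mulr1 => ->.
by apply: eq_tlift => a b; rewrite mulr1.
Qed.
Lemma rb_D_Mt r x : DR (x * tR r) = tlift (fun x1 x2 => (x1 * tR r) \ox x2) (DR x).
Proof.
have := rb_D_bimod (ha_r HH) r 1 x; rewrite rmorph1 mulr1 => ->.
by apply: eq_tlift => a b; rewrite mulr1.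
Qed.
Lemma lb_D_Mt l x : D (x * t l) = tlift (fun x1 x2 => x1 \ox (x2 * t l)) (D x).
Proof.
rewrite [LHS](ca_lamM_pure (C := regular HH) x (lb_D_t HH l)).
by apply: eq_tlift => a b; rewrite mulr1.
Qed.
Lemma lb_D_s l : D (s l) = s l \ox 1.
Proof.
rewrite -[s l]mulr1 lb_DL lb_D1 /tact1 (tliftE _ _ (tact1_bal (regular HH) l)).
by rewrite /lmulact mulr1.
Qed.
Lemma lb_D_Ms l x : D (x * s l) = tlift (fun x1 x2 => (x1 * s l) \ox x2) (D x).
Proof.
rewrite [LHS](ca_lamM_pure (C := regular HH) x (lb_D_s l)).
by apply: eq_tlift => a b; rewrite mulr1.
Qed.

(** By the compatibility axioms s and t_R have the same image, and so do t and s_R; this carries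
    identities between the left and the right bialgebroid. *)
Lemma s_tR l : s l = tR (eR (s l)). Proof. by rewrite ha_tresl. Qed.
Lemma t_sR l : t l = sR (eR (t l)). Proof. by rewrite ha_sretl. Qed.
Lemma sR_t r : sR r = t (e (sR r)). Proof. by rewrite ha_tlesr. Qed.

Lemma rb_D_Msl l x : DR (x * s l) = tlift (fun x1 x2 => (x1 * s l) \ox x2) (DR x).
Proof. by rewrite s_tR rb_D_Mt. Qed.
Lemma rb_D_sl l : DR (s l) = s l \ox 1.
Proof.
have [b1 b2 b3] := tpure_bal (rmulact sR) (rmulact tR).
rewrite -[s l]mul1r rb_D_Msl rb_D1 (tliftE (f := fun x1 x2 => (x1 * s l) \ox x2 : TR)) //.
split=> [y a u v|y a u v|r' a b].
- by rewrite mulrDl scalAl b1.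
- by rewrite b2.
by rewrite -b3 /rmulact -!mulrA [s l]s_tR rb_stC.
Qed.

Lemma lb_D_eval (V : lmodType k) (f : H -> H -> V) g h :
  balanced (lmulact t) (lmulact s) f ->
  tlift f (D (g * h)) = tlift (fun a b => tlift (fun a' b' => f (a * a') (b * b')) (D h)) (D g).
Proof.
move=> bf; rewrite lb_DM /tmul (lin_tlift _ _ (tlift_lin bf)); apply: eq_tlift => a b.
by rewrite (lin_tlift _ _ (tlift_lin bf)); apply: eq_tlift => a' b'; rewrite (tliftE _ _ bf).
Qed.
Lemma rb_D_eval (V : lmodType k) (f : H -> H -> V) g h :
  balanced (rmulact sR) (rmulact tR) f ->
  tlift f (DR (g * h)) = tlift (fun a b => tlift (fun a' b' => f (a * a') (b * b')) (DR h)) (DR g).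
Proof.
move=> bf; rewrite rb_DM /tmul (lin_tlift _ _ (tlift_lin bf)); apply: eq_tlift => a b.
by rewrite (lin_tlift _ _ (tlift_lin bf)); apply: eq_tlift => a' b'; rewrite (tliftE _ _ bf).
Qed.

Lemma lb_takeuchi_eval (V : lmodType k) (f : H -> H -> V) l h :
  balanced (lmulact t) (lmulact s) f ->
  tlift (fun a b => f (a * t l) b) (D h) = tlift (fun a b => f a (b * s l)) (D h).
Proof.
move=> bf; have /(congr1 (tlift f)) := lb_takeuchi HH h l.
rewrite !(lin_tlift _ _ (tlift_lin bf)).
under eq_tlift do rewrite (tliftE _ _ bf).
by under [in X in _ = X -> _]eq_tlift do rewrite (tliftE _ _ bf).
Qed.
Lemma rb_takeuchi_eval (V : lmodType k) (f : H -> H -> V) r h :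
  balanced (rmulact sR) (rmulact tR) f ->
  tlift (fun a b => f (sR r * a) b) (DR h) = tlift (fun a b => f a (tR r * b)) (DR h).
Proof.
move=> bf; have /(congr1 (tlift f)) := rb_takeuchi (ha_r HH) h r.
rewrite !(lin_tlift _ _ (tlift_lin bf)).
under eq_tlift do rewrite (tliftE _ _ bf).
by under [in X in _ = X -> _]eq_tlift do rewrite (tliftE _ _ bf).
Qed.

Lemma coassoc_lr_eval (V : lmodType k) (f : H -> H -> H -> V) h :
  tribalanced (lmulact t) (lmulact s) (rmulact sR) (rmulact tR) f ->
  tlift (fun a b => tlift (fun x y => f x y b) (D a)) (DR h) =
  tlift (fun a b => tlift (f a) (DR b)) (D h).
Proof.
move=> bf; apply: coassoc_eval bf (ha_coassoc_lr HH h) => [l a u v|l r y]; rewrite /lmulact /rmulact ?mulrDr ?mulrDl ?scalAr ?scalAl ?mulrA //.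
Qed.
Lemma coassoc_rl_eval (V : lmodType k) (f : H -> H -> H -> V) h :
  tribalanced (rmulact sR) (rmulact tR) (lmulact t) (lmulact s) f ->
  tlift (fun a b => tlift (fun x y => f x y b) (DR a)) (D h) =
  tlift (fun a b => tlift (f a) (D b)) (DR h).
Proof.
move=> bf; apply: coassoc_eval bf (ha_coassoc_rl HH h) => [l a u v|l r y]; rewrite /lmulact /rmulact ?mulrDr ?mulrDl ?scalAr ?scalAl ?mulrA //.
Qed.

Lemma S1 : S 1 = 1.
Proof.
have := ha_antipode_l HH 1; rewrite lb_D1 rb_e1 rmorph1 (tliftE (f := fun x y => S x * y)).
  by rewrite mulr1.
by split=> [y|y|l x y]; [lin|lin|rewrite /lmulact S_tl -mulrA].
Qed.

(** The right antipode axiom at g t(l): since t(l) lies in the image of s_R, [DR] puts it on the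
    second factor, where S(q t(l)) = s(l) S(q). *)
Lemma antipode_mid g l :
  tlift (fun p q => p * (s l * S q)) (DR g) = s (e (g * s l)).
Proof.
have bal : balanced (rmulact sR) (rmulact tR) (fun x y => x * S y).
  by split=> [y|y|r x y]; [lin|lin|rewrite /rmulact S_tRr mulrA].
rewrite -lb_e_Mt -ha_antipode_r [t l]t_sR rb_D_Ms (lin_tlift _ _ (tlift_lin bal)).
by apply: eq_tlift => p q; rewrite (tliftE _ _ bal) -t_sR S_tr.
Qed.

Lemma S_counit x : tlift (fun a b => S a * s (e b)) (D x) = S x.
Proof.
rewrite -[in RHS](lb_counitr HH x) lin_tlift; last by lin.
by apply: eq_tlift => a b; rewrite S_tl.
Qed.

Lemma antipode_bal : balanced (lmulact t) (lmulact s) (fun x y => S x * y).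
Proof. by split=> [y|y|l x y]; [lin|lin|rewrite /lmulact S_tl mulrA]. Qed.

(** Write [D] h = h_1 (x) h_2 and [DR] h = h^1 (x) h^2. Replacing s(eps(h_2)) by h_2^1 S(h_2^2) and
    using mixed coassociativity gives S(c_1 h^1_1) c_2 h^1_2 S(h^2). The left antipode axiom at c
    h^1 leaves s_R(eps_R(c h^1)) S(h^2), and the right Takeuchi condition and counit finish. *)
Lemma antipodeM_partial c h :
  tlift (fun h1 h2 => tlift (fun c1 c2 => S (c1 * h1) * c2) (D c) * s (e h2)) (D h) =
  S h * sR (eR c).
Proof.
have balc (V : lmodType k) x (A : {linear H -> V}) :
    balanced (lmulact t) (lmulact s) (fun c1 c2 => A (S (c1 * x) * c2)).
  by split=> [y|y|l a b]; [lin|lin|rewrite /lmulact -[t l * _ * _]mulrA S_tl !mulrA].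
transitivity (tlift (fun h1 h2 => tlift (fun u v =>
    tlift (fun c1 c2 => S (c1 * h1) * c2 * u * S v) (D c)) (DR h2)) (D h)).
  apply: eq_tlift => h1 h2; rewrite -ha_antipode_r lin_tlift; last by lin.
  apply: eq_tlift => u v; rewrite (lin_tlift (F := fun z => z * (u * S v))); last by lin.
  by apply: eq_tlift => c1 c2; rewrite mulrA.
rewrite -(coassoc_lr_eval (f := fun x y z => tlift (fun c1 c2 => S (c1 * x) * c2 * y * S z) (D c)));
  last first.
  split=> [y z|x z|x y|l x y z|r x y z].
  - by apply: tlift_linf => c1 c2; lin.
  - by apply: tlift_linf => c1 c2; lin.
  - by apply: tlift_linf => c1 c2; lin.
  - rewrite /lmulact; under eq_tlift do rewrite mulrA.
    rewrite (lb_takeuchi_eval (f := fun a b => S (a * x) * b * y * S z)).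
      by apply: eq_tlift => c1 c2; rewrite !mulrA.
    by split=> [b|b|l' a b]; [lin|lin|rewrite /lmulact -[t l' * _ * _]mulrA S_tl !mulrA].
  - by apply: eq_tlift => c1 c2; rewrite /rmulact S_tRr !mulrA.
have balR : balanced (rmulact sR) (rmulact tR) (fun a b => sR (eR a) * S b).
  by split=> [y|y|r a b]; [lin|lin|rewrite /rmulact rb_e_Ms rmorphM S_tRr mulrA].
transitivity (tlift (fun a b => sR (eR (sR (eR c) * a)) * S b) (DR h)).
  apply: eq_tlift => a b; rewrite rb_es -ha_antipode_l (lb_D_eval _ _ antipode_bal).
  rewrite tlift_exchange [RHS](lin_tlift (F := fun z => z * S b)); last by lin.
  apply: eq_tlift => c1 c2.
  rewrite [RHS](lin_tlift (F := fun z => z * S b)); last by lin.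
  by apply: eq_tlift => x y; rewrite !mulrA.
rewrite (rb_takeuchi_eval _ _ balR).
transitivity (S (tR (eR c) * tlift (fun a b => b * tR (eR a)) (DR h))); last first.
  by rewrite rb_counitl S_tRl.
rewrite (lin_tlift (F := fun z => S (tR (eR c) * z))); last by lin.
by apply: eq_tlift => a b; rewrite mulrA S_tRr.
Qed.

(** Start from S(g_1 h_1) s(eps(g_2 h_2)). By [antipode_mid] the second factor is g_2^1 s(eps(h_2))
    S(g_2^2); mixed coassociativity in g groups the sum as S(g^1_1 h_1) g^1_2 s(eps(h_2)) S(g^2),
    which [antipodeM_partial] turns into S(h) s_R(eps_R(g^1)) S(g^2) = S(h) S(g). *)
Lemma SM g h : S (g * h) = S h * S g.
Proof.
rewrite -S_counit (lb_D_eval (f := fun a b => S a * s (e b))); last first.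
  by split=> [y|y|l x y]; [lin|lin|rewrite /lmulact S_tl lb_e_sM rmorphM mulrA].
rewrite tlift_exchange.
transitivity (tlift (fun h1 h2 => tlift (fun g1 g2 => tlift (fun p q =>
   S (g1 * h1) * p * s (e h2) * S q) (DR g2)) (D g)) (D h)).
  apply: eq_tlift => h1 h2; apply: eq_tlift => g1 g2.
  rewrite -(lb_es HH g2) -antipode_mid [LHS](lin_tlift (F := fun z => S (g1 * h1) * z)); last by lin.
  by apply: eq_tlift => p q; rewrite !mulrA.
transitivity (tlift (fun h1 h2 => tlift (fun c d => tlift (fun g1 p =>
   S (g1 * h1) * p * s (e h2) * S d) (D c)) (DR g)) (D h)).
  apply: eq_tlift => h1 h2.
  rewrite (coassoc_lr_eval (f := fun g1 p q => S (g1 * h1) * p * s (e h2) * S q)) //.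
  split=> [y z|x z|x y|l x y z|r x y z]; try by lin.
    by rewrite /lmulact -(mulrA (t l)) S_tl !mulrA.
  by rewrite /rmulact S_tRr -!mulrA; congr (_ * (_ * _)); rewrite !mulrA [sR r]sR_t lb_stC.
rewrite tlift_exchange -[in RHS](rb_counitl (ha_r HH) g).
rewrite [RHS](lin_tlift (F := fun z => S h * S z)); last by lin.
apply: eq_tlift => c d; rewrite S_tRr mulrA -antipodeM_partial.
rewrite [RHS](lin_tlift (F := fun z => z * S d)); last by lin.
apply: eq_tlift => h1 h2; rewrite -mulrA [RHS](lin_tlift (F := fun z => z * (s (e h2) * S d))).
  by apply: eq_tlift => x y; rewrite !mulrA.
by lin.
Qed.

End Antipode.

(** * Left duals of modules over a Hopf algebroid *)

Section DualModule.
Variables (k : fieldType) (L R : algType k) (H : falgType k) (HH : hopf_algebroid L R H).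
Local Notation s := (lb_s HH).
Local Notation t := (lb_t HH).
Local Notation e := (lb_e HH).
Local Notation D := (lb_D HH).
Local Notation sR := (rb_s (ha_r HH)).
Local Notation tR := (rb_t (ha_r HH)).
Local Notation eR := (rb_e (ha_r HH)).
Local Notation DR := (rb_D (ha_r HH)).
Local Notation S := (ha_S HH).
Local Notation TR := (tens (rmulact sR) (rmulact tR)).
Local Notation Rg := (regular HH).
Variable X : amod H.

Definition dualP : pred (X -> L) :=
  fun f => `[< linear f /\ forall l x, f (mact (t l) x) = f x * l >].

Lemma dual_submod : submod_closed dualP.
Proof.
have z w : (0 : X -> L) w = 0 by [].
have e' c (f g : X -> L) w : (c *: f + g) w = c *: f w + g w by [].
split=> [|c f g]; first (apply/asboolP; split=> [a u v|l x]).
- by rewrite !z scaler0 addr0.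
- by rewrite !z mul0r.
move=> /asboolP [f1 f2] /asboolP [g1 g2]; apply/asboolP.
split=> [a u v|l x]; rewrite !e'.
- by rewrite f1 g1 !scalerDr !scalerA [a * c]mulrC addrACA.
- by rewrite f2 g2 mulrDl scalAl.
Qed.
HB.instance Definition _ := GRing.isSubmodClosed.Build k (X -> L) dualP dual_submod.

Record dual := Dual { dual_fun :> X -> L; dual_in : dualP dual_fun }.
HB.instance Definition _ := [isSub for dual_fun].
HB.instance Definition _ := [Choice of dual by <:].
HB.instance Definition _ := [SubChoice_isSubLmodule of dual by <:].

Lemma dual_lin (f : dual) : linear f.
Proof. exact: (proj1 (asboolW (dual_in f))). Qed.
Lemma dual_t (f : dual) l x : f (mact (t l) x) = f x * l.
Proof. exact: (proj2 (asboolW (dual_in f))). Qed.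
Lemma dual_ext (f g : dual) : f =1 g -> f = g.
Proof. by move=> h; apply: val_inj; apply: funext. Qed.
Lemma dualE a (f g : dual) x : (a *: f + g) x = a *: f x + g x.
Proof. by []. Qed.
Definition mk_dual (f : X -> L) (l : linear f)
  (h : forall l x, f (mact (t l) x) = f x * l) : dual :=
  Dual (introT (asboolP _) (conj l h)).

Definition dual_act_fun (f : X -> L) (h : H) (x : X) : L :=
  tlift (fun a b => e (a * s (f (mact (S b) x)))) (DR h).

Lemma dual_act_bal (f : dual) x : balanced (rmulact sR) (rmulact tR)
  (fun a b => e (a * s (f (mact (S b) x)))).
Proof.
split=> [b|a c u v|r a b].
- by move=> c u v; rewrite mulrDl scalAl linearP.
- by rewrite linearP mact_linl dual_lin linearP mulrDr scalAr linearP.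
rewrite /rmulact S_tRr mactM sR_t dual_t rmorphM mulrA -[RHS]lb_e_Mt.
by rewrite -mulrA -lb_stC mulrA.
Qed.

Lemma dual_act_lin (f : dual) h : linear (dual_act_fun f h).
Proof.
apply: tlift_linf => a b c x y.
by rewrite mact_linr dual_lin linearP mulrDr scalAr linearP.
Qed.
Lemma dual_act_t (f : dual) h l x :
  dual_act_fun f h (mact (t l) x) = dual_act_fun f h x * l.
Proof.
rewrite /dual_act_fun [RHS](lin_tlift (F := fun y => y * l)); last by lin.
transitivity (tlift (fun a b => e (sR (eR (t l)) * a * s (f (mact (S b) x)))) (DR h)).
  rewrite (rb_takeuchi_eval _ _ (dual_act_bal f x)); apply: eq_tlift => a b.
  by rewrite S_tRl mactM -t_sR.
by apply: eq_tlift => a b; rewrite -t_sR -mulrA lb_e_tM.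
Qed.

Definition dual_act (h : H) (f : dual) : dual :=
  mk_dual (dual_act_lin f h) (dual_act_t f h).

Lemma dual_act_s l (f : dual) x : dual_act (s l) f x = l * f x.
Proof.
rewrite /= /dual_act_fun rb_D_sl (tliftE _ _ (dual_act_bal f x)) S1 mact1.
by rewrite -rmorphM lb_e_s.
Qed.

Lemma dual_act_linl f : linear (dual_act^~ f).
Proof.
move=> c g h; apply: dual_ext => x; rewrite dualE /= /dual_act_fun linearP.
by rewrite (tlift_lin (dual_act_bal f x)).
Qed.
Lemma dual_act_linr h : linear (dual_act h).
Proof.
move=> c f g; apply: dual_ext => x.
have li a b : linear (fun w : dual => e (a * s (w (mact (S b) x)))).
  by move=> c' u v; rewrite dualE linearP mulrDr scalAr linearP.
exact: (tlift_linf _ li).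
Qed.
Lemma dual_act1 f : dual_act 1 f = f.
Proof.
apply: dual_ext => x; rewrite /= /dual_act_fun rb_D1 (tliftE _ _ (dual_act_bal f x)).
by rewrite mul1r S1 mact1 lb_e_s.
Qed.
(** An action because S reverses products ([SM]), while [lb_es] absorbs the inner s(eps(...)). *)
Lemma dual_actM g h f : dual_act (g * h) f = dual_act g (dual_act h f).
Proof.
apply: dual_ext => x; rewrite /= /dual_act_fun (rb_D_eval _ _ (dual_act_bal f x)).
apply: eq_tlift => a b; rewrite (lin_tlift (F := fun l => e (a * s l))); last first.
  by move=> c u v; rewrite linearP mulrDr scalAr linearP.
by apply: eq_tlift => a' b'; rewrite /= lb_es mulrA SM mactM.
Qed.

Variables (m : nat) (x : 'I_m -> X) (f : 'I_m -> X -> L).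
Hypotheses (f_lin : forall i, linear (f i)) (f_t : forall i l y, f i (mact (t l) y) = f i y * l)
  (xf : forall y, y = \sum_i mact (t (f i y)) (x i)).

Definition dual_gen i : dual := mk_dual (f_lin i) (f_t i).

Lemma dual_expand (g : dual) : g = \sum_i dual_act (s (g (x i))) (dual_gen i).
Proof.
apply: dual_ext => y.
have -> (I : finType) (E : I -> dual) : (\sum_i E i : dual) y = \sum_i E i y.
  by apply: (big_morph (fun g : dual => g y)).
rewrite {1}(xf y) (linsum (@dual_lin g)); apply: eq_bigr => i _.
by rewrite dual_t dual_act_s.
Qed.

Lemma dual_fin : fin_dim dual.
Proof.
have [n [b hb]] := umod_fin HH.
apply: (@fin_dim_fin _ _ ('I_m * 'I_n)%type
  (fun p => dual_act (s (b p.2)) (dual_gen p.1))) => g.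
have /choice [c hc] : forall i, exists c : 'I_n -> k, g (x i) = \sum_j c j *: b j.
  by move=> i; exact: hb.
exists (fun p => c p.1 p.2); rewrite {1}(dual_expand g).
rewrite -(pair_bigA _ (fun i j => c i j *: dual_act (s (b j)) (dual_gen i))) /=.
apply: eq_bigr => i _; rewrite hc linear_sum (linsum (dual_act_linl _)).
by apply: eq_bigr => j _; rewrite linearZ (linZ (dual_act_linl _)).
Qed.

Definition dual_mod : amod H :=
  AMod dual_act_linl dual_act_linr dual_act1 dual_actM dual_fin.

Lemma ev_bal : balanced (fun l => @mact _ _ dual_mod (t l)) (fun l => @mact _ _ X (ca_s Rg l))
  (fun (g : dual_mod) y => (g : dual) y).
Proof.
split=> [y|g|l g y]; [by []|exact: dual_lin|].
have e' : DR (t l) = 1 \ox t l.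
  have [b1 b2 b3] := tpure_bal (rmulact sR) (rmulact tR).
  rewrite -[t l]mul1r t_sR rb_D_Ms rb_D1.
  rewrite (tliftE (f := fun x1 x2 => x1 \ox (x2 * sR (eR (t l))) : TR)) ?mul1r //.
  split=> [z a u v|z a u v|r a b]; first by rewrite b1.
    by rewrite mulrDl scalAl b2.
  by rewrite b3 /rmulact -!mulrA rb_stC.
rewrite /= /dual_act_fun e' (tliftE _ _ (dual_act_bal g y)).
by rewrite -[t l]mulr1 S_tl S1 !mul1r lb_e_s.
Qed.

Definition ev_fun (u : mtens Rg dual_mod X) : umod HH :=
  tlift (fun (g : dual_mod) y => (g : dual) y) u.
Lemma ev_lin : linear ev_fun. Proof. exact: tlift_lin ev_bal. Qed.
Lemma ev_funE (g : dual_mod) y : ev_fun (g \ox y) = (g : dual) y.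
Proof. exact: tliftE ev_bal. Qed.

(** Mixed coassociativity brings the pairing of h_1 g with h_2 y to eps(h^1 s(g(S(h^2_1) h^2_2 y)));
    the left antipode axiom and the right counit then leave eps(h s(g(y))). *)
Lemma ev_act h u : ev_fun (mact h u) = mact h (ev_fun u).
Proof.
move: u; apply: (@mtens_ext _ _ _ _ _ Rg dual_mod X _ (fun u => ev_fun (mact h u))
  (fun u => mact h (ev_fun u))) => [c v w|c v w|g y].
- by rewrite mact_linr ev_lin.
- by rewrite ev_lin mact_linr.
rewrite ev_funE mtens_mactE (lin_tlift _ _ ev_lin) /=.
transitivity (tlift (fun h1 h2 => tlift (fun a b =>
    e (a * s ((g : dual) (mact (S b * h2) y)))) (DR h1)) (D h)).
  apply: eq_tlift => h1 h2; rewrite ev_funE; apply: eq_tlift => a b.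
  by rewrite mactM.
rewrite (coassoc_rl_eval (f := fun a b h2 => e (a * s ((g : dual) (mact (S b * h2) y)))));
  last first.
  split=> [b z|a z|a b|r a b z|l a b z].
  - by move=> c u v; rewrite mulrDl scalAl linearP.
  - by move=> c u v; rewrite linearP mulrDl scalAl mact_linl dual_lin linearP mulrDr scalAr linearP.
  - by move=> c u v; rewrite mulrDr scalAr mact_linl dual_lin linearP mulrDr scalAr linearP.
  - have [_ _ b3] := dual_act_bal g (mact z y).
    by rewrite !mactM; exact: b3.
  - by rewrite /lmulact S_tl mulrA.
transitivity (e (tlift (fun a b => a * sR (eR b)) (DR h) * s ((g : dual) y))); last first.
  by rewrite rb_counitr.
rewrite [RHS](lin_tlift (F := fun z => e (z * s ((g : dual) y)))); last first.
  by move=> c u v; rewrite mulrDl scalAl linearP.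
apply: eq_tlift => a b.
transitivity (e (a * s ((g : dual) (mact (sR (eR b)) y)))).
  rewrite -ha_antipode_l (@lin_tlift _ _ _ _ _ _ _ _
    (fun z => e (a * s ((g : dual) (mact z y))))) //.
  by move=> c u v; rewrite mact_linl dual_lin linearP mulrDr scalAr linearP.
rewrite sR_t dual_t rmorphM mulrA -[LHS]lb_e_Mt.
by rewrite -!mulrA lb_stC.
Qed.

Definition ev : ahom (mtens Rg dual_mod X) (umod HH) := mk_ahom ev_lin ev_act.

Definition coev_fun (l : umod HH) : mtens Rg X dual_mod :=
  \sum_i mact (s l) (x i) \ox (dual_gen i : dual_mod).

Let ra := fun l => @mact _ _ X (t l).
Let la := fun l => @mact _ _ dual_mod (ca_s Rg l).

Lemma coev_lin : linear coev_fun.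
Proof.
have [b1 b2 b3] := tpure_bal ra la.
move=> a u v; rewrite /coev_fun scaler_sumr -big_split; apply: eq_bigr => i _ /=.
by rewrite linearP mact_linl b1.
Qed.

Lemma pairing_bal y : balanced ra la (fun z (g : dual_mod) => mact (t ((g : dual) y)) z).
Proof.
split=> [g|z|l z g]; first exact: mact_linr.
  by move=> c g g'; rewrite dualE linearP mact_linl.
by rewrite /ra /la [ca_s Rg l]/(s l) [(mact _ g : dual) y]dual_act_s lb_tM mactM.
Qed.

(** X (x)_L X' embeds into the linear endomorphisms of X, z (x) g acting as y -> z . g(y): the dual
    basis recovers u as \sum_i u(x_i) (x) f_i. Identities in this tensor product can thus be tested
    on elements of X. *)
Lemma pairing_inj (u v : mtens Rg X dual_mod) :
  (forall y, tlift (fun z (g : dual_mod) => mact (t ((g : dual) y)) z) u =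
             tlift (fun z (g : dual_mod) => mact (t ((g : dual) y)) z) v) -> u = v.
Proof.
pose P u y := tlift (fun z (g : dual_mod) => mact (t ((g : dual) y)) z) (u : mtens Rg X dual_mod).
pose Q u := \sum_i P u (x i) \ox (dual_gen i : dual_mod) : mtens Rg X dual_mod.
suff QK u' : Q u' = u'.
  by move=> eq; rewrite -[u]QK -[v]QK /Q; apply: eq_bigr => i _; rewrite /P eq.
have [b1 b2 b3] := tpure_bal ra la.
have PE z g y : P (z \ox g) y = mact (t ((g : dual) y)) z by exact: tliftE (pairing_bal y).
move: u'; apply: (@mtens_ext _ _ _ _ _ Rg X dual_mod _ Q id) => // [a u' v'|z g].
  rewrite /Q scaler_sumr -big_split; apply: eq_bigr => i _ /=.
  by rewrite /P (tlift_lin (pairing_bal (x i))) b1.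
rewrite /Q {2}(dual_expand (g : dual)) (linsum (b2 z)); apply: eq_bigr => i _.
by rewrite PE b3.
Qed.

(** Under the embedding of [pairing_inj], [coev_fun l] is the action of s(l). With [DR] (h s(l)) = a
    (x) b, the left-hand side acts as a S(b) by the right antipode axiom, and mixed coassociativity
    with the left counit brings the right-hand side to the same expression. *)
Lemma coev_act h l : coev_fun (mact h l) = mact h (coev_fun l).
Proof.
apply: pairing_inj => y.
have bl z := tlift_lin (pairing_bal z).
have pairE z (g : dual_mod) : tlift (fun z (g : dual_mod) => mact (t ((g : dual) y)) z)
   (z \ox g : mtens Rg X dual_mod) = mact (t ((g : dual) y)) z by exact: tliftE (pairing_bal y).
have coevE l' : tlift (fun z (g : dual_mod) => mact (t ((g : dual) y)) z) (coev_fun l') =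
    mact (s l') y.
  rewrite /coev_fun (linsum (bl y)) {2}(xf y) (linsum (mact_linr _)).
  by apply: eq_bigr => i _; rewrite pairE -!mactM lb_stC.
rewrite coevE -[mact h l]/(e (h * s l)).
transitivity (tlift (fun a b => mact (a * S b) y) (DR (h * s l))).
  rewrite -ha_antipode_r.
  by rewrite (@lin_tlift _ _ _ _ _ _ _ _ (fun z => mact z y)) //; exact: mact_linl.
rewrite /coev_fun (linsum (mact_linr h)) (linsum (bl y)).
have actE i : tlift (fun z (g : dual_mod) => mact (t ((g : dual) y)) z)
     (mact h (mact (s l) (x i) \ox (dual_gen i : dual_mod) : mtens Rg X dual_mod)) =
   tlift (fun a b => mact (a * t (f i (mact (S b) y)) * s l) (x i)) (DR h).
  rewrite mtens_mactE (lin_tlift _ _ (bl y)).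
  transitivity (tlift (fun h1 h2 => tlift (fun p q =>
      mact (t (e (p * s (f i (mact (S q) y)))) * h1 * s l) (x i)) (DR h2)) (D h)).
    apply: eq_tlift => h1 h2; rewrite pairE /= /dual_act_fun.
    rewrite (@lin_tlift _ _ _ _ _ _ _ _ (fun z => mact (t z) (mact h1 (mact (s l) (x i))))).
      by apply: eq_tlift => p q; rewrite !mactM.
    by move=> c u v; rewrite linearP mact_linl.
  rewrite -(coassoc_lr_eval (f := fun h1 p q =>
      mact (t (e (p * s (f i (mact (S q) y)))) * h1 * s l) (x i))); last first.
    split=> [p q|h1 q|h1 p|l' h1 p q|r h1 p q].
    - by move=> c u v; rewrite mulrDr scalAr mulrDl scalAl mact_linl.
    - move=> c u v; rewrite mulrDl scalAl linearP linearP.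
      by rewrite !mulrDl !scalAl mact_linl.
    - move=> c u v; rewrite linearP mact_linl f_lin linearP mulrDr scalAr linearP linearP.
      by rewrite !mulrDl !scalAl mact_linl.
    - by rewrite /lmulact -[s l' * _ * _]mulrA lb_e_sM lb_tM !mulrA.
    - have [_ _ b3] := dual_act_bal (dual_gen i) y.
      by have /= -> := b3 r p q.
  apply: eq_tlift => a b.
  rewrite -[a * t _](lb_counitr HH).
  rewrite (@lin_tlift _ _ _ _ _ _ _ _ (fun z => mact (z * s l) (x i))); last first.
    by move=> c u v; rewrite mulrDl scalAl mact_linl.
  have balc : balanced (lmulact t) (lmulact s) (fun x1 x2 => mact (t (e x2) * x1 * s l) (x i)).
    split=> [z c u v|z c u v|l' u v].
    - by rewrite mulrDr scalAr mulrDl scalAl mact_linl.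
    - by rewrite linearP linearP !mulrDl !scalAl mact_linl.
    - by rewrite /lmulact lb_e_sM lb_tM !mulrA.
  rewrite lb_D_Mt (lin_tlift _ _ (tlift_lin balc)); apply: eq_tlift => h1 h2.
  by rewrite (tliftE _ _ balc) lb_e_Mt.
have balS : balanced (rmulact sR) (rmulact tR) (fun a b => mact (a * S b) y).
  split=> [z c u v|z c u v|r a b].
  - by rewrite mulrDl scalAl mact_linl.
  - by rewrite linearP mulrDr scalAr mact_linl.
  - by rewrite /rmulact S_tRr mulrA.
rewrite rb_D_Msl (lin_tlift _ _ (tlift_lin balS)).
under eq_bigr do rewrite actE.
transitivity (tlift (fun a b => mact (a * s l * S b) y) (DR h)).
  by apply: eq_tlift => a b; rewrite (tliftE _ _ balS).
rewrite /tlift /tsum exchange_big; apply: eq_bigr => p _ /=.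
rewrite mactM {1}(xf (mact (S p.2) y)) (linsum (mact_linr _)); apply: eq_bigr => i _.
by rewrite -!mactM -!mulrA lb_stC.
Qed.

Definition coev : ahom (umod HH) (mtens Rg X dual_mod) := mk_ahom coev_lin coev_act.

End DualModule.

(* The dual basis form of the duality gives one of the two zigzag identities
   (zigzag_of_dual_basis), the only one that is used. *)
Definition left_rigid (k : fieldType) (L R : algType k) (H : falgType k)
    (HH : hopf_algebroid L R H) : Prop :=
  forall X : amod H, exists (X' : amod H) (m : nat) (x : 'I_m -> X) (f : 'I_m -> X')
    (ev : ahom (mtens (regular HH) X' X) (umod HH))
    (coev : ahom (umod HH) (mtens (regular HH) X X')),
  (forall y, y = \sum_i mact (lb_t HH (ev (f i \ox y))) (x i)) /\
  (forall l, coev l = \sum_i mact (lb_s HH l) (x i) \ox f i).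

Lemma simple_left_rigid (k : closedFieldType) (L R : algType k) (H : falgType k)
  (HH : hopf_algebroid L R H) : simple_alg L -> left_rigid HH.
Proof.
move=> L_simple X.
have [|||||m [x [f [f_lin f_t xf]]]] :=
  @dual_basis _ L L_simple (umod_fin HH) X (fun l => mact (lb_t HH l)).
- exact: mact_fin.
- by move=> y a u v; rewrite linearP mact_linl.
- by move=> l; exact: mact_linr.
- by move=> y; rewrite lb_t1 mact1.
- by move=> l l' y; rewrite lb_tM mactM.
exists (dual_mod f_lin f_t xf), m, x, (dual_gen f_lin f_t),
  (ev f_lin f_t xf), (coev f_lin f_t xf); split=> // y.
by rewrite {1}(xf y); apply: eq_bigr => i _; rewrite /= ev_funE.
Qed.

(** * Module categories *)

Section BifunctorTheory.
Variables (k : fieldType) (C M : lincat k) (T : bifunctor C M).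

Lemma bmap_idl X Y Y' Y'' (g : hom Y' Y'') (f : hom Y Y') :
  bmap T (idm X) (g \oc f) = bmap T (idm X) g \oc bmap T (idm X) f.
Proof. by rewrite -bmapM comp1m. Qed.
Lemma bmap_idr X X' X'' Y (g : hom X' X'') (f : hom X X') :
  bmap T (g \oc f) (idm Y) = bmap T g (idm Y) \oc bmap T f (idm Y).
Proof. by rewrite -bmapM comp1m. Qed.
Lemma bmap_lr X X' Y Y' (f : hom X X') (g : hom Y Y') :
  bmap T f g = bmap T f (idm Y') \oc bmap T (idm X) g.
Proof. by rewrite -bmapM comp1m compm1. Qed.
Lemma bmap_rl X X' Y Y' (f : hom X X') (g : hom Y Y') :
  bmap T f g = bmap T (idm X') g \oc bmap T f (idm Y).
Proof. by rewrite -bmapM comp1m compm1. Qed.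
Lemma bmap0r X X' Y Y' (f : hom X X') : bmap T f (0 : hom Y Y') = 0.
Proof. exact: lin0 (@bmap_linr _ _ _ T X X' Y Y' f). Qed.
Lemma bmap_iso X X' Y Y' (f : hom X X') (g : hom Y Y') :
  is_iso f -> is_iso g -> is_iso (bmap T f g).
Proof.
move=> [f' [e1 e2]] [g' [e3 e4]]; exists (bmap T f' g').
by rewrite -!bmapM e1 e2 e3 e4 !bmap1.
Qed.

End BifunctorTheory.

Section Reassociation.
Variables (k : fieldType) (C : lincat k).
(** Lets an equation g f = h rewrite inside a right-nested composite g (f j). *)
Lemma comp_reassoc (X Y Z T : C) (g : hom Y Z) (f : hom X Y) h (j : hom T X) :
  g \oc f = h -> g \oc (f \oc j) = h \oc j.
Proof. by move=> <-; rewrite compA. Qed.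
End Reassociation.

Section ModuleCategories.
Variables (k : fieldType) (D : moncat k) (M : modcat D).
Local Notation "1" := (mc_unit D).
Local Notation ten := (mc_ten D).
Local Notation act := (md_act M).

Lemma md_unit_faithful (A B : M) (f g : hom A B) :
  bmap act (idm 1) f = bmap act (idm 1) g -> f = g.
Proof.
move=> e; apply: (iso_epi (md_unit_iso A)).
by rewrite -!md_unit_nat e.
Qed.

Lemma md_pentagon_r X Y Z A : bmap act (idm X) (md_assoc Y Z A) \oc
    (md_assoc X (ten Y Z) A \oc bmap act (mc_assoc X Y Z) (idm A)) =
  md_assoc X Y (act Z A) \oc md_assoc (ten X Y) Z A.
Proof. by rewrite md_pentagon compA. Qed.

(* Kelly's argument: the identity is checked after acting by the unit object. *)
Lemma md_unit_act (X : D) (A : M) :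
  md_unit (act X A) \oc md_assoc 1 X A = bmap act (mc_lunit X) (idm A).
Proof.
apply: md_unit_faithful.
apply: (iso_epi (md_assoc_iso 1 (ten 1 X) A)).
apply: (iso_epi (bmap_iso act (mc_assoc_iso 1 1 X) (iso_idm A))).
rewrite bmap_idl -!compA md_pentagon_r compA md_triangle.
rewrite -(bmap1 act X A) -md_assoc_nat -mc_triangle bmap_idr compA md_assoc_nat.
by rewrite !compA.
Qed.

(** * Cofree comodules over a comonoid *)

Section Comonoid.
Variables (G : D) (Dl : hom G (ten G G)) (ep : hom G 1).
Hypothesis Dl_coassoc :
  mc_assoc G G G \oc bmap ten Dl (idm G) \oc Dl = bmap ten (idm G) Dl \oc Dl.
Hypothesis Dl_counit : mc_lunit G \oc bmap ten ep (idm G) \oc Dl = idm G.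
Variable M0 : M.
Let P := act G M0.

(** The morphism [delta] for an abstract comonoid G, later the regular module H. *)
Definition cofree_coact : hom P (act G P) :=
  md_assoc G G M0 \oc bmap act Dl (idm M0).

Definition star X A (x : hom G X) (phi : hom P A) : hom P (act X A) :=
  bmap act x phi \oc cofree_coact.

Lemma star_comp X X' A A' (x : hom G X) (g : hom X X') (phi : hom P A) (f : hom A A') :
  star (g \oc x) (f \oc phi) = bmap act g f \oc star x phi.
Proof. by rewrite /star bmapM compA. Qed.

Lemma cofree_coassoc :
  bmap act (idm G) cofree_coact \oc cofree_coact =
  md_assoc G G P \oc bmap act Dl (idm P) \oc cofree_coact.
Proof.
rewrite /cofree_coact bmap_idl -!compA -[idm P](bmap1 act).
rewrite [in RHS](comp_reassoc _ (esym (md_assoc_nat _ _ _))) -compA -bmap_idr.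
rewrite [in RHS](comp_reassoc _ (md_pentagon _ _ _ _)) -!compA -!bmap_idr.
rewrite (compA (mc_assoc _ _ _)) Dl_coassoc bmap_idr [in RHS](comp_reassoc _ (md_assoc_nat _ _ _)).
by rewrite -compA.
Qed.

(** An endomorphism r of G applied to the left leg, to the right leg or before the coaction is in
    each case moved into [Dl]. With r a right multiplication by s(l) or t(l), this transports the
    Takeuchi condition from H to P. *)
Lemma cofree_l (r : hom G G) : bmap act r (idm P) \oc cofree_coact =
  md_assoc G G M0 \oc bmap act (bmap ten r (idm G) \oc Dl) (idm M0).
Proof.
by rewrite -[idm P](bmap1 act) (comp_reassoc _ (esym (md_assoc_nat _ _ _))) -compA -bmap_idr.
Qed.
Lemma cofree_r (r : hom G G) :
  bmap act (idm G) (bmap act r (idm M0)) \oc cofree_coact =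
  md_assoc G G M0 \oc bmap act (bmap ten (idm G) r \oc Dl) (idm M0).
Proof. by rewrite (comp_reassoc _ (esym (md_assoc_nat _ _ _))) -compA -bmap_idr. Qed.
Lemma cofree_m (r : hom G G) : cofree_coact \oc bmap act r (idm M0) =
  md_assoc G G M0 \oc bmap act (Dl \oc r) (idm M0).
Proof. by rewrite -compA -bmap_idr. Qed.

Lemma star_star X Y A (y : hom G Y) (x : hom G X) (phi : hom P A) :
  star y (star x phi) = md_assoc Y X A \oc star (bmap ten y x \oc Dl) phi.
Proof.
rewrite [in LHS]/star -[y]compm1 bmapM -compA cofree_coassoc.
rewrite compm1 -compA (comp_reassoc _ (esym (md_assoc_nat _ _ _))).
by rewrite /star -compA -[phi in RHS]compm1 bmapM -compA.
Qed.

Lemma star_counit A (phi : hom P A) : md_unit A \oc star ep phi = phi.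
Proof.
rewrite /star bmap_rl -compA (comp_reassoc _ (md_unit_nat _)) -[RHS]compm1 -compA.
congr (_ \oc _); rewrite /cofree_coact -[idm P](bmap1 act) (comp_reassoc _ (esym (md_assoc_nat _ _ _))).
by rewrite -compA (comp_reassoc _ (md_unit_act _ _)) -!bmap_idr compA Dl_counit bmap1.
Qed.

End Comonoid.

(** * The adjunction given by a left dual *)

Section LeftDual.
Variables (X X' : D) (ev : hom (ten X' X) 1) (coev : hom 1 (ten X X')).
Hypothesis zigzag : mc_runit X \oc bmap ten (idm X) ev \oc mc_assoc X X' X
  \oc bmap ten coev (idm X) = mc_lunit X.

(** The counit of the adjunction between acting by X' and acting by X. *)
Definition act_ev A : hom (act X' (act X A)) A :=
  md_unit A \oc bmap act ev (idm A) \oc inv_of (md_assoc_iso X' X A).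

Lemma act_evE A : act_ev A \oc md_assoc X' X A = md_unit A \oc bmap act ev (idm A).
Proof. by rewrite -compA inv_ofK compm1. Qed.

(** The zigzag identity of X acted on A. Composing first with the isomorphism [md_assoc 1 X A] makes
    [md_unit_act] applicable, after which pentagon, triangle and naturality move the constraints
    into place. *)
Lemma zigzag_act A :
  bmap act (idm X) (act_ev A) \oc md_assoc X X' (act X A) \oc bmap act coev (idm (act X A)) =
  md_unit (act X A).
Proof.
apply: (iso_epi (md_assoc_iso 1 X A)).
rewrite md_unit_act -zigzag -!compA -(bmap1 act X A) -md_assoc_nat.
rewrite (comp_reassoc _ (md_pentagon _ _ _ _)) -!compA.
rewrite (comp_reassoc _ (esym (bmap_idl act _ _ _))) act_evE bmap_idl -!compA.
rewrite -bmap_idr (comp_reassoc _ (esym (md_assoc_nat _ _ _))) -!compA -!bmap_idr.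
rewrite (comp_reassoc _ (md_triangle _ _)) -bmap_idr.
by rewrite !compA.
Qed.

(** Injectivity of the passage to mates: by [zigzag_act], g is recovered from its mate and
    [coev]. *)
Lemma act_mate_inj B A (g : hom B (act X A)) :
  act_ev A \oc bmap act (idm X') g = 0 -> g = 0.
Proof.
move=> e0; apply: (iso_epi (md_unit_iso B)).
rewrite comp0l -md_unit_nat -zigzag_act -!compA -bmap_lr (bmap_rl act coev g).
rewrite -(bmap1 (mc_ten D) X X') (comp_reassoc _ (md_assoc_nat _ _ _)) -!compA.
by rewrite (comp_reassoc _ (esym (bmap_idl act _ _ _))) e0 bmap0r comp0l.
Qed.

End LeftDual.
End ModuleCategories.

(** * The comonoid H in H-mod *)

Section RegularComonoid.
Variables (k : fieldType) (L R : algType k) (H : falgType k) (HH : hopf_algebroid L R H).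
Local Notation s := (lb_s HH).
Local Notation t := (lb_t HH).
Local Notation e := (lb_e HH).
Local Notation D := (lb_D HH).
Local Notation Rg := (regular HH).
Local Notation C := (rep (ha_l HH)).

Definition reg_mod : amod H.
Proof.
apply: (@AMod _ _ H (fun a x => a * x)) => [x|a|x|a b x|].
- by lin.
- by lin.
- exact: mul1r.
- by rewrite mulrA.
- exact: fin_dim_vect.
Defined.

Lemma comul_act a (x : reg_mod) :
  (D (a * x) : mtens Rg reg_mod reg_mod) = mact a (D x : mtens Rg reg_mod reg_mod).
Proof. by rewrite lb_DM /tmul tlift_exchange. Qed.

Definition comul : ahom reg_mod (mtens Rg reg_mod reg_mod) :=
  @mk_ahom _ _ reg_mod (mtens Rg reg_mod reg_mod) (fun x => D x) (linearP D) comul_act.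

Lemma counit_act a (x : reg_mod) : (e (a * x) : umod HH) = mact a (e x : umod HH).
Proof. by rewrite /= lb_es. Qed.

Definition counit : ahom reg_mod (umod HH) :=
  @mk_ahom _ _ reg_mod (umod HH) (fun x => e x) (linearP e) counit_act.

Definition rho (X : amod H) (x : X) : ahom reg_mod X :=
  @mk_ahom _ _ reg_mod X (fun h => mact h x) (mact_linl x) (fun a h => mactM a h x).

Lemma ahom_regP (X : amod H) (f g : ahom reg_mod X) : f 1 = g 1 -> f = g.
Proof.
move=> e1; apply: ahom_ext => h.
by rewrite -[h]mulr1 -[h * 1]/(mact h (1 : reg_mod)) !ahomE e1.
Qed.

Lemma rho_lin (X : amod H) a (x y : X) : rho (a *: x + y) = a *: rho x + rho y.
Proof.
apply: ahom_regP; rewrite -[RHS]/(a *: rho x 1 + rho y 1) /=.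
exact: mact_linr.
Qed.

Lemma rho_act (X : amod H) h (x : X) :
  rho (mact h x) = acomp (rho x) (rho (h : reg_mod)).
Proof. by apply: ahom_regP; rewrite /= mact1 mul1r. Qed.

Lemma rho_comp (X Y : amod H) (f : ahom X Y) (x : X) : acomp f (rho x) = rho (f x).
Proof. by apply: ahom_regP; rewrite /= !mact1. Qed.

Lemma comul_coassoc :
  (mtens_assoc Rg reg_mod reg_mod reg_mod : @hom _ C (mc_ten C (mc_ten C _ _) _) _)
    \oc bmap (mc_ten C) (comul : @hom _ C reg_mod _) (idm (reg_mod : C))
    \oc (comul : @hom _ C reg_mod _)
  = bmap (mc_ten C) (idm (reg_mod : C)) (comul : @hom _ C reg_mod _) \oc (comul : @hom _ C reg_mod _).
Proof.
apply: ahom_ext => h.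
pose T := mtens Rg reg_mod (mtens Rg reg_mod reg_mod).
have [b1 b2 b3] := tpure_bal (fun l => @mact _ _ reg_mod (t l))
  (fun l => @mact _ _ (mtens Rg reg_mod reg_mod) (ca_s Rg l)).
have [c1 c2 c3] := tpure_bal (fun l => @mact _ _ reg_mod (t l))
  (fun l => @mact _ _ reg_mod (ca_s Rg l)).
transitivity (tlift (fun a b => tlift (fun x y => (x : reg_mod) \ox
    ((y : reg_mod) \ox (b : reg_mod) : mtens Rg reg_mod reg_mod) : T) (D a)) (D h)).
  transitivity (mtens_assoc Rg reg_mod reg_mod reg_mod
     (mtens_map Rg comul (aid reg_mod) (tlift (fun x y => x \ox y) (D h)))).
    by rewrite tlift_pure.
  rewrite (lin_tlift _ _ (@ahom_lin _ _ _ _ (mtens_map _ _ _))) (lin_tlift _ _ (@ahom_lin _ _ _ _ (mtens_assoc _ _ _ _))).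
  apply: eq_tlift => a b; rewrite mtens_mapE /=.
  exact: tliftE (mtens_assoc_bal Rg reg_mod reg_mod reg_mod).
transitivity (tlift (fun a b => tlift (fun x y => (a : reg_mod) \ox
    ((x : reg_mod) \ox (y : reg_mod) : mtens Rg reg_mod reg_mod) : T) (D b)) (D h)).
  apply: coassoc_eval (lb_coassoc HH h).
  - by move=> l a u v; rewrite /lmulact mulrDr scalAr.
  - by move=> l r y; rewrite /lmulact !mulrA lb_stC.
  split=> [y z|x z|x y|l x y z|l x y z].
  - by move=> c u v; rewrite b1.
  - by move=> c u v; rewrite c1 b2.
  - by move=> c u v; rewrite c2 b2.
  - by rewrite b3 mtens_act_s.
  - by rewrite c3.
transitivity (mtens_map Rg (aid reg_mod) comul (tlift (fun x y => x \ox y) (D h))); last first.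
  by rewrite tlift_pure.
rewrite (lin_tlift _ _ (@ahom_lin _ _ _ _ (mtens_map _ _ _))).
apply: eq_tlift => a b; rewrite mtens_mapE /= -[in RHS](tlift_pure (D b)).
by rewrite (lin_tlift _ _ (b2 a)).
Qed.

Lemma comul_counit :
  mc_lunit (m := C) (reg_mod : C)
    \oc bmap (mc_ten C) (counit : @hom _ C reg_mod _) (idm (reg_mod : C))
    \oc (comul : @hom _ C reg_mod _) = idm (reg_mod : C).
Proof.
apply: ahom_ext => h.
transitivity (lunit Rg reg_mod
   (mtens_map Rg counit (aid reg_mod) (tlift (fun x y => x \ox y) (D h)))).
  by rewrite tlift_pure.
rewrite (lin_tlift _ _ (@ahom_lin _ _ _ _ (mtens_map _ _ _))) (lin_tlift _ _ (@ahom_lin _ _ _ _ (lunit _ _))).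
rewrite -[RHS](lb_counitl HH h); apply: eq_tlift => a b.
by rewrite mtens_mapE /= lunit_funE.
Qed.

Lemma comul_t l :
  bmap (mc_ten C) (rho (t l : reg_mod) : @hom _ C reg_mod reg_mod) (idm (reg_mod : C))
    \oc (comul : @hom _ C reg_mod _) =
  bmap (mc_ten C) (idm (reg_mod : C)) (rho (s l : reg_mod) : @hom _ C reg_mod reg_mod)
    \oc (comul : @hom _ C reg_mod _).
Proof. by apply: ahom_ext => h; exact: (lb_takeuchi HH h l). Qed.

Lemma comul_s l :
  bmap (mc_ten C) (rho (s l : reg_mod) : @hom _ C reg_mod reg_mod) (idm (reg_mod : C))
    \oc (comul : @hom _ C reg_mod _) =
  (comul : @hom _ C reg_mod _) \oc (rho (s l : reg_mod) : @hom _ C reg_mod reg_mod).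
Proof. by apply: ahom_ext => h; apply/esym; exact: (lb_D_Ms HH l h). Qed.

Lemma rho_tensor (X Y : amod H) (x : X) (y : Y) :
  bmap (mc_ten C) (rho x : @hom _ C reg_mod X) (rho y : @hom _ C reg_mod Y)
    \oc (comul : @hom _ C reg_mod _) = rho (x \ox y : mtens Rg X Y) :> ahom _ _.
Proof.
by apply: ahom_ext => h; rewrite [RHS](mtens_mactE Rg).
Qed.

(** On l (x) y the zigzag is the dual basis expansion of y acted on by s(l), because s(l) commutes
    with the image of t. *)
Lemma zigzag_of_dual_basis (X X' : amod H) m (x : 'I_m -> X) (f : 'I_m -> X')
    (ev : ahom (mtens Rg X' X) (umod HH)) (coev : ahom (umod HH) (mtens Rg X X')) :
  (forall y, y = \sum_i mact (t (ev (f i \ox y))) (x i)) ->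
  (forall l, coev l = \sum_i mact (s l) (x i) \ox f i) ->
  mc_runit (X : C) \oc bmap (mc_ten C) (idm (X : C)) (ev : @hom _ C (mc_ten C X' X) (mc_unit C))
    \oc mc_assoc (X : C) (X' : C) (X : C)
    \oc bmap (mc_ten C) (coev : @hom _ C (mc_unit C) (mc_ten C X X')) (idm (X : C))
  = mc_lunit (X : C).
Proof.
move=> xf coevE.
apply: mtens_ahom_ext => l y.
have [b1 b2 b3] := tpure_bal (fun l => @mact _ _ X (t l))
  (fun l => @mact _ _ X' (ca_s Rg l)).
have [c1 c2 c3] := tpure_bal (fun l => @mact _ _ (mtens Rg X X') (t l))
  (fun l => @mact _ _ X (ca_s Rg l)).
transitivity (runit HH X (mtens_map Rg (aid X) ev (mtens_assoc Rg X X' X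
   (mtens_map Rg coev (aid X) (l \ox y))))) => //.
transitivity (lunit Rg X (l \ox y)) => //.
rewrite mtens_mapE coevE (linsum (c1 _)).
rewrite (linsum (@ahom_lin _ _ _ _ (mtens_assoc Rg X X' X))).
rewrite (linsum (@ahom_lin _ _ _ _ (mtens_map Rg (aid X) ev))).
rewrite (linsum (@ahom_lin _ _ _ _ (runit HH X))).
rewrite [RHS]lunit_funE {2}(xf y) (linsum (mact_linr _)).
apply: eq_bigr => i _.
rewrite mtens_assocE mtens_mapE [LHS]runit_funE -!mactM.
by rewrite -lb_stC.
Qed.

End RegularComonoid.

(** * The comparison map from X (x)_L Hom(P, A) to Hom(P, X . A) *)

Section InternalTensor.
Variables (k : fieldType) (L R : algType k) (H : falgType k) (HH : hopf_algebroid L R H).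
Hypothesis HH_rigid : left_rigid HH.
Local Notation s := (lb_s HH).
Local Notation t := (lb_t HH).
Local Notation e := (lb_e HH).
Local Notation Rg := (regular HH).
Local Notation C := (rep (ha_l HH)).
Local Notation reg := (reg_mod H).
Variables (M : modcat C) (M0 : M).
Local Notation act := (md_act M).
Local Notation P := (md_act M (reg : C) M0).

(** Right multiplication by a is left H-linear, hence acts on P; for a = s(l), precomposing with it
    is the left L-action on Hom(P, A). *)
Definition rmap (a : H) : hom P P :=
  bmap act (rho (a : reg) : @hom _ C reg reg) (idm M0).

Lemma rmap_lin : linear rmap.
Proof. by move=> c a b; rewrite /rmap rho_lin bmap_linl. Qed.
Lemma rmap1 : rmap 1 = idm P.
Proof.
rewrite /rmap -(bmap1 act); congr (bmap act _ _).
by apply: ahom_regP; rewrite /= mulr1.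
Qed.
Lemma rmapM a b : rmap (a * b) = rmap b \oc rmap a.
Proof.
rewrite /rmap -bmap_idr; congr (bmap act _ _).
exact: (rho_act a (b : reg)).
Qed.

Definition st (X : amod H) (A : M) (x : X) (phi : hom P A) : hom P (act (X : C) A) :=
  star (comul HH : @hom _ C reg _) (rho x : @hom _ C reg X) phi.

Lemma st_linl (X : amod H) A (phi : hom P A) : linear (fun x : X => st x phi).
Proof. by move=> a x y; rewrite /st /star rho_lin bmap_linl comp_linl. Qed.
Lemma st_linr (X : amod H) A (x : X) : linear (fun phi : hom P A => st x phi).
Proof. by move=> a f g; rewrite /st /star bmap_linr comp_linl. Qed.

Lemma st_comp (X X' : amod H) A A' (f : @hom _ C X X') (g : hom A A') (x : X) (phi : hom P A) :
  bmap act f g \oc st x phi = st ((f : ahom X X') x) (g \oc phi).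
Proof. by rewrite /st -star_comp -rho_comp. Qed.

Lemma st_compr (X : amod H) A B (g : hom A B) (x : X) (phi : hom P A) :
  st x (g \oc phi) = bmap act (idm (X : C)) g \oc st x phi.
Proof. by rewrite st_comp. Qed.

Lemma st_act (X : amod H) A (x : X) (phi : hom P A) h :
  st (mact h x) phi = bmap act (rho x : @hom _ C reg X) phi \oc
    st (h : reg) (idm P).
Proof. by rewrite st_comp compm1 /=. Qed.

(** L-balancedness is the Takeuchi condition: right multiplication by t(l) on the left leg of
    [comul] equals right multiplication by s(l) on the right leg. *)
Lemma st_t (X : amod H) A (x : X) (phi : hom P A) l :
  st (mact (t l) x) phi = st x (phi \oc rmap (s l)).
Proof.
rewrite st_act /st /star.
have -> : bmap act (rho x : @hom _ C reg X) (phi \oc rmap (s l)) =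
    bmap act (rho x : @hom _ C reg X) phi \oc bmap act (idm (reg : C)) (rmap (s l)).
  by rewrite -bmapM compm1.
rewrite -[RHS]compA; congr (_ \oc _).
by rewrite cofree_l comul_t -cofree_r.
Qed.

Lemma cofree_rmap l :
  cofree_coact (comul HH : @hom _ C reg _) M0 \oc rmap (s l) = st (s l : reg) (idm P).
Proof. by rewrite cofree_m /st /star cofree_l comul_s. Qed.

Lemma st_rmap (X : amod H) A (x : X) (phi : hom P A) l :
  st x phi \oc rmap (s l) = bmap act (rho x : @hom _ C reg X) phi \oc st (s l : reg) (idm P).
Proof. by rewrite /st {1}/star -compA cofree_rmap. Qed.

Lemma st_unit A (l : umod HH) (phi : hom P A) : md_unit A \oc st l phi = phi \oc rmap (s l).
Proof.
have -> : st l phi = star (comul HH : @hom _ C reg _) (counit HH : @hom _ C reg _) phi \oc rmap (s l).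
  rewrite /star -compA cofree_rmap st_comp compm1; congr st.
  by rewrite /= lb_e_s.
by rewrite compA star_counit //; exact: comul_counit.
Qed.

Lemma st_st (X Y : amod H) A (y : Y) (x : X) (phi : hom P A) :
  st y (st x phi) = md_assoc (Y : C) (X : C) A \oc st (y \ox x : mtens Rg Y X) phi.
Proof. by rewrite /st star_star -?rho_tensor //; exact: comul_coassoc. Qed.

Section Comparison.
Variables (X : amod H) (A : M).
Let ra := fun l => @mact _ _ X (t l).
Let la := fun l (phi : hom P A) => phi \oc rmap (s l).

Lemma st_bal : balanced ra la (@st X A).
Proof. by split=> [phi|x|l x phi]; [exact: st_linl|exact: st_linr|exact: st_t]. Qed.

Definition cmap (u : tens ra la) : hom P (act (X : C) A) := tlift (@st X A) u.
Lemma cmap_lin : linear cmap. Proof. exact: tlift_lin st_bal. Qed.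
Lemma cmapE x phi : cmap (x \ox phi) = st x phi. Proof. exact: tliftE st_bal. Qed.

(** The inverse sends psi to \sum_i x_i (x) phi_i, where phi_i is the evaluation morphism [act_ev]
    after f_i star psi. One composite is the identity by the dual basis, the other by the zigzag
    identity, since [coev] sends 1 to \sum_i x_i (x) f_i. *)
Lemma cmap_bij : exists d : hom P (act (X : C) A) -> tens ra la,
  [/\ linear d, cancel cmap d & cancel d cmap].
Proof.
have [X' [m [x [f [ev [coev [xf coevE]]]]]]] := HH_rigid X.
pose evC : @hom _ C (mc_ten C X' X) (mc_unit C) := ev.
pose coevC : @hom _ C (mc_unit C) (mc_ten C X X') := coev.
have zz := zigzag_of_dual_basis xf coevE.
pose d psi := \sum_i x i \ox (act_ev evC A \oc st (f i) psi) : tens ra la.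
have [b1 b2 b3] := tpure_bal ra la.
have dlin : linear d.
  move=> a u v; rewrite /d scaler_sumr -big_split; apply: eq_bigr => i _ /=.
  by rewrite st_linr comp_linr b2.
exists d; split=> // [|psi].
  apply: (@tens_ext _ _ _ _ ra la _ (d \o cmap) id) => // [a u v|y phi].
    by rewrite /= cmap_lin dlin.
  rewrite /= cmapE {2}(xf y) (linsum (b1 _)); apply: eq_bigr => i _.
  rewrite st_st compA act_evE -compA st_comp comp1m st_unit.
  by rewrite b3.
rewrite /d (linsum cmap_lin).
under eq_bigr do rewrite cmapE st_compr st_st compA.
rewrite -compsumr -(linsum (@st_linl (mtens Rg X X') _ psi)).
have <- : (coev : ahom _ _) 1 = \sum_i x i \ox f i.
  by rewrite coevE; apply: eq_bigr => i _; rewrite rmorph1 mact1.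
rewrite -[psi in st _ psi]comp1m -(st_comp coevC).
rewrite compA (zigzag_act zz) st_unit rmorph1 rmap1 compm1 //.
Qed.

End Comparison.
End InternalTensor.

(** * The algebra of endomorphisms of P and the functor Hom(P, -) *)

Section OppositeEndomorphisms.
Variables (k : fieldType) (C : lincat k) (P : C) (nz : idm P != 0).

(* Multiplication is opposite to composition; the argument makes the algebra
   nontrivial, as required of an algType. *)
Definition endop (_ : idm P != 0) : Type := hom P P.
Local Notation K := (endop nz).
HB.instance Definition _ := GRing.Lmodule.on K.

Definition endop_mul (f g : K) : K := (g : hom P P) \oc (f : hom P P).
Lemma endop_mulA : associative endop_mul.
Proof. by move=> f g h; rewrite /endop_mul compA. Qed.
Lemma endop_mul1 : left_id (idm P : K) endop_mul.
Proof. by move=> f; exact: compm1. Qed.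
Lemma endop_mulr1 : right_id (idm P : K) endop_mul.
Proof. by move=> f; exact: comp1m. Qed.
Lemma endop_mulDl : left_distributive endop_mul +%R.
Proof. by move=> f g h; exact: compDr. Qed.
Lemma endop_mulDr : right_distributive endop_mul +%R.
Proof. by move=> f g h; exact: compDl. Qed.
HB.instance Definition _ := GRing.Zmodule_isNzRing.Build K
  endop_mulA endop_mul1 endop_mulr1 endop_mulDl endop_mulDr nz.
Lemma endop_scalel a (f g : K) : a *: (f * g) = a *: f * g.
Proof. by apply/esym; exact: compZr. Qed.
Lemma endop_scaler a (f g : K) : a *: (f * g) = f * (a *: g).
Proof. by apply/esym; exact: compZl. Qed.
HB.instance Definition _ := GRing.Lmodule_isLalgebra.Build k K endop_scalel.
HB.instance Definition _ := GRing.Lalgebra_isAlgebra.Build k K endop_scaler.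

Lemma endopM (f g : K) : f * g = (g : hom P P) \oc (f : hom P P). Proof. by []. Qed.
Lemma endop1 : (1 : K) = idm P. Proof. by []. Qed.

Hypothesis finC : finite_cat C.

Definition hom_mod (A : C) : amod K.
Proof.
apply: (@AMod _ K (hom P A) (fun a phi => phi \oc (a : hom P P))) => [phi|a|phi|a b phi|].
- exact: comp_linr.
- exact: comp_linl.
- exact: compm1.
- exact: compA.
- by case: finC.
Defined.

Definition hom_map (A B : C) (g : hom A B) : ahom (hom_mod A) (hom_mod B).
Proof.
apply: (@mk_ahom _ _ (hom_mod A) (hom_mod B) (fun phi => g \oc phi)).
  exact: comp_linr.
by move=> a phi; exact: compA.
Defined.

Definition hom_functor : functor C (mod_cat K).
Proof.
exists (hom_mod : C -> mod_cat K) hom_map.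
- by move=> A; apply: ahom_ext => phi; exact: comp1m.
- by move=> A B B' g f; apply: ahom_ext => phi; apply/esym; exact: compA.
- by move=> A B a f g; apply: ahom_ext => phi; exact: comp_linl.
Defined.

End OppositeEndomorphisms.

(** * The comodule algebra of endomorphisms *)

Section EndomorphismComoduleAlgebra.
Variables (k : fieldType) (L R : algType k) (H : falgType k) (HH : hopf_algebroid L R H).
Hypothesis HH_rigid : left_rigid HH.
Local Notation s := (lb_s HH).
Local Notation t := (lb_t HH).
Local Notation e := (lb_e HH).
Local Notation C := (rep (ha_l HH)).
Local Notation reg := (reg_mod H).
Variables (M : modcat C) (M0 : M).
Local Notation act := (md_act M).
Local Notation P := (md_act M (reg : C) M0).
Local Notation rm := (rmap M0).
Variable nz : idm P != 0.
Local Notation K := (endop nz).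
Local Notation delta := (cofree_coact (comul HH : @hom _ C reg _) M0).

(** Left multiplication by [end_s l] in K is precomposition with [rm (s l)], so T is the source of
    the comparison map for A = P. Multiplicativity combines two reversals, in [rmapM] and in the
    product of K. *)
Definition end_s (l : L) : K := rm (s l).
Lemma end_s_lin : linear end_s.
Proof. by move=> a u v; rewrite /end_s linearP rmap_lin. Qed.
Lemma end_s_mul : monoid_morphism end_s.
Proof. by split=> [|a b]; rewrite /end_s ?rmorph1 ?rmap1 // rmorphM rmapM. Qed.
HB.instance Definition _ := GRing.isLinear.Build k L K *:%R end_s end_s_lin.
HB.instance Definition _ := GRing.isMonoidMorphism.Build L K end_s end_s_mul.

Local Notation T := (tens (lmulact t) (lmulact end_s)).

Lemma cm_bal : balanced (lmulact t) (lmulact end_s)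
  (fun x (phi : K) => st (x : reg) (phi : hom P P)).
Proof.
split=> [phi|x|l x phi]; [exact: (@st_linl _ _ _ _ HH M M0 reg P phi)|exact: (@st_linr _ _ _ _ HH M M0 reg P x)|].
exact: (st_t (x : reg) (phi : hom P P) l).
Qed.
Definition cm (u : T) : hom P (act (reg : C) P) :=
  tlift (fun x (phi : K) => st (x : reg) (phi : hom P P)) u.
Lemma cm_lin : linear cm. Proof. exact: tlift_lin cm_bal. Qed.
Lemma cmE x (phi : K) : cm (x \ox phi) = st (x : reg) (phi : hom P P).
Proof. exact: tliftE cm_bal. Qed.

(* The lmodType underlying K is not convertible to [hom P P], whence the
   transport of the inverse from [cmap_bij]. *)
Lemma cm_inv : {d : hom P (act (reg : C) P) -> T | [/\ linear d, cancel cm d & cancel d cm]}.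
Proof.
apply: cid; have [d [d_lin cd dc]] := @cmap_bij _ _ _ _ HH HH_rigid M M0 reg P.
have [b1 b2 b3] := tpure_bal (lmulact t) (lmulact end_s).
have bal : balanced (fun l => @mact _ _ reg (t l)) (fun l (phi : hom P P) => phi \oc rm (s l))
    (fun (x : reg) (phi : hom P P) => (x : H) \ox (phi : K) : T).
  by split=> [psi|x|l x psi]; [exact: b1|exact: (b2 (x : H))|exact: (b3 l (x : H) (psi : K))].
pose g psi := tlift (fun (x : reg) (phi : hom P P) => (x : H) \ox (phi : K) : T) (d psi).
have g_lin : linear g by move=> a u v; rewrite /g d_lin (tlift_lin bal).
have stE (x : reg) (phi : hom P P) : st x phi = cmap (x \ox phi) by rewrite cmapE.
exists g; split=> // [|psi].
  apply: tens_ext => // [a u v|x phi]; first by rewrite cm_lin g_lin.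
  by rewrite cmE stE /g cd (tliftE _ _ bal).
rewrite /g (lin_tlift _ _ cm_lin) -[RHS]dc.
by apply: eq_tlift => x phi; rewrite cmE.
Qed.
Definition cmi := sval cm_inv.
Lemma cmi_lin : linear cmi. Proof. by case: (svalP cm_inv). Qed.
Lemma cmK : cancel cm cmi. Proof. by case: (svalP cm_inv). Qed.
Lemma cmiK : cancel cmi cm. Proof. by case: (svalP cm_inv). Qed.
Lemma cm_inj : injective cm. Proof. exact: can_inj cmK. Qed.
Lemma cm_tlift u : cm u = tlift (fun (x : H) (phi : K) => st (x : reg) (phi : hom P P)) u.
Proof. by []. Qed.

Definition end_lam (a : K) : T := cmi (delta \oc (a : hom P P)).
Lemma end_lam_lin : linear end_lam.
Proof. by move=> a u v; rewrite /end_lam comp_linr cmi_lin. Qed.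
HB.instance Definition _ := GRing.isLinear.Build k K T *:%R end_lam end_lam_lin.

Lemma end_lamE a : tlift (fun (x : H) (phi : K) => st (x : reg) (phi : hom P P)) (end_lam a) = delta \oc (a : hom P P).
Proof. by rewrite -cm_tlift cmiK. Qed.

Lemma cm_act l u : cm (tact1 (lmulact s l) u) = cm u \oc rm (s l).
Proof.
have bal : balanced (lmulact t) (lmulact end_s)
    (fun x (y : K) => lmulact s l x \ox y : T).
  have [b1 b2 b3] := tpure_bal (lmulact t) (lmulact end_s).
  split=> [y a u' v|x|l' x y]; first by rewrite /lmulact mulrDr scalAr b1.
    exact: b2.
  by rewrite -b3 /lmulact mulrA lb_stC mulrA.
move: u; apply: tens_ext => [a u v|a u v|x phi].
- by rewrite /tact1 (tlift_lin bal) cm_lin.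
- by rewrite cm_lin comp_linl.
rewrite /tact1 (tliftE _ _ bal) !cmE /lmulact.
by rewrite -[_ * x]/(mact (s l) (x : reg)) st_act st_rmap.
Qed.

Local Notation T3 := (tens (lmulact t) (fun l => @tact1 _ _ _ _ (lmulact t) (lmulact end_s) (lmulact s l))).

Lemma cm3_bal : balanced (lmulact t)
  (fun l => @tact1 _ _ _ _ (lmulact t) (lmulact end_s) (lmulact s l))
  (fun x v => st (x : reg) (cm v)).
Proof.
split=> [v|x|l x v].
- exact: (@st_linl _ _ _ _ HH M M0 reg _ (cm v)).
- by move=> a u v; rewrite cm_lin st_linr.
- by rewrite -[lmulact _ _ _]/(mact (t l) (x : reg)) st_t cm_act.
Qed.
Definition cm3 (u : T3) := tlift (fun x v => st (x : reg) (cm v)) u.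
Lemma cm3_lin : linear cm3. Proof. exact: tlift_lin cm3_bal. Qed.
Lemma cm3E x v : cm3 (x \ox v) = st (x : reg) (cm v).
Proof. exact: tliftE cm3_bal. Qed.

(** [cm3] is the comparison map for [reg] and [reg . P], preceded by the bijection [cm] on the
    second leg. *)
Lemma cm3_inj : injective cm3.
Proof.
have [d [d_lin cd dc]] := @cmap_bij _ _ _ _ HH HH_rigid M M0 reg (act (reg : C) P).
pose la l (phi : hom P (act (reg : C) P)) := phi \oc rm (s l).
have [b1 b2 b3] := tpure_bal (lmulact t)
  (fun l => @tact1 _ _ _ _ (lmulact t) (lmulact end_s) (lmulact s l)).
have bal : balanced (lmulact t) la (fun x psi => x \ox cmi psi : T3).
  split=> [psi|x a u v|l x psi]; first exact: b1.
    by rewrite cmi_lin b2.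
  rewrite b3; congr (_ \ox _); apply: cm_inj.
  by rewrite cm_act !cmiK.
pose g psi := tlift (fun x psi => x \ox cmi psi : T3) (d psi).
apply: (can_inj (g := g)); apply: tens_ext => [a u v|//|x v].
  by rewrite cm3_lin /g d_lin (tlift_lin bal).
have -> : cm3 (x \ox v) = cmap (X := reg) (x \ox cm v) by rewrite cm3E cmapE.
by rewrite /g cd (tliftE _ _ bal) cmK.
Qed.

Lemma end_lamL l x : end_lam (end_s l * x) = tact1 (lmulact s l) (end_lam x).
Proof. by apply: cm_inj; rewrite cm_act !cmiK compA. Qed.

Lemma st_unit_sum (u : T) :
  tlift (fun h y => end_s (e h) * y) u =
  md_unit P \oc bmap act (counit HH : @hom _ C reg _) (idm P) \oc cm u.
Proof.
rewrite cm_tlift (lin_tlift _ _ (comp_linr _)); apply: eq_tlift => x phi.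
by rewrite -compA st_comp comp1m st_unit.
Qed.

Lemma end_counit x : tlift (fun h y => end_s (e h) * y) (end_lam x) = x.
Proof.
rewrite st_unit_sum cmiK compA.
have := star_counit (comul_counit HH) (idm P); rewrite /star compA => ->.
exact: comp1m.
Qed.

(** After [cm3] the right side is (H . delta) delta x, and the left side is its other form in
    [cofree_coassoc]. *)
Lemma end_coassoc x :
  tlift (fun h y => tlift (fun h1 h2 => h1 \ox (h2 \ox y)) (lb_D HH h)) (end_lam x)
  = tlift (fun h y => h \ox end_lam y) (end_lam x) :> T3.
Proof.
apply: cm3_inj.
rewrite !(lin_tlift _ _ cm3_lin).
transitivity (bmap act (idm (reg : C)) delta \oc (delta \oc (x : hom P P))); last first.
  rewrite -end_lamE (lin_tlift _ _ (comp_linr _)); apply: eq_tlift => h y.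
  by rewrite cm3E cmiK st_comp.
rewrite compA (cofree_coassoc (comul_coassoc HH)) -compA -end_lamE.
rewrite (lin_tlift _ _ (comp_linr _)); apply: eq_tlift => h y.
rewrite (lin_tlift _ _ cm3_lin) -compA st_comp comp1m /=.
transitivity (md_assoc (reg : C) (reg : C) P \oc
  st (tlift (fun x y => x \ox y : mtens (regular HH) reg reg) (lb_D HH h) : mtens (regular HH) reg reg) (y : hom P P)).
  rewrite (@lin_tlift _ _ _ _ _ _ _ _ (fun w : mtens (regular HH) reg reg => st w (y : hom P P))).
    rewrite (lin_tlift _ _ (comp_linr _)); apply: eq_tlift => h1 h2.
    by rewrite cm3E cmE st_st.
  exact: st_linl.
by rewrite tlift_pure.
Qed.

Lemma end_takeuchi x l :
  tlift (fun h y => (h * t l) \ox y) (end_lam x) =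
  tlift (fun h y => h \ox (y * end_s l)) (end_lam x) :> T.
Proof.
apply: cm_inj; rewrite !(lin_tlift _ _ cm_lin).
transitivity (bmap act (rho (t l : reg) : @hom _ C reg reg) (idm P) \oc (delta \oc (x : hom P P))).
  rewrite -end_lamE (lin_tlift _ _ (comp_linr _)); apply: eq_tlift => h y.
  by rewrite cmE st_comp comp1m.
rewrite compA cofree_l comul_t -cofree_r -compA -end_lamE.
rewrite (lin_tlift _ _ (comp_linr _)); apply: eq_tlift => h y.
by rewrite cmE st_comp.
Qed.

Lemma end_lam1 : end_lam 1 = 1 \ox 1.
Proof.
apply: cm_inj; rewrite cmiK cmE /st /star compm1.
have -> : rho (1 : reg) = idm (reg : C) by apply: ahom_regP; exact: mulr1.
by rewrite bmap1 comp1m.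
Qed.

(** Since x * y is y after x, delta (x * y) expands in two rounds: delta y is a sum of h' star y',
    and (h' . y') delta x is a sum of (h h') star (z * y'). Right multiplication in H and the
    opposite product in K reverse the order consistently. *)
Lemma end_lamM x y : end_lam (x * y) = tmul (end_lam x) (end_lam y).
Proof.
apply: cm_inj; rewrite cmiK endopM compA -end_lamE /tmul tlift_exchange.
rewrite (lin_tlift _ _ cm_lin) (lin_tlift _ _ (comp_linl _)); apply: eq_tlift => h' y'.
rewrite (lin_tlift _ _ cm_lin) /st /star -compA -end_lamE.
rewrite (lin_tlift _ _ (comp_linr _)); apply: eq_tlift => h z.
by rewrite st_comp cmE.
Qed.

Definition end_comod : comod_alg (ha_l HH) K :=
  @ComodAlg _ _ _ (ha_l HH) K end_s end_lam end_lamL end_counit end_coassoc end_takeuchi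
    end_lam1 end_lamM.

Hypothesis finM : finite_cat M.
Local Notation N := (comod_rep end_comod).
Local Notation F := (hom_functor nz finM : functor M N).

Section Structure.
Variables (X : amod H) (A : M).

Lemma struct_bal : balanced (fun l => @mact _ _ X (t l))
  (fun l => @mact _ _ (F A) (ca_s end_comod l)) (fun x (phi : F A) => st x (phi : hom P A)).
Proof. exact: st_bal. Qed.

Definition struct_fun (u : mtens end_comod X (F A)) : F (act (X : C) A) :=
  tlift (fun x (phi : F A) => st x (phi : hom P A)) u.
Lemma struct_lin : linear struct_fun. Proof. exact: tlift_lin struct_bal. Qed.
Lemma struct_funE x (phi : F A) : struct_fun (x \ox phi) = st x (phi : hom P A).
Proof. exact: tliftE struct_bal. Qed.

Lemma struct_act a u : struct_fun (mact a u) = mact a (struct_fun u).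
Proof.
move: u; apply: (@mtens_ext _ _ _ _ _ end_comod X (F A) _
  (fun u => struct_fun (mact a u)) (fun u => mact a (struct_fun u))) => [c v w|c v w|x phi].
- by rewrite mact_linr struct_lin.
- by rewrite struct_lin mact_linr.
rewrite struct_funE mtens_mactE (lin_tlift _ _ struct_lin) /=.
rewrite /st /star -compA -end_lamE (lin_tlift _ _ (comp_linr _)).
apply: eq_tlift => h y; rewrite struct_funE.
by rewrite [RHS]st_comp.
Qed.

Definition struct : ahom (mtens end_comod X (F A)) (F (act (X : C) A)) :=
  mk_ahom struct_lin struct_act.

Lemma struct_iso : is_iso (struct : @hom _ N (md_act N (X : C) (F A)) (F (act (X : C) A))).
Proof.
have [d [d_lin cd dc]] := @cmap_bij _ _ _ _ HH HH_rigid M M0 X A.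
exact: (@mod_iso _ _ _ _ struct d d_lin).
Qed.
End Structure.

(** A module functor needs maps F (X . A) -> X . F A, whereas pure tensors determine maps in the
    other direction; each coherence law is proved for [struct] and carried over to its inverse. *)
Definition cstruct (X : amod H) (A : M) :
    @hom _ N (F (act (X : C) A)) (md_act N (X : C) (F A)) := inv_of (struct_iso X A).

Lemma cstruct_iso X A : is_iso (cstruct X A). Proof. exact: inv_of_iso. Qed.

Lemma structK X A : @comp _ N _ _ _ (struct X A) (cstruct X A) = idm _.
Proof. exact: inv_ofKr. Qed.
Lemma cstructK X A : @comp _ N _ _ _ (cstruct X A) (struct X A) = idm _.
Proof. exact: inv_ofK. Qed.

Lemma cstruct_nat (X X' : C) (A A' : M) (f : hom X X') (g : hom A A') :
  cstruct X' A' \oc fmap F (bmap act f g) = bmap (md_act N) f (fmap F g) \oc cstruct X A.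
Proof.
apply: (iso_epi (struct_iso X A)); rewrite -[RHS]compA cstructK compm1.
apply: (iso_mono (struct_iso X' A')); rewrite compA compA structK comp1m.
apply: mtens_ahom_ext => x phi.
by rewrite /= mtens_map_funE !struct_funE st_comp.
Qed.

Lemma struct_assoc (X Y : C) (A : M) :
  fmap F (md_assoc X Y A) \oc (struct (mc_ten C X Y) A : @hom _ N _ _) =
  (struct X (act Y A) : @hom _ N (md_act N X (F (act Y A))) _)
    \oc (bmap (md_act N) (idm X) (struct Y A : @hom _ N (md_act N Y (F A)) _)
    \oc md_assoc X Y (F A : N)).
Proof.
apply: mtens_assoc_ahom_ext => x y phi.
rewrite /= mtens_assoc_funE mtens_map_funE !struct_funE.
by rewrite -[X in st x X]/(struct_fun (y \ox phi)) struct_funE st_st.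
Qed.

Lemma cstruct_assoc (X Y : C) (A : M) :
  md_assoc X Y (F A : N) \oc cstruct (mc_ten C X Y) A =
  bmap (md_act N) (idm X) (cstruct Y A) \oc cstruct X (act Y A) \oc fmap F (md_assoc X Y A).
Proof.
apply: (iso_epi (struct_iso (mc_ten C X Y) A)); rewrite -[LHS]compA cstructK compm1.
rewrite -[RHS]compA struct_assoc -[RHS]compA (comp_reassoc _ (cstructK _ _)) comp1m.
by rewrite compA -bmap_idl cstructK bmap1 comp1m.
Qed.

Lemma cstruct_unit (A : M) :
  md_unit (F A : N) \oc cstruct (mc_unit C) A = fmap F (md_unit A).
Proof.
apply: (iso_epi (struct_iso (mc_unit C) A)); rewrite -[LHS]compA cstructK compm1.
apply: mtens_ahom_ext => l phi.
by rewrite /= lunit_funE struct_funE st_unit.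
Qed.

Lemma modcat_equiv_end : is_equivalence F -> modcat_equiv M N.
Proof.
move=> eqF; exists F, cstruct; split=> //.
- exact: cstruct_iso.
- exact: cstruct_nat.
- exact: cstruct_assoc.
- exact: cstruct_unit.
Qed.

End EndomorphismComoduleAlgebra.

(** * Hom(P, -) is an equivalence *)

Section Morita.
Variables (k : fieldType) (C : lincat k) (P : C) (nz : idm P != 0).
Hypotheses (abC : abelian C) (finC : finite_cat C).
Hypotheses (P_proj : projective P) (P_gen : generates P).
Local Notation K := (endop nz).
Local Notation F := (hom_functor nz finC).

Lemma hom_functor_faithful (A B : C) (f : hom A B) : fmap F f = 0 -> f = 0.
Proof. by move=> e; apply: P_gen => u; exact: (congr1 (fun g : ahom (F A) (F B) => g u) e). Qed.

(** Spanning maps u_i : P -> A give an epi P^n -> A. The maps th(u_i) define P^n -> B; by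
    K-linearity of th, and because P generates, it kills whatever the epi kills, so it descends to
    A. *)
Lemma hom_functor_full (A B : C) (th : hom (F A) (F B)) : exists f : hom A B, fmap F f = th.
Proof.
have [n [u hu]] : fin_dim (hom P A) by case: finC.
pose thf (phi : hom P A) : hom P B := (th : ahom (F A) (F B)) phi.
have th_lin : linear thf by exact: (@ahom_lin _ _ (hom_mod nz finC A) (hom_mod nz finC B) th).
have thM (phi : hom P A) (a : hom P P) : thf (phi \oc a) = thf phi \oc a.
  exact: (ahomE (th : ahom (F A) (F B)) (a : K) phi).
have [Pn _] := copower_exists abC n P.
have epi_pi : epi (cp_map Pn u).
  apply: epiP => Z h h0; apply: P_gen => phi; have [c ->] := hu phi.
  rewrite compsumr big1 // => i _; rewrite compZr -(cp_mapE Pn u) compA h0 comp0l.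
  exact: scaler0.
have [f ef] : exists f, f \oc cp_map Pn u = cp_map Pn (fun i => thf (u i)).
  apply: (epi_factor abC epi_pi) => T g g0; apply: P_gen => w.
  rewrite -compA compsuml.
  transitivity (thf (cp_map Pn u \oc (g \oc w))); last by rewrite compA g0 comp0l (lin0 th_lin).
  rewrite [in RHS]compsuml (linsum th_lin); apply: eq_bigr => i _.
  by rewrite -!compA thM.
exists f; apply: ahom_ext => phi; have [c ->] := hu phi.
rewrite -[RHS]/(thf _) (linsum th_lin) [LHS]compsumr; apply: eq_bigr => i _.
by rewrite compZr (linZ th_lin) -(cp_mapE Pn u) compA ef cp_mapE cp_mapE.
Qed.

(** Generators of X give T from Hom(P, P^n), a free K-module, onto X. Finitely many elements r_j
    span its kernel; A is the cokernel of the map P^m -> P^n they define, and projectivity of P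
    makes Hom(P, A) the quotient of Hom(P, P^n) by that kernel. *)
Lemma hom_functor_surj (X : mod_cat K) : exists A : C, isom (F A) X.
Proof.
have [n [x hx]] := mact_fin (X : amod K).
have [Pn _] := copower_exists abC n P.
pose T (w : hom P Pn) : (X : amod K) := \sum_i mact (cp_out Pn i \oc w : K) (x i).
have T_lin : linear T.
  move=> a u v; rewrite /T scaler_sumr -big_split; apply: eq_bigr => i _ /=.
  by rewrite comp_linr; exact: mact_linl.
have T_act (w : hom P Pn) (a : hom P P) : T (w \oc a) = mact (a : K) (T w).
  rewrite /T (linsum (mact_linr _)); apply: eq_bigr => i _.
  by rewrite -mactM compA.
have T_surj y : exists w, T w = y.
  have [c ->] := hx y; exists (\sum_i c i *: cp_in Pn i).
  apply: eq_bigr => i _; rewrite compsumr (bigD1 i) //= big1 => [|j ne].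
    by rewrite addr0 compZr cp_io eqxx (linZ (mact_linl _)) -endop1 mact1.
  by rewrite compZr cp_io eq_sym (negbTE ne) scaler0.
have finP : fin_dim (hom P Pn) by case: finC.
have [||m [r [r0 hr]]] := subspace_spanned (U := fun w => T w = 0) finP.
- exact: lin0 T_lin.
- by move=> a u v eu ev; rewrite T_lin eu ev scaler0 addr0.
have [Pm _] := copower_exists abC m P.
have [_ _ kc _ _] := abC.
have [_ [A [q kq]]] := kc _ _ (cp_map Pm r).
have epi_q := cokernel_epi kq.
have T_ker w : q \oc w = 0 <-> T w = 0.
  split=> [/(projective_exact abC P_proj kq) [v ->]|/hr [c ->]].
    rewrite compsuml (linsum T_lin) big1 // => j _.
    by rewrite -compA T_act r0 (lin0 (mact_linr _)).
  rewrite compsumr big1 // => j _.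
  by rewrite compZr -(cp_mapE Pm r) compA (proj1 kq) comp0l scaler0.
pose lift (phi : hom P A) : hom P Pn := sval (cid (proj_lift phi P_proj epi_q)).
have liftE phi : q \oc lift phi = phi by rewrite /lift; case: cid.
have T_eq w w' : q \oc w = q \oc w' -> T w = T w'.
  move=> e; apply/eqP; rewrite -subr_eq0 -scaleN1r addrC -T_lin; apply/eqP/T_ker.
  by rewrite comp_linr e scaleN1r addNr.
pose f (phi : F A) : (X : amod K) := T (lift phi).
have f_lin : linear f.
  by move=> a u v; rewrite /f -T_lin; apply: T_eq; rewrite comp_linr !liftE.
have f_act (a : K) phi : f (mact a phi) = mact a (f phi).
  by rewrite /f -T_act; apply: T_eq; rewrite compA !liftE.
pose g y : F A := q \oc sval (cid (T_surj y)).
have fg y : f (g y) = y.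
  rewrite /g; case: cid => w /= <-; apply: T_eq; exact: liftE.
have f_inj phi : f phi = 0 -> phi = 0 by move=> /T_ker; rewrite liftE.
have f_inj' : injective f.
  move=> u v e; apply/eqP; rewrite -subr_eq0 -scaleN1r addrC; apply/eqP/f_inj.
  by rewrite f_lin e scaleN1r addNr.
exists A, (mk_ahom f_lin f_act); apply: (@mod_iso _ _ _ _ _ g) => [a u v|u|//].
  by apply: f_inj'; rewrite f_lin !fg.
by apply: f_inj'; exact: fg.
Qed.

Lemma hom_functor_equivalence : is_equivalence F.
Proof.
apply: equivalence_of_ff.
- exact: hom_functor_faithful.
- exact: hom_functor_full.
- exact: hom_functor_surj.
Qed.

End Morita.

(** * Epimorphisms and kernels of modules *)

Section ModuleCategoryOfAlgebra.
Variables (k : fieldType) (A : algType k).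

(** In coordinates, U is the row space of a matrix B, so v is outside U exactly when it has a
    nonzero product with some column of [cokermx B]. *)
Lemma separating_functional (V : lmodType k) (U : V -> Prop) (v : V) : fin_dim V ->
  U 0 -> (forall a x y, U x -> U y -> U (a *: x + y)) -> ~ U v ->
  exists xi : V -> k^o, [/\ linear xi, forall u, U u -> xi u = 0 & xi v != 0].
Proof.
move=> finV U0 Ulin nUv.
have [m [r [rU hr]]] := subspace_spanned finV U0 Ulin.
have [n [e [xi [xil eE _]]]] := fin_dim_basis finV.
pose co w : 'rV[k]_n := \row_i xi i w.
have col : linear co by move=> a x y; apply/rowP => i; rewrite !mxE xil.
pose B : 'M[k]_(m, n) := \matrix_(j < m) co (r j).
have coB u : U u -> co u *m cokermx B = 0.
  move=> /hr [c ->]; rewrite (linsum col) mulmx_suml big1 // => j _.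
  rewrite (linZ col) -scalemxAl.
  have -> : co (r j) = row j B by rewrite rowK.
  by rewrite -row_mul mulmx_coker row0 scaler0.
have : co v *m cokermx B != 0.
  rewrite -submxE; apply/negP => /submxP [c ec]; apply: nUv.
  have -> : v = \sum_j c 0 j *: r j.
    rewrite [LHS]eE [RHS]eE; apply: eq_bigr => i _; congr (_ *: _).
    have /rowP/(_ i) := ec; rewrite !mxE => ->.
    by rewrite (linsum (xil i)); apply: eq_bigr => j _; rewrite !mxE (linZ (xil i)).
  elim/big_ind: _ => [//|x y Ux Uy|j _].
    by rewrite -[x]scale1r; apply: Ulin.
  by rewrite -[_ *: _]addr0; apply: Ulin.
move=> /rV0Pn [i hi].
exists (fun u => (co u *m cokermx B) 0 i); split=> // [a x y|u Uu].
  by rewrite col mulmxDl -scalemxAl !mxE.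
by rewrite coB // mxE.
Qed.

(* The cokernel of p is k (x) Y with c (x) p(x) identified with 0. *)
Section Cokernel.
Variables (X Y : amod A) (p : ahom X Y).
Let ra (x : X) (c : k^o) : k^o := 0.
Let la (x : X) (y : Y) : Y := p x.
Let T := tens ra la.

Lemma coker_act_bal a : balanced ra la (fun c y => (c : k^o) \ox mact a y : T).
Proof.
have [b1 b2 b3] := tpure_bal ra la.
split=> [y|c u v w|x c y]; [exact: b1|by rewrite mact_linr b2|].
have z w : ra x c \ox w = 0 :> T by exact: (lin0 (b1 w)).
by rewrite z /la -ahomE -[p _]/(la (mact a x) y) -b3 (lin0 (b1 y)).
Qed.
Definition coker_act a (u : T) : T := tlift (fun c y => (c : k^o) \ox mact a y) u.
Lemma coker_actE a (c : k^o) y : coker_act a (c \ox y) = c \ox mact a y.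
Proof. exact: tliftE (coker_act_bal a). Qed.
Lemma coker_act_linr a : linear (coker_act a).
Proof. exact: tlift_lin (coker_act_bal a). Qed.

Definition coker_mod : amod A.
Proof.
apply: (@AMod _ _ T coker_act) => [u|a|u|a b u|].
- have [b1 b2 b3] := tpure_bal ra la.
  by apply: tlift_linf => c y a b b'; rewrite mact_linl b2.
- exact: coker_act_linr.
- move: u; apply: tens_ext => // [|c y]; first exact: coker_act_linr.
  by rewrite coker_actE mact1.
- move: u; apply: (@tens_ext _ _ _ _ _ _ _ (coker_act (a * b)) (fun u => coker_act a (coker_act b u))).
  + exact: coker_act_linr.
  + by move=> c x y; rewrite !coker_act_linr.
  + by move=> c y; rewrite !coker_actE mactM.
- apply: fin_dim_tens (mact_fin Y).
  by exists 1%N, (fun=> 1) => c; exists (fun=> c); rewrite big_ord1 [RHS]mulr1.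
Defined.

Definition coker_proj : ahom Y coker_mod.
Proof.
apply: (@mk_ahom _ _ Y coker_mod (fun y => (1 : k^o) \ox y : T)).
  by have [_ b2 _] := tpure_bal ra la; exact: b2.
by move=> a y; rewrite /= coker_actE.
Defined.

Lemma coker_proj0 x : coker_proj (p x) = 0.
Proof.
have [b1 b2 b3] := tpure_bal ra la.
by rewrite /= -[p x]/(la x 0) -b3 (lin0 (b1 _)).
Qed.

(** If y were missed, a linear functional vanishing on the image of p but not at y would induce one
    on the cokernel, showing 1 (x) y nonzero there; but an epi p forces the projection to the
    cokernel to vanish. *)
Lemma epi_surjective : epi (p : @hom _ (mod_cat A) X Y) -> forall y, exists x, p x = y.
Proof.
move=> ep y; have [//|no] := EM (exists x, p x = y).
have [||xi [xil xip /eqP[]]] := @separating_functional Y (fun y => exists x, p x = y) y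
    (mact_fin Y) _ _ no.
- by exists 0; exact: lin0 (@ahom_lin _ _ _ _ p).
- by move=> a _ _ [x <-] [x' <-]; exists (a *: x + x'); exact: ahom_lin.
have e0 : (coker_proj : @hom _ (mod_cat A) Y coker_mod) = 0.
  by apply: (epi_eq0 ep); apply: ahom_ext => x; exact: coker_proj0.
have bal : balanced ra la (fun (c : k^o) y => c * xi y : k^o).
  split=> [y'|c a u v|x c y']; first by lin.
    by rewrite xil mulrDr scalAr.
  by rewrite mul0r xip ?mulr0 //; exists x.
have := congr1 (fun g : ahom Y coker_mod => tlift (fun (c : k^o) y => c * xi y : k^o) (g y)) e0.
rewrite (tliftE _ _ bal) mul1r => ->.
exact: (lin0 (tlift_lin bal)).
Qed.

End Cokernel.

Section Kernel.
Variables (X Y : amod A) (f : ahom X Y).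

Definition kerP : pred X := fun x => `[< f x = 0 >].
Lemma ker_submod : submod_closed kerP.
Proof.
split=> [|a x y /asboolP ex /asboolP ey]; apply/asboolP.
  exact: lin0 (@ahom_lin _ _ _ _ f).
by rewrite ahom_lin ex ey scaler0 addr0.
Qed.
HB.instance Definition _ := GRing.isSubmodClosed.Build k X kerP ker_submod.
Record ker := Ker { ker_val :> X; ker_in : kerP ker_val }.
HB.instance Definition _ := [isSub for ker_val].
HB.instance Definition _ := [Choice of ker by <:].
HB.instance Definition _ := [SubChoice_isSubLmodule of ker by <:].

Lemma ker0 (x : ker) : f x = 0.
Proof. exact: (asboolW (ker_in x)). Qed.
Definition mk_ker x (e : f x = 0) : ker := Ker (introT (asboolP _) e).
Lemma ker_inj (x y : ker) : (x : X) = y -> x = y.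
Proof. exact: val_inj. Qed.

Lemma ker_act0 a (x : ker) : f (mact a x) = 0.
Proof. by rewrite ahomE ker0 (lin0 (mact_linr a)). Qed.

Definition ker_mod : amod A.
Proof.
apply: (@AMod _ _ ker (fun a x => mk_ker (ker_act0 a x))) => [x|a|x|a b x|].
- by move=> c u v; apply: ker_inj; exact: mact_linl.
- by move=> c u v; apply: ker_inj; exact: mact_linr.
- by apply: ker_inj; exact: mact1.
- by apply: ker_inj; exact: mactM.
have [||m [r [r0 hr]]] := @subspace_spanned _ X (fun x => f x = 0) (mact_fin X).
- exact: lin0 (@ahom_lin _ _ _ _ f).
- by move=> a x y ex ey; rewrite ahom_lin ex ey scaler0 addr0.
exists m, (fun j => mk_ker (r0 j)) => x; have [c ec] := hr _ (ker0 x).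
exists c; apply: ker_inj; rewrite ec.
by rewrite (big_morph (fun x : ker => (x : X)) (id1 := 0) (op1 := +%R)).
Defined.

Definition ker_incl : ahom ker_mod X.
Proof. by apply: (@mk_ahom _ _ ker_mod X (fun x : ker => (x : X))). Defined.

Lemma ker_is_kernel : is_kernel (ker_incl : @hom _ (mod_cat A) _ _) (f : @hom _ (mod_cat A) X Y).
Proof.
split=> [|T h e]; first by apply: ahom_ext => x; exact: ker0.
have e' x : f ((h : ahom T X) x) = 0 by exact: (congr1 (fun g : ahom T Y => g x) e).
have hl : linear (fun x => mk_ker (e' x)) by move=> a x y; apply: ker_inj; exact: ahom_lin.
have ha a x : mk_ker (e' (mact a x)) = mact a (mk_ker (e' x) : ker_mod).
  by apply: ker_inj; exact: ahomE.
exists (@mk_ahom _ _ T ker_mod _ hl ha); split; first exact: ahom_ext.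
move=> u eu; apply: ahom_ext => x; apply: ker_inj.
exact: (esym (congr1 (fun g : ahom T X => g x) eu)).
Qed.

End Kernel.
End ModuleCategoryOfAlgebra.

(** * Free covers *)

Section FreeCover.
Variables (k : fieldType) (L R : algType k) (H : falgType k) (HH : hopf_algebroid L R H).
Local Notation C := (rep (ha_l HH)).
Local Notation reg := (reg_mod H).
Local Notation s := (lb_s HH).
Local Notation e := (lb_e HH).

Lemma reg_projective : projective (reg : C).
Proof.
move=> X Y p f /(@epi_surjective _ _ X Y p) sp.
have [x ex] := sp ((f : ahom reg Y) 1).
by exists (rho x); apply: ahom_regP; rewrite /= mact1.
Qed.

(** Bi-exactness speaks of short exact sequences, so eps is completed to one before acting. As s is
    a k-linear section of eps, a map h killing the kernel satisfies h(x) = h(s(eps(x))), and h s is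
    the required factorisation. *)
Lemma counit_exact : exists (N : C) (i : hom N (reg : C)),
  short_exact i (counit HH : @hom _ C reg (umod HH)).
Proof.
exists (ker_mod (counit HH)), (ker_incl (counit HH)); split; first exact: ker_is_kernel.
split=> [|T h h0]; first by case: (ker_is_kernel (counit HH)).
have hk (x : reg) : e x = 0 -> (h : ahom reg T) x = 0.
  move=> ex; exact: (congr1 (fun g : ahom (ker_mod (counit HH)) T => g (mk_ker (f := counit HH) ex)) h0).
have he (x : reg) : (h : ahom reg T) (s (e x)) = (h : ahom reg T) x.
  apply/eqP; rewrite -subr_eq0 -scaleN1r addrC -ahom_lin; apply/eqP/hk.
  by rewrite linearP /= lb_e_s scaleN1r addNr.
pose u (l : umod HH) : T := (h : ahom reg T) (s l).
have ul : linear u by move=> a x y; rewrite /u linearP ahom_lin.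
have ua a l : u (mact a l) = mact a (u l).
  by rewrite /u /= he -ahomE.
exists (mk_ahom ul ua); split; first by apply: ahom_ext => x; exact: he.
move=> v ev; apply: ahom_ext => l.
rewrite /= /u -ev /=; congr (v _); by rewrite lb_e_s.
Qed.

Variables (M : modcat C).
Hypotheses (M_modcat : module_category M) (M_exact : exact_modcat M).
Local Notation act := (md_act M).

Definition free_cover (A : M) : hom (act (reg : C) A) A :=
  md_unit A \oc bmap act (counit HH : @hom _ C reg _) (idm A).

Lemma free_cover_epi A : epi (free_cover A).
Proof.
apply: epi_comp; first exact: iso_epi (md_unit_iso A).
have [N [i si]] := counit_exact.
have [_ [_ ex]] := M_modcat.
by have [_ /cokernel_epi] := ex A _ _ _ _ _ si.
Qed.

Lemma free_projective A : projective (act (reg : C) A).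
Proof. by apply: (proj2 M_exact); exact: reg_projective. Qed.

End FreeCover.

(** * Stable subcategories and direct sums *)

Section FullSubcategory.
Variables (k : fieldType) (D : moncat k) (M : modcat D) (S : M -> Prop).
Local Notation act := (md_act M).
Hypothesis S_act : forall (X : D) A, S A -> S (act X A).

Definition subcat : lincat k.
Proof.
apply: (@LinCat k {A : M | S A} (fun A B => hom (sval A) (sval B))
  (fun A => idm (sval A)) (fun A B B' g f => g \oc f)).
- by move=> A B f; exact: comp1m.
- by move=> A B f; exact: compm1.
- by move=> A B B' B'' h g f; exact: compA.
- by move=> A B B' f; exact: comp_linl.
- by move=> A B B' g; exact: comp_linr.
Defined.

Definition sub_act : bifunctor D subcat.
Proof.
exists (fun (X : D) (A : subcat) => exist S (act X (sval A)) (S_act X (svalP A)) : subcat)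
  (fun X X' A A' f g => bmap act f g).
- by move=> X A; exact: bmap1.
- by move=> *; exact: bmapM.
- by move=> X X' A A' g; exact: bmap_linl.
- by move=> X X' A A' f; exact: (@bmap_linr _ _ _ act X X' (sval A) (sval A') f).
Defined.

Lemma sub_iso (A B : subcat) (f : hom (sval A) (sval B)) :
  is_iso f -> is_iso (f : @hom _ subcat A B).
Proof. by move=> [g h]; exists g. Qed.

Definition submod : modcat D.
Proof.
apply: (@ModCat k D subcat sub_act (fun X Y A => md_assoc X Y (sval A)) _ _
  (fun A => md_unit (sval A))).
- by move=> X Y A; apply: sub_iso; exact: md_assoc_iso.
- by move=> *; exact: md_assoc_nat.
- by move=> A; apply: sub_iso; exact: md_unit_iso.
- by move=> *; exact: md_unit_nat.
- by move=> *; exact: md_pentagon.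
- by move=> *; exact: md_triangle.
Defined.

Hypotheses (S_zero : forall Z, zero_ob Z -> S Z)
  (S_sum : forall A B Q (i1 : hom A Q) (i2 : hom B Q) p1 p2,
     is_biproduct i1 i2 p1 p2 -> S A -> S B -> S Q)
  (S_mono : forall A B (i : hom A B), mono i -> S B -> S A)
  (S_epi : forall A B (p : hom A B), epi p -> S A -> S B).
Hypothesis M_modcat : module_category M.

(** S is closed under subobjects and quotients, so kernels and cokernels taken in M stay in S. Hence
    monos, epis, kernels and cokernels of the subcategory are those of M, here and in the next
    lemmas. *)
Lemma sub_mono (A B : subcat) (f : @hom _ subcat A B) :
  mono f -> @mono _ M (sval A) (sval B) f.
Proof.
have [[_ _ kc _ _] _] := M_modcat.
move=> mf; apply: monoP => Z h fh.
have [[J [j kj]] _] := kc _ _ (f : hom (sval A) (sval B)).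
have SJ : S J by apply: S_mono (kernel_mono kj) (svalP A).
have j0 : j = 0.
  by apply: (mf (exist S J SJ : subcat) j 0); rewrite [LHS](proj1 kj) [RHS]comp0r.
by have [v [<- _]] := proj2 kj _ _ fh; rewrite j0 comp0l.
Qed.
Lemma sub_epi (A B : subcat) (f : @hom _ subcat A B) :
  epi f -> @epi _ M (sval A) (sval B) f.
Proof.
have [[_ _ kc _ _] _] := M_modcat.
move=> ef; apply: epiP => Z h fh.
have [_ [J [j kj]]] := kc _ _ (f : hom (sval A) (sval B)).
have SJ : S J by apply: S_epi (cokernel_epi kj) (svalP B).
have j0 : j = 0.
  by apply: (ef (exist S J SJ : subcat) j 0); rewrite [LHS](proj1 kj) [RHS]comp0l.
by have [v [<- _]] := proj2 kj _ _ fh; rewrite j0 comp0r.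
Qed.

Lemma sub_kernel (A B B' : subcat) (i : @hom _ subcat A B) (f : @hom _ subcat B B') :
  is_kernel i f <-> @is_kernel _ M (sval A) (sval B) (sval B') i f.
Proof.
split=> ki; last by case: ki => e u; split=> // T h; exact: u.
have [[_ _ kc _ _] _] := M_modcat.
have mi := sub_mono (kernel_mono ki).
have [e u] := ki; split=> // T h fh.
have [[J [j kj]] _] := kc _ _ (f : hom (sval B) (sval B')).
have SJ : S J by apply: S_mono (kernel_mono kj) (svalP B).
have [v [ev _]] := u (exist S J SJ : subcat) j (proj1 kj).
have [w [ew _]] := proj2 kj _ _ fh.
have e' : (i : hom (sval A) (sval B)) \oc ((v : hom J (sval A)) \oc w) = h.
  by rewrite compA [X in X \oc w]ev.
exists ((v : hom J (sval A)) \oc w); split=> // w' ew'.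
by apply: mi; rewrite e' ew'.
Qed.
Lemma sub_cokernel (A B B' : subcat) (f : @hom _ subcat A B) (p : @hom _ subcat B B') :
  is_cokernel f p <-> @is_cokernel _ M (sval A) (sval B) (sval B') f p.
Proof.
split=> ki; last by case: ki => e u; split=> // T h; exact: u.
have [[_ _ kc _ _] _] := M_modcat.
have mi := sub_epi (cokernel_epi ki).
have [e u] := ki; split=> // T h fh.
have [_ [J [j kj]]] := kc _ _ (f : hom (sval A) (sval B)).
have SJ : S J by apply: S_epi (cokernel_epi kj) (svalP B).
have [v [ev _]] := u (exist S J SJ : subcat) j (proj1 kj).
have [w [ew _]] := proj2 kj _ _ fh.
have e' : (w \oc (v : hom (sval B') J)) \oc (p : hom (sval B) (sval B')) = h.
  by rewrite -compA [X in w \oc X]ev.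
exists (w \oc (v : hom (sval B') J)); split=> // w' ew'.
by apply: mi; rewrite e' ew'.
Qed.

Lemma sub_short_exact (A B B' : subcat) (i : @hom _ subcat A B) (p : @hom _ subcat B B') :
  short_exact i p <-> @short_exact _ M (sval A) (sval B) (sval B') i p.
Proof. by split=> -[/sub_kernel ? /sub_cokernel ?]. Qed.

Lemma sub_abelian : abelian subcat.
Proof.
have [[[Z zZ] bip kc nm ne] _] := M_modcat.
split.
- exists (exist S Z (S_zero zZ)) => A; exact: (zZ (sval A)).
- move=> A B; have [Q [i1 [i2 [p1 [p2 h]]]]] := bip (sval A) (sval B).
  by exists (exist S Q (S_sum h (svalP A) (svalP B))), i1, i2, p1, p2.
- move=> A B f; have [[J [j kj]] [Q [q kq]]] := kc _ _ (f : hom (sval A) (sval B)).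
  have SJ := S_mono (kernel_mono kj) (svalP A).
  have SQ := S_epi (cokernel_epi kq) (svalP B).
  split; first by exists (exist S J SJ : subcat), j; apply/sub_kernel.
  by exists (exist S Q SQ : subcat), q; apply/sub_cokernel.
- move=> A B f /sub_mono /nm [Z' [g [gf ug]]].
  have [_ [Q [q kq]]] := kc _ _ (f : hom (sval A) (sval B)).
  have SQ := S_epi (cokernel_epi kq) (svalP B).
  exists (exist S Q SQ : subcat), q; apply/sub_kernel; split; first exact: (proj1 kq).
  move=> T h qh; apply: ug.
  by have [g' [<- _]] := proj2 kq _ _ gf; rewrite -compA qh comp0r.
- move=> A B f /sub_epi /ne [Z' [g [gf ug]]].
  have [[J [j kj]] _] := kc _ _ (f : hom (sval A) (sval B)).
  have SJ := S_mono (kernel_mono kj) (svalP A).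
  exists (exist S J SJ : subcat), j; apply/sub_cokernel; split; first exact: (proj1 kj).
  move=> T h qh; apply: ug.
  by have [g' [<- _]] := proj2 kj _ _ gf; rewrite compA qh comp0l.
Qed.

Lemma submod_module_category : module_category submod.
Proof.
have [_ [ex1 ex2]] := M_modcat.
split; first exact: sub_abelian.
split=> [X A B B' f g|A X Y Z f g].
  by move=> /sub_short_exact /ex1 h; apply/sub_short_exact; exact: h.
by move=> /ex2 h; apply/sub_short_exact; exact: h.
Qed.

End FullSubcategory.

(** * Projection onto a direct summand as a module functor *)

Section Summand.
Variables (k : fieldType) (D : moncat k) (M : modcat D) (S : M -> Prop).
Local Notation act := (md_act M).
Hypothesis S_act : forall (X : D) A, S A -> S (act X A).
Variables (pr : M -> M) (inj : forall A, hom (pr A) A) (prj : forall A, hom A (pr A)).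
Hypotheses (pr_S : forall A, S (pr A)) (prK : forall A, prj A \oc inj A = idm (pr A))
  (to_S : forall A Z (g : hom A Z), S Z -> g \oc inj A \oc prj A = g)
  (from_S : forall A Z (h : hom Z A), S Z -> inj A \oc (prj A \oc h) = h)
  (act_to_S : forall (X : D) A Z (g : hom (act X A) Z), S Z ->
     g \oc bmap act (idm X) (inj A \oc prj A) = g).
Local Notation N := (submod S_act).

(** Composition is respected because [from_S] lets the projector [inj prj] be removed in front of a
    map with source in S. *)
Definition summand : functor M N.
Proof.
exists (fun A => exist S (pr A) (pr_S A) : N) (fun A B f => prj B \oc f \oc inj A).
- by move=> A; rewrite compm1; exact: prK.
- move=> A B B' g f.
  transitivity ((prj B' \oc g \oc inj B) \oc (prj B \oc f \oc inj A)) => //.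
  by rewrite -[RHS]compA -(compA (prj B) f) from_S // !compA.
- by move=> A B a f g; rewrite comp_linr comp_linl.
Defined.

Definition summand_c (X : D) (A : M) : @hom _ N (summand (act X A)) (md_act N X (summand A)) :=
  bmap act (idm X) (prj A) \oc inj (act X A).

Lemma summand_c_iso X A : is_iso (summand_c X A).
Proof.
exists (prj (act X A) \oc bmap act (idm X) (inj A)); split.
  transitivity ((prj (act X A) \oc bmap act (idm X) (inj A)) \oc
    (bmap act (idm X) (prj A) \oc inj (act X A))) => //.
  by rewrite -compA (compA (bmap _ _ _)) -bmap_idl compA act_to_S // prK.
transitivity ((bmap act (idm X) (prj A) \oc inj (act X A)) \oc
  (prj (act X A) \oc bmap act (idm X) (inj A))) => //.
rewrite compA to_S; last by apply: S_act; exact: pr_S.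
by rewrite -bmap_idl prK bmap1.
Qed.

Lemma summand_c_nat X X' A A' (f : hom X X') (g : hom A A') :
  summand_c X' A' \oc fmap summand (bmap act f g) =
  bmap (md_act N) f (fmap summand g) \oc summand_c X A.
Proof.
transitivity ((bmap act (idm X') (prj A') \oc inj (act X' A')) \oc
  (prj (act X' A') \oc bmap act f g \oc inj (act X A))) => //.
transitivity (bmap act f (prj A' \oc g \oc inj A) \oc
  (bmap act (idm X) (prj A) \oc inj (act X A))) => //.
rewrite [RHS]compA -bmapM compm1 to_S //.
rewrite -(compA (prj _)) (compA (_ \oc inj _)) to_S; last by apply: S_act; exact: pr_S.
by rewrite compA -bmapM comp1m.
Qed.

Lemma summand_c_assoc (X Y : D) A :
  md_assoc X Y (summand A) \oc summand_c (mc_ten D X Y) A =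
  bmap (md_act N) (idm X) (summand_c Y A) \oc summand_c X (act Y A)
    \oc fmap summand (md_assoc X Y A).
Proof.
transitivity (md_assoc X Y (pr A) \oc
  (bmap act (idm (mc_ten D X Y)) (prj A) \oc inj (act (mc_ten D X Y) A))) => //.
transitivity (bmap act (idm X) (bmap act (idm Y) (prj A) \oc inj (act Y A)) \oc
  (bmap act (idm X) (prj (act Y A)) \oc inj (act X (act Y A))) \oc
  (prj (act X (act Y A)) \oc md_assoc X Y A \oc inj (act (mc_ten D X Y) A))) => //.
have SY : S (act Y (pr A)) by apply: S_act; exact: pr_S.
have SXY : S (act X (act Y (pr A))) by exact: S_act.
have -> : bmap act (idm X) (bmap act (idm Y) (prj A) \oc inj (act Y A)) \oc
    (bmap act (idm X) (prj (act Y A)) \oc inj (act X (act Y A))) =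
    bmap act (idm X) (bmap act (idm Y) (prj A)) \oc inj (act X (act Y A)).
  by rewrite compA -bmap_idl to_S.
rewrite -(compA (prj _)) [RHS]compA to_S //.
by rewrite !compA -md_assoc_nat bmap1.
Qed.

Lemma summand_c_unit A :
  md_unit (summand A) \oc summand_c (mc_unit D) A = fmap summand (md_unit A).
Proof.
transitivity (md_unit (pr A) \oc (bmap act (idm (mc_unit D)) (prj A) \oc inj (act (mc_unit D) A))) => //.
transitivity (prj A \oc md_unit A \oc inj (act (mc_unit D) A)) => //.
by rewrite compA md_unit_nat.
Qed.
End Summand.

(** * Decomposition along two mutually orthogonal subcategories *)

Section DirectSumDecomposition.
Variables (k : fieldType) (D : moncat k) (M : modcat D) (S1 S2 : M -> Prop).
Local Notation act := (md_act M).
Hypotheses (S1_act : forall (X : D) A, S1 A -> S1 (act X A))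
  (S2_act : forall (X : D) A, S2 A -> S2 (act X A)).
Hypotheses (hom12 : forall A B (f : hom A B), S1 A -> S2 B -> f = 0)
  (hom21 : forall A B (f : hom A B), S2 A -> S1 B -> f = 0).
Hypothesis abM : abelian M.

Record splitting (A : M) := Splitting {
  sp1 : M; sp2 : M; in1 : hom sp1 A; in2 : hom sp2 A; out1 : hom A sp1; out2 : hom A sp2;
  sp1_S : S1 sp1; sp2_S : S2 sp2; sp_bip : is_biproduct in1 in2 out1 out2
}.

Variable dec : forall A : M, splitting A.

Lemma split1K A : out1 (dec A) \oc in1 (dec A) = idm _. Proof. by case: (sp_bip (dec A)). Qed.
Lemma split2K A : out2 (dec A) \oc in2 (dec A) = idm _. Proof. by case: (sp_bip (dec A)). Qed.
Lemma split_sum A : in1 (dec A) \oc out1 (dec A) + in2 (dec A) \oc out2 (dec A) = idm A.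
Proof. by case: (sp_bip (dec A)). Qed.
Lemma split1E A : in1 (dec A) \oc out1 (dec A) = idm A - in2 (dec A) \oc out2 (dec A).
Proof. by rewrite -split_sum addrK. Qed.
Lemma split2E A : in2 (dec A) \oc out2 (dec A) = idm A - in1 (dec A) \oc out1 (dec A).
Proof. by rewrite -split_sum addrC addKr. Qed.

Lemma split1_to A Z (g : hom A Z) : S1 Z -> g \oc in1 (dec A) \oc out1 (dec A) = g.
Proof.
move=> SZ; rewrite -compA split1E compBr compm1 compA.
by rewrite (hom21 (g \oc _) (sp2_S (dec A)) SZ) comp0l subr0.
Qed.
Lemma split1_from A Z (g : hom Z A) : S1 Z -> in1 (dec A) \oc (out1 (dec A) \oc g) = g.
Proof.
move=> SZ; rewrite compA split1E compBl comp1m -compA.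
by rewrite (hom12 (_ \oc g) SZ (sp2_S (dec A))) comp0r subr0.
Qed.
Lemma split1_act (X : D) A Z (g : hom (act X A) Z) : S1 Z ->
  g \oc bmap act (idm X) (in1 (dec A) \oc out1 (dec A)) = g.
Proof.
move=> SZ; rewrite split1E -scaleN1r addrC (bmap_linr act) bmap1.
rewrite comp_linr compm1 bmap_idl compA.
by rewrite (hom21 (g \oc _) (S2_act X (sp2_S (dec A))) SZ) comp0l scaler0 add0r.
Qed.
Lemma split2_to A Z (g : hom A Z) : S2 Z -> g \oc in2 (dec A) \oc out2 (dec A) = g.
Proof.
move=> SZ; rewrite -compA split2E compBr compm1 compA.
by rewrite (hom12 (g \oc _) (sp1_S (dec A)) SZ) comp0l subr0.
Qed.
Lemma split2_from A Z (g : hom Z A) : S2 Z -> in2 (dec A) \oc (out2 (dec A) \oc g) = g.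
Proof.
move=> SZ; rewrite compA split2E compBl comp1m -compA.
by rewrite (hom21 (_ \oc g) SZ (sp1_S (dec A))) comp0r subr0.
Qed.
Lemma split2_act (X : D) A Z (g : hom (act X A) Z) : S2 Z ->
  g \oc bmap act (idm X) (in2 (dec A) \oc out2 (dec A)) = g.
Proof.
move=> SZ; rewrite split2E -scaleN1r addrC (bmap_linr act) bmap1.
rewrite comp_linr compm1 bmap_idl compA.
by rewrite (hom12 (g \oc _) (S1_act X (sp1_S (dec A))) SZ) comp0l scaler0 add0r.
Qed.

Local Notation F1 := (@summand k D M S1 S1_act (fun A => sp1 (dec A)) (fun A => in1 (dec A))
  (fun A => out1 (dec A)) (fun A => sp1_S (dec A)) split1K split1_from).
Local Notation F2 := (@summand k D M S2 S2_act (fun A => sp2 (dec A)) (fun A => in2 (dec A))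
  (fun A => out2 (dec A)) (fun A => sp2_S (dec A)) split2K split2_from).
Local Notation N := (dsum (submod S1_act) (submod S2_act)).

Definition split_functor : functor M N.
Proof.
exists (fun A => (F1 A, F2 A) : N) (fun A B f => (fmap F1 f, fmap F2 f)).
- by move=> A; rewrite !fmap1.
- by move=> A B B' g f; rewrite !fmapM.
- by move=> A B a f g; rewrite !fmap_lin.
Defined.

(** Orthogonality makes every morphism diagonal with respect to the splittings; a pair (B1, B2) is
    reached from the biproduct of B1 and B2 in M, whose chosen splitting is again B1 and B2 up to
    isomorphism. *)
Lemma split_equivalence : is_equivalence split_functor.
Proof.
apply: equivalence_of_ff.
- move=> A B f [e1 e2].
  rewrite -(compm1 f) -split_sum compDr !compA.
  have f1 : out1 (dec B) \oc f \oc in1 (dec A) = 0 by exact: e1.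
  have f2 : out2 (dec B) \oc f \oc in2 (dec A) = 0 by exact: e2.
  rewrite -(split1_from (f \oc in1 _) (sp1_S _)) -(split2_from (f \oc in2 _) (sp2_S _)).
  by rewrite (compA (out1 _)) f1 (compA (out2 _)) f2 !comp0r !comp0l addr0.
- move=> A B [g1 g2].
  pose h1 : hom (sp1 (dec A)) (sp1 (dec B)) := g1.
  pose h2 : hom (sp2 (dec A)) (sp2 (dec B)) := g2.
  exists (in1 (dec B) \oc h1 \oc out1 (dec A) + in2 (dec B) \oc h2 \oc out2 (dec A)).
  have [e1 e2 e3 e4 _] := sp_bip (dec A); have [e1' e2' e3' e4' _] := sp_bip (dec B).
  congr pair.
    transitivity (out1 (dec B) \oc (in1 (dec B) \oc h1 \oc out1 (dec A) +
      in2 (dec B) \oc h2 \oc out2 (dec A)) \oc in1 (dec A)) => //.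
    rewrite compDr compDl !compA e1' comp1m e3' !comp0l addr0.
    by rewrite -compA e1 compm1.
  transitivity (out2 (dec B) \oc (in1 (dec B) \oc h1 \oc out1 (dec A) +
    in2 (dec B) \oc h2 \oc out2 (dec A)) \oc in2 (dec A)) => //.
  rewrite compDr compDl !compA e2' comp1m e4' !comp0l add0r.
  by rewrite -compA e2 compm1.
move=> [[B1 SB1] [B2 SB2]].
have [_ bip _ _ _] := abM.
have [Q [j1 [j2 [q1 [q2 [e1 e2 e3 e4 e5]]]]]] := bip B1 B2.
exists Q, (q1 \oc in1 (dec Q), q2 \oc in2 (dec Q)); apply: prodcat_iso.
  exists (out1 (dec Q) \oc j1); split.
    transitivity ((out1 (dec Q) \oc j1) \oc (q1 \oc in1 (dec Q))) => //.
    rewrite -compA (compA j1).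
    have -> : j1 \oc q1 = idm Q - j2 \oc q2 by rewrite -e5 addrK.
    rewrite compBl comp1m -compA (hom12 (q2 \oc _) (sp1_S _) SB2) comp0r subr0.
    exact: split1K.
  transitivity ((q1 \oc in1 (dec Q)) \oc (out1 (dec Q) \oc j1)) => //.
  by rewrite -compA split1_from.
exists (out2 (dec Q) \oc j2); split.
  transitivity ((out2 (dec Q) \oc j2) \oc (q2 \oc in2 (dec Q))) => //.
  rewrite -compA (compA j2).
  have -> : j2 \oc q2 = idm Q - j1 \oc q1 by rewrite -e5 addrC addKr.
  rewrite compBl comp1m -compA (hom21 (q1 \oc _) (sp2_S _) SB1) comp0r subr0.
  exact: split2K.
transitivity ((q2 \oc in2 (dec Q)) \oc (out2 (dec Q) \oc j2)) => //.
by rewrite -compA split2_from.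
Qed.

Lemma modcat_equiv_dsum : modcat_equiv M N.
Proof.
pose c1 := @summand_c k D M S1 S1_act (fun A => sp1 (dec A)) (fun A => in1 (dec A))
  (fun A => out1 (dec A)) (fun A => sp1_S (dec A)) split1K split1_from.
pose c2 := @summand_c k D M S2 S2_act (fun A => sp2 (dec A)) (fun A => in2 (dec A))
  (fun A => out2 (dec A)) (fun A => sp2_S (dec A)) split2K split2_from.
exists split_functor, (fun X A => (c1 X A, c2 X A)); split.
- move=> X A; apply: prodcat_iso; apply: summand_c_iso.
  + exact: split1_to. + exact: split1_act. + exact: split2_to. + exact: split2_act.
- move=> X X' A A' f g; congr pair; apply: summand_c_nat.
  + exact: split1_to. + exact: split2_to.
- move=> X Y A; congr pair; apply: summand_c_assoc.
  + exact: split1_to. + exact: split2_to.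
- by move=> A; congr pair; apply: summand_c_unit.
- exact: split_equivalence.
Qed.

End DirectSumDecomposition.

(** * Costable ideals *)

Section Annihilators.
Variables (k : fieldType) (C : lincat k) (P : C).
Hypotheses (abC : abelian C) (finC : finite_cat C).
Hypotheses (P_proj : projective P) (P_gen : generates P).

Definition end_ideal (I : hom P P -> Prop) : Prop :=
  [/\ I 0, forall u v, I u -> I v -> I (u + v) & forall a u b, I u -> I (a \oc u \oc b)].

(** The objects whose K-module Hom(P, A) is killed by I: the subcategory attached to I. *)
Definition annihilated (I : hom P P -> Prop) (A : C) : Prop :=
  forall (phi : hom P A) u, I u -> phi \oc u = 0.

Variable I : hom P P -> Prop.

Lemma annihilated_zero Z : zero_ob Z -> annihilated I Z.
Proof. by move=> zZ phi u _; rewrite (proj2 (zZ P) phi) comp0l. Qed.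
Lemma annihilated_sum A B Q (i1 : hom A Q) (i2 : hom B Q) p1 p2 :
  is_biproduct i1 i2 p1 p2 -> annihilated I A -> annihilated I B -> annihilated I Q.
Proof.
move=> [_ _ _ _ e] nA nB phi u Iu.
rewrite -(comp1m phi) -e compDl compDl -!compA (compA p1) (compA p2) nA // nB //.
by rewrite !comp0r addr0.
Qed.
Lemma annihilated_mono A B (i : hom A B) : mono i -> annihilated I B -> annihilated I A.
Proof. by move=> mi nB phi u Iu; apply: (mono_eq0 mi); rewrite compA nB. Qed.
Lemma annihilated_epi A B (p : hom A B) : epi p -> annihilated I A -> annihilated I B.
Proof.
move=> ep nA phi u Iu; have [psi <-] := proj_lift phi P_proj ep.
by rewrite -compA nA // comp0r.
Qed.

Hypothesis I_ideal : end_ideal I.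

Lemma end_ideal_lin a u v : I u -> I v -> I (a *: u + v).
Proof.
have [_ ID IM] := I_ideal => Iu Iv; apply: ID => //.
by rewrite -(comp1m u) -compZl -(compm1 (_ \oc u)); apply: IM.
Qed.

(** B is the quotient P / I, the cokernel of a map P^m -> P whose components span I; projectivity of
    P shows that the maps killed by p are no more than I. *)
Lemma ideal_cokernel : exists (B : C) (p : hom P B),
  [/\ epi p, annihilated I B & forall u, p \oc u = 0 <-> I u].
Proof.
have [I0 ID IM] := I_ideal.
have finP : fin_dim (hom P P) by case: finC.
have [m [r [rI hr]]] := subspace_spanned finP I0 end_ideal_lin.
have [Pm _] := copower_exists abC m P.
have [_ _ kc _ _] := abC.
have [_ [B [p kp]]] := kc _ _ (cp_map Pm r).
have pP u : p \oc u = 0 <-> I u.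
  split=> [/(projective_exact abC P_proj kp) [v ->]|/hr [c ->]].
    rewrite compsuml; elim/big_ind: _ => [//|x y|j _]; first exact: ID.
    by rewrite -compA -(comp1m (r j)) -(compA (idm P)) (compA (idm P)); apply: IM.
  rewrite compsumr big1 // => j _.
  by rewrite compZr -(cp_mapE Pm r) compA (proj1 kp) comp0l scaler0.
have ep := cokernel_epi kp.
exists B, p; split=> // phi u Iu.
have [psi <-] := proj_lift phi P_proj ep.
by rewrite -compA; apply/pP; rewrite -(compm1 (_ \oc u)); apply: IM.
Qed.

End Annihilators.

(** * Stable ideals and central idempotents *)

Section StableIdeals.
Variables (k : fieldType) (L R : algType k) (H : falgType k) (HH : hopf_algebroid L R H).
Hypothesis HH_rigid : left_rigid HH.
Local Notation C := (rep (ha_l HH)).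
Local Notation reg := (reg_mod H).
Variables (M : modcat C).
Hypotheses (M_modcat : module_category M) (M_exact : exact_modcat M).
Local Notation act := (md_act M).
Variable P : M.
Hypotheses (P_proj : projective P) (P_gen : generates P).
Let abM : abelian M := proj1 M_modcat.
Let finM : finite_cat M := proj1 M_exact.

Definition stable_ideal (I : hom P P -> Prop) : Prop :=
  end_ideal I /\ forall (X : C) A, annihilated I A -> annihilated I (act X A).

(* The quotient P / I is covered by an object that is both annihilated by I and
   projective, so that it splits off P modulo I. *)
Lemma stable_ideal_idempotent I : stable_ideal I ->
  exists (e : hom P P) (Q : M) (s : hom P Q) (r : hom Q P),
  [/\ I e, forall u, I u -> e \oc u = u, annihilated I Q & r \oc s = idm P - e].
Proof.
move=> [Iid Ist].
have [B [p [ep nB pI]]] := ideal_cokernel abM finM P_proj Iid.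
pose q := free_cover B.
have epi_q : epi q by exact: free_cover_epi.
have projQ : projective (act (reg : C) B) by exact: free_projective.
have [s es] := proj_lift p P_proj epi_q.
have [r er] := proj_lift q projQ ep.
have nQ : annihilated I (act (reg : C) B) by exact: Ist.
exists (idm P - r \oc s), (act (reg : C) B), s, r; split=> //.
- by apply/pI; rewrite compBr compm1 compA er es subrr.
- by move=> u Iu; rewrite compBl comp1m -compA nQ // comp0r subr0.
- by rewrite opprB addrC subrK.
Qed.

Lemma left_dual (X : C) : exists (X' : C) (ev : hom (mc_ten C X' X) (mc_unit C))
    (coev : hom (mc_unit C) (mc_ten C X X')),
  mc_runit X \oc bmap (mc_ten C) (idm X) ev \oc mc_assoc X X' X
    \oc bmap (mc_ten C) coev (idm X) = mc_lunit X.
Proof.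
have [X' [m [x [f [ev [coev [xf coevE]]]]]]] := HH_rigid X.
by exists X', ev, coev; exact: zigzag_of_dual_basis xf coevE.
Qed.

Section Central.
Variables (I : hom P P -> Prop) (e : hom P P) (Q : M) (s : hom P Q) (r : hom Q P).
Hypotheses (I_stable : stable_ideal I) (Ie : I e) (eI : forall u, I u -> e \oc u = u)
  (nQ : annihilated I Q) (rs : r \oc s = idm P - e).
Let f := idm P - e.

Lemma ee : e \oc e = e. Proof. exact: eI. Qed.
Lemma ff : f \oc f = f.
Proof. by rewrite /f compBl comp1m compBr compm1 ee subrr subr0. Qed.

Lemma annihilatedP A : annihilated I A <-> forall phi : hom P A, phi \oc e = 0.
Proof.
split=> [nA phi|h phi u Iu]; first exact: nA.
by rewrite -(eI Iu) compA h comp0l.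
Qed.

(** The complementary ideal End(P) f, two-sided by [fMf]; the objects it annihilates form the right
    orthogonal of the subcategory attached to I. *)
Definition fixed (u : hom P P) : Prop := u \oc f = u.

(** Since I is two-sided, b e lies in I, where e is a left unit: so f b e = 0. *)
Lemma fMf b : f \oc b = f \oc b \oc f.
Proof.
have [[_ _ IM] _] := I_stable.
have Ibe : I (b \oc e) by rewrite -(compm1 (b \oc e)); exact: IM.
have fbe : f \oc (b \oc e) = 0 by rewrite /f compBl comp1m (eI Ibe) subrr.
have -> : f \oc b \oc f = f \oc b - f \oc (b \oc e) by rewrite {2}/f compBr compm1 compA.
by rewrite fbe subr0.
Qed.

Lemma fixed_ideal : end_ideal fixed.
Proof.
split=> [|u v|a u b]; rewrite /fixed; first exact: comp0l.
  by move=> eu ev; rewrite compDl eu ev.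
move=> eu; rewrite -eu -!compA; congr (_ \oc (_ \oc _)).
by rewrite compA -fMf.
Qed.

Lemma annihilated_fixedP A : annihilated fixed A <-> forall phi : hom P A, phi \oc f = 0.
Proof.
split=> [nA phi|h phi u <-]; first by apply: nA; exact: ff.
by rewrite compA h.
Qed.

Lemma hom_annihilated_fixed A B (g : hom A B) :
  annihilated I A -> annihilated fixed B -> g = 0.
Proof.
move=> /annihilatedP nA /annihilated_fixedP nB; apply: P_gen => w.
by rewrite -(compm1 (g \oc w)) -[idm P](subrK e) compDr nB -compA nA comp0r addr0.
Qed.

(** As f factors through Q, it suffices that a map Q -> X . A vanishes. Its mate X' . Q -> A goes
    from an object annihilated by I, by stability, to one annihilated by [fixed], hence is zero. *)
Lemma fixed_stable : stable_ideal fixed.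
Proof.
split=> [|X A nA]; first exact: fixed_ideal.
apply/annihilated_fixedP => phi.
rewrite /f -rs compA; suff -> : phi \oc r = 0 by rewrite comp0l.
have [X' [ev [coev zz]]] := left_dual X.
apply: (act_mate_inj zz).
apply: hom_annihilated_fixed nA.
exact: (proj2 I_stable).
Qed.

(** [stable_ideal_idempotent] gives e' in End(P) f with e' u = u on that ideal, so e' = e' f = f.
    Applied to b f this yields f b f = b f, and [fMf] gives f b f = f b. *)
Lemma f_central b : f \oc b = b \oc f.
Proof.
have [e' [Q' [s' [r' [fixe' e'fix _ _]]]]] := stable_ideal_idempotent fixed_stable.
have ef : e' = f by rewrite -[LHS]fixe' e'fix //; exact: ff.
rewrite fMf -compA -{1}ef; apply: e'fix.
by rewrite /fixed -compA ff.
Qed.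

Lemma hom_fixed_annihilated A B (g : hom A B) :
  annihilated fixed A -> annihilated I B -> g = 0.
Proof.
move=> /annihilated_fixedP nA /annihilatedP nB; apply: P_gen => w.
by rewrite -(compm1 (g \oc w)) -[idm P](subrK e) compDr nB -compA nA comp0r addr0.
Qed.

Hypothesis nz : idm P != 0.

(** The action of a central f on Hom(P, A) is K-linear, hence induced by an endomorphism of A, as
    Hom(P, -) is full. *)
Lemma central_natural A : exists z : hom A A, forall phi : hom P A, z \oc phi = phi \oc f.
Proof.
pose F := hom_functor nz finM.
pose g (phi : F A) : F A := (phi : hom P A) \oc f.
have g_lin : linear g by exact: comp_linl.
have g_act (a : endop nz) phi : g (mact a phi) = mact a (g phi).
  by rewrite /g /= -!compA f_central.
have [z ez] := hom_functor_full abM (finC := finM) P_gen (mk_ahom g_lin g_act : hom (F A) (F A)).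
exists z => phi; exact: (congr1 (fun h : ahom (F A) (F A) => h phi) ez).
Qed.

(** The idempotent z splits A into the kernel of 1 - z, where f acts as the identity and so e as
    zero, and the kernel of z, where f acts as zero. *)
Lemma central_splitting A : exists sp : splitting (annihilated I) (annihilated fixed) A, True.
Proof.
have [z hz] := central_natural A.
have zz : z \oc z = z.
  by apply: (generates_ext P_gen) => u; rewrite -compA !hz -compA ff.
have [_ _ kc _ _] := abM.
have [[A1 [i1 k1]] _] := kc _ _ (idm A - z).
have [[A2 [i2 k2]] _] := kc _ _ z.
have [p1 [e1 _]] := proj2 k1 A z (ltac:(by rewrite compBl comp1m zz subrr)).
have [p2 [e2 _]] := proj2 k2 A (idm A - z) (ltac:(by rewrite compBr compm1 zz subrr)).
have m1 := kernel_mono k1; have m2 := kernel_mono k2.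
have zi1 : z \oc i1 = i1.
  by apply/esym/eqP; rewrite -subr_eq0 -{1}(comp1m i1) -compBl (proj1 k1).
have zi2 : z \oc i2 = 0 by exact: (proj1 k2).
unshelve eexists; last by [].
apply: (@Splitting _ _ _ _ _ A A1 A2 i1 i2 p1 p2).
- apply/annihilatedP => phi; apply: (mono_eq0 m1).
  rewrite compA -zi1 -(compA z) hz -compA.
  by rewrite /f compBl comp1m ee subrr comp0r.
- apply/annihilated_fixedP => phi; apply: (mono_eq0 m2).
  by rewrite compA -hz compA zi2 comp0l.
split.
- by apply: m1; rewrite compA e1 zi1 compm1.
- by apply: m2; rewrite compA e2 compBl comp1m zi2 subr0 compm1.
- by apply: m1; rewrite compA e1 zi2 comp0r.
- by apply: m2; rewrite compA e2 compBl comp1m zi1 subrr comp0r.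
- by rewrite e1 e2 addrC subrK.
Qed.

Hypothesis M_indec : indecomposable M.

(** If I annihilates no nonzero object, then P / I is zero and I contains the identity. If [fixed]
    annihilates none, the second summand of P is zero, so I annihilates P and I = 0. Otherwise M
    splits into two nonzero parts. *)
Lemma indecomposable_ideal : (forall u, I u -> u = 0) \/ I (idm P).
Proof.
have [/= h1|h1] := EM (exists A : M, annihilated I A /\ ~ zero_ob A); last first.
  right; have [B [p [ep nB pI]]] := ideal_cokernel abM finM P_proj (proj1 I_stable).
  apply/pI; rewrite compm1.
  have [zB|nzB] := EM (zero_ob B); last by case: h1; exists B.
  exact: (proj2 (zB P)).
have [/= h2|h2] := EM (exists A : M, annihilated fixed A /\ ~ zero_ob A); last first.
  left => u Iu; have [sp _] := central_splitting P.
  have nA : annihilated I P.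
    case: sp => A1 A2 i1 i2 p1 p2 n1 n2 [_ _ _ _ e12].
    have z2 : zero_ob A2.
      by have [//|nzA] := EM (zero_ob A2); case: h2; exists A2.
    have i20 : i2 = 0 by exact: (proj1 (z2 P)).
    move=> phi v Iv; rewrite -(compm1 phi) -e12 i20 comp0l addr0.
    by rewrite -!compA n1 // !comp0r.
  by rewrite -(comp1m u); exact: nA.
case: M_indec.
have [_ Ist] := I_stable; have [_ Fst] := fixed_stable.
exists (submod Ist), (submod Fst); split.
- apply: submod_module_category M_modcat.
  + exact: annihilated_zero. + exact: annihilated_sum.
  + exact: annihilated_mono. + by move=> A B p; exact: annihilated_epi.
- apply: submod_module_category M_modcat.
  + exact: annihilated_zero. + exact: annihilated_sum.
  + exact: annihilated_mono. + by move=> A B p; exact: annihilated_epi.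
- have [A [nA nzA]] := h1; exists (exist _ A nA) => /zero_ob_idm e0.
  by apply: nzA; apply/zero_ob_idm.
- have [A [nA nzA]] := h2; exists (exist _ A nA) => /zero_ob_idm e0.
  by apply: nzA; apply/zero_ob_idm.
apply: (modcat_equiv_dsum Ist Fst hom_annihilated_fixed hom_fixed_annihilated abM
  (fun A => sval (cid (central_splitting A)))).
Qed.

End Central.
End StableIdeals.

(** * Costable ideals of K and the nonzero case *)

Section NonzeroCase.
Variables (k : fieldType) (L R : algType k) (H : falgType k) (HH : hopf_algebroid L R H).
Hypothesis HH_rigid : left_rigid HH.
Local Notation C := (rep (ha_l HH)).
Local Notation reg := (reg_mod H).
Variables (M : modcat C).
Hypotheses (M_modcat : module_category M) (M_exact : exact_modcat M).
Local Notation act := (md_act M).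

Section Costable.
Variables (M0 : M) (nz : idm (act (reg : C) M0) != 0).
Local Notation P := (act (reg : C) M0).
Local Notation K := (endop nz).

Lemma two_sided_end_ideal (I : K -> Prop) : two_sided_ideal I -> end_ideal (P := P) I.
Proof.
move=> [I0 ID IM]; split=> // a u b Iu.
by have := IM (b : K) u (a : K) Iu; rewrite !endopM compA.
Qed.

(** Every phi : P -> X . A is a sum of x star phi', and composing with i in I gives (x . phi') delta
    i. Costability writes delta i as a sum of h star y with y in I, and phi' y = 0 when I
    annihilates A. *)
Lemma costable_stable (I : K -> Prop) :
  two_sided_ideal I -> costable (end_comod HH_rigid nz) I -> stable_ideal (P := P) I.
Proof.
move=> Iid Ico; split=> [|X A nA phi i Ii]; first exact: two_sided_end_ideal.
have [d [_ _ dc]] := @cmap_bij _ _ _ _ HH HH_rigid M M0 X A.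
rewrite -(dc phi) /cmap [LHS](lin_tlift (F := fun g => g \oc (i : hom P P))); last exact: comp_linl.
rewrite /tlift /tsum big1 // => -[x phi'] _ /=.
have [w [wI ew]] := Ico i Ii.
rewrite /st /star -compA -(end_lamE HH_rigid) [end_lam _ _]ew.
rewrite -(cm_tlift (nz := nz)) (linsum (@cm_lin _ _ _ _ HH M M0 nz)) compsumr big_seq big1 // => -[h y] py.
by rewrite cmE st_comp nA; [exact: (lin0 (st_linr _))|exact: wI py].
Qed.

End Costable.

Lemma nonzero_case (M_indec : indecomposable M) (A0 : M) : ~ zero_ob A0 ->
  exists (K : algType k) (B : comod_alg (ha_l HH) K), H_simple B /\ modcat_equiv M (comod_rep B).
Proof.
move=> nzA.
have abM := proj1 M_modcat; have finM := proj1 M_exact.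
have [M0 [M0_proj M0_gen]] := generator_exists abM finM.
pose P := act (reg : C) M0.
have P_proj : projective P by exact: free_projective.
have P_gen : generates P.
  by apply: (generates_epi M0_gen (q := free_cover M0)) => //; exact: free_cover_epi.
have nz : idm P != 0.
  apply/eqP => e0; apply: nzA; apply/zero_ob_idm; apply: P_gen => u.
  by rewrite comp1m -(compm1 u) e0 comp0r.
exists (endop nz), (end_comod HH_rigid nz); split; last first.
  by apply: (modcat_equiv_end (finM := finM)); apply: hom_functor_equivalence.
move=> I Iid Ico.
have Ist := costable_stable Iid Ico.
have [e [Q [s [r [Ie eI nQ rs]]]]] := stable_ideal_idempotent M_modcat M_exact P_proj Ist.
have [h|h1] := indecomposable_ideal HH_rigid M_modcat M_exact P_proj P_gen Ist Ie eI nQ rs nz M_indec.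
  by left.
right=> x; have [_ _ IM] := Iid.
by have := IM x 1 1 h1; rewrite !mulr1.
Qed.

End NonzeroCase.

(** * The zero module category *)

Section ZeroCategories.
Variables (k : fieldType) (D : moncat k) (M N : modcat D).

Lemma modcat_equiv_zero (a : M) (b : N) :
  (forall A : M, zero_ob A) -> (forall B : N, zero_ob B) -> modcat_equiv M N.
Proof.
move=> zM zN.
have eqM (A B : M) (f g : hom A B) : f = g.
  by rewrite (proj1 (zM A B) f) (proj1 (zM A B) g).
have eqN (A B : N) (f g : hom A B) : f = g.
  by rewrite (proj1 (zN A B) f) (proj1 (zN A B) g).
have isoM (A B : M) (f : hom A B) : is_iso f by exists 0; split; exact: eqM.
have isoN (A B : N) (f : hom A B) : is_iso f by exists 0; split; exact: eqN.
unshelve eexists.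
  by apply: (@Functor _ M N (fun=> b) (fun _ _ _ => 0)) => [X|X Y Z g f|X Y c u v]; exact: eqN.
exists (fun _ _ => 0); split; try (by move=> *; exact: eqN); first by move=> X A; exact: isoN.
unshelve eexists.
  by apply: (@Functor _ N M (fun=> a) (fun _ _ _ => 0)) => [X|X Y Z g f|X Y c u v]; exact: eqM.
by split; exists (fun=> 0); split=> [X|X Y f]; (exact: eqM || exact: eqN || exact: isoM || exact: isoN).
Qed.

End ZeroCategories.

(** * Rational functions as an algebra *)

Section RationalFunctions.
Variable k : fieldType.

Definition ratfun : Type := {fraction {poly k}}.
HB.instance Definition _ := GRing.Field.on ratfun.

Definition ratfun_scale (c : k) (w : ratfun) : ratfun := tofrac c%:P * w.
Lemma ratfun_scaleA a b w : ratfun_scale a (ratfun_scale b w) = ratfun_scale (a * b) w.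
Proof. by rewrite /ratfun_scale mulrA polyCM rmorphM. Qed.
Lemma ratfun_scale1 : left_id 1 ratfun_scale.
Proof. by move=> w; rewrite /ratfun_scale rmorph1 mul1r. Qed.
Lemma ratfun_scaleDr : right_distributive ratfun_scale +%R.
Proof. by move=> a u v; rewrite /ratfun_scale mulrDr. Qed.
Lemma ratfun_scaleDl w : {morph ratfun_scale^~ w : a b / a + b}.
Proof. by move=> a b; rewrite /ratfun_scale polyCD rmorphD mulrDl. Qed.
HB.instance Definition _ := GRing.Zmodule_isLmodule.Build k ratfun
  ratfun_scaleA ratfun_scale1 ratfun_scaleDr ratfun_scaleDl.
Lemma ratfun_scaleAl a (u v : ratfun) : a *: (u * v) = a *: u * v.
Proof. exact: mulrA. Qed.
HB.instance Definition _ := GRing.Lmodule_isLalgebra.Build k ratfun ratfun_scaleAl.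
Lemma ratfun_scaleAr a (u v : ratfun) : a *: (u * v) = u * (a *: v).
Proof. exact: mulrCA. Qed.
HB.instance Definition _ := GRing.Lalgebra_isAlgebra.Build k ratfun ratfun_scaleAr.

Definition ratfun_of (p : {poly k}) : ratfun := tofrac p.

Lemma ratfun_horner (p : {poly k}) :
  \sum_(i < size p) p`_i *: (ratfun_of 'X ^+ i : ratfun) = ratfun_of p.
Proof.
rewrite /ratfun_of -[in RHS](coefK p) poly_def rmorph_sum; apply: eq_bigr => i _ /=.
by rewrite -mul_polyC rmorphM rmorphXn.
Qed.

Lemma ratfun_of_neq0 p : p != 0 -> ratfun_of p != 0.
Proof. by rewrite /ratfun_of tofrac_eq0. Qed.

End RationalFunctions.

(** * The comodule algebra L (x) W *)

Section ScalarExtension.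
Variables (k : fieldType) (L W : algType k).
Let ra (i : void) (x : L) : L := x.
Let la (i : void) (w : W) : W := w.

(* L (x)_k W : nothing is balanced over the empty type. *)
Definition ext : Type := tens ra la.
HB.instance Definition _ := GRing.Lmodule.on ext.

Definition ext_pure (x : L) (w : W) : ext := x \ox w.

Lemma ext_pure_linl w : linear (ext_pure^~ w).
Proof. by have [b _ _] := tpure_bal ra la; exact: b. Qed.
Lemma ext_pure_linr x : linear (ext_pure x).
Proof. by have [_ b _] := tpure_bal ra la; exact: b. Qed.

Lemma ext_balanced (V : lmodType k) (f : L -> W -> V) :
  (forall w, linear (f^~ w)) -> (forall x, linear (f x)) -> balanced ra la f.
Proof. by split=> // -[]. Qed.

Definition ext_lift (V : lmodType k) (f : L -> W -> V) (u : ext) : V := tlift f (u : tens ra la).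

Lemma ext_lift_lin (V : lmodType k) (f : L -> W -> V) :
  (forall w, linear (f^~ w)) -> (forall x, linear (f x)) -> linear (ext_lift f).
Proof. by move=> f1 f2; exact: tlift_lin (ext_balanced f1 f2). Qed.
Lemma ext_liftE (V : lmodType k) (f : L -> W -> V) x w :
  (forall w, linear (f^~ w)) -> (forall x, linear (f x)) -> ext_lift f (ext_pure x w) = f x w.
Proof. by move=> f1 f2; exact: tliftE (ext_balanced f1 f2). Qed.

Lemma ext_ind (V : lmodType k) (F G : ext -> V) : linear F -> linear G ->
  (forall x w, F (ext_pure x w) = G (ext_pure x w)) -> F =1 G.
Proof. by move=> lF lG e u; exact: (@tens_ext _ _ _ _ ra la V F G lF lG e). Qed.

Definition ext_mul (u v : ext) : ext :=
  ext_lift (fun x w => ext_lift (fun x' w' => ext_pure (x * x') (w * w')) v) u.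

Lemma ext_mul_in_linr x w : linear (ext_lift (fun x' w' => ext_pure (x * x') (w * w'))).
Proof.
apply: ext_lift_lin => [w'|x'] a u v.
  by rewrite mulrDr scalAr ext_pure_linl.
by rewrite mulrDr scalAr ext_pure_linr.
Qed.
Lemma ext_mul_in_linl (v : ext) :
  (forall w, linear (fun x => ext_lift (fun x' w' => ext_pure (x * x') (w * w')) v)) /\
  (forall x, linear (fun w => ext_lift (fun x' w' => ext_pure (x * x') (w * w')) v)).
Proof.
split=> [w|x]; apply: tlift_linf => x' w' a y z.
  by rewrite mulrDl scalAl ext_pure_linl.
by rewrite mulrDl scalAl ext_pure_linr.
Qed.

Lemma ext_mul_linl v : linear (ext_mul^~ v).
Proof. by have [l1 l2] := ext_mul_in_linl v; exact: ext_lift_lin. Qed.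
Lemma ext_mul_linr u : linear (ext_mul u).
Proof. by apply: tlift_linf => x w; exact: ext_mul_in_linr. Qed.
Lemma ext_mulE x w x' w' :
  ext_mul (ext_pure x w) (ext_pure x' w') = ext_pure (x * x') (w * w').
Proof.
have [l1 l2] := ext_mul_in_linl (ext_pure x' w').
rewrite /ext_mul ext_liftE // ext_liftE // => [z|z] a u v.
  by rewrite mulrDr scalAr ext_pure_linl.
by rewrite mulrDr scalAr ext_pure_linr.
Qed.

Lemma ext_mulA : associative ext_mul.
Proof.
move=> u v z; move: u; apply: ext_ind => [a x y|a x y|x w].
- exact: ext_mul_linl.
- by rewrite !ext_mul_linl.
move: v; apply: ext_ind => [a y y'|a y y'|x' w'].
- by rewrite ext_mul_linl ext_mul_linr.
- by rewrite ext_mul_linr ext_mul_linl.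
move: z; apply: ext_ind => [a y y'|a y y'|x'' w''].
- by rewrite !ext_mul_linr.
- exact: ext_mul_linr.
by rewrite !ext_mulE !mulrA.
Qed.
Lemma ext_mul1 : left_id (ext_pure 1 1) ext_mul.
Proof.
apply: ext_ind => [a x y|//|x w]; first exact: ext_mul_linr.
by rewrite ext_mulE !mul1r.
Qed.
Lemma ext_mulr1 : right_id (ext_pure 1 1) ext_mul.
Proof.
apply: ext_ind => [a x y|//|x w]; first exact: ext_mul_linl.
by rewrite ext_mulE !mulr1.
Qed.
Lemma ext_mulDl : left_distributive ext_mul +%R.
Proof. by move=> u v w; exact: (linD (ext_mul_linl w)). Qed.
Lemma ext_mulDr : right_distributive ext_mul +%R.
Proof. by move=> u v w; exact: (linD (ext_mul_linr u)). Qed.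

(** As for [endop], the argument records that the algebra is nonzero. *)
Definition ext_alg (_ : ext_pure 1 1 != 0) : Type := ext.
Variable nz : ext_pure 1 1 != 0.
Local Notation K := (ext_alg nz).
HB.instance Definition _ := GRing.Lmodule.on K.
HB.instance Definition _ := GRing.Zmodule_isNzRing.Build K
  ext_mulA ext_mul1 ext_mulr1 ext_mulDl ext_mulDr nz.
Lemma ext_scaleAl a (u v : K) : a *: (u * v) = a *: u * v.
Proof. by apply/esym; exact: (linZ (ext_mul_linl v)). Qed.
HB.instance Definition _ := GRing.Lmodule_isLalgebra.Build k K ext_scaleAl.
Lemma ext_scaleAr a (u v : K) : a *: (u * v) = u * (a *: v).
Proof. by apply/esym; exact: (linZ (ext_mul_linr u)). Qed.
HB.instance Definition _ := GRing.Lalgebra_isAlgebra.Build k K ext_scaleAr.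

Definition pureK (x : L) (w : W) : K := ext_pure x w.
Lemma pureKM x w x' w' : pureK x w * pureK x' w' = pureK (x * x') (w * w').
Proof. exact: ext_mulE. Qed.
Lemma pureK1 : pureK 1 1 = 1. Proof. by []. Qed.
Lemma pureK_linl w : linear (pureK^~ w). Proof. exact: ext_pure_linl. Qed.
Lemma pureK_linr x : linear (pureK x). Proof. exact: ext_pure_linr. Qed.

Section Coaction.
Variables (H : algType k) (B : lbialgebroid L H).
Local Notation s := (lb_s B).
Local Notation t := (lb_t B).
Local Notation e := (lb_e B).

Definition ext_s (l : L) : K := pureK l 1.
Lemma ext_s_lin : linear ext_s. Proof. exact: ext_pure_linl. Qed.
Lemma ext_s_mul : monoid_morphism ext_s.
Proof. by split=> [//|a b]; rewrite /ext_s pureKM mulr1. Qed.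
HB.instance Definition _ := GRing.isLinear.Build k L K *:%R ext_s ext_s_lin.
HB.instance Definition _ := GRing.isMonoidMorphism.Build L K ext_s ext_s_mul.

Local Notation T := (tens (lmulact t) (lmulact ext_s)).
Let bT := tpure_bal (lmulact t) (lmulact ext_s).

(** The coaction l -> s(l) (x) 1 of the base algebra L, extended so that W is coinvariant. *)
Definition ext_lam_in (x : L) (w : W) : T := s x \ox pureK 1 w.
Lemma ext_lam_in_linl w : linear (ext_lam_in^~ w).
Proof. by have [b1 b2 b3] := bT; move=> a x y; rewrite /ext_lam_in linearP b1. Qed.
Lemma ext_lam_in_linr x : linear (ext_lam_in x).
Proof. by have [b1 b2 b3] := bT; move=> a w w'; rewrite /ext_lam_in pureK_linr b2. Qed.
Definition ext_lam (u : K) : T := ext_lift ext_lam_in u.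
Lemma ext_lam_lin : linear ext_lam.
Proof. exact: ext_lift_lin ext_lam_in_linl ext_lam_in_linr. Qed.
HB.instance Definition _ := GRing.isLinear.Build k K T *:%R ext_lam ext_lam_lin.
Lemma ext_lamE x w : ext_lam (pureK x w) = s x \ox pureK 1 w.
Proof. exact: ext_liftE ext_lam_in_linl ext_lam_in_linr. Qed.

Lemma K_ind (V : lmodType k) (F G : K -> V) : linear F -> linear G ->
  (forall x w, F (pureK x w) = G (pureK x w)) -> F =1 G.
Proof. exact: ext_ind. Qed.

Lemma smul_bal l : balanced (lmulact t) (lmulact ext_s)
  (fun h (y : K) => lmulact s l h \ox y : T).
Proof.
have [b1 b2 b3] := bT; split=> [y a u v|x|l' h y].
- by rewrite /lmulact mulrDr scalAr b1.
- exact: b2.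
- by rewrite -b3 /lmulact mulrA lb_stC -mulrA.
Qed.

Lemma ext_lamL l x : ext_lam (ext_s l * x) = tact1 (lmulact s l) (ext_lam x).
Proof.
move: x; apply: K_ind => [a u v|a u v|x w].
- by rewrite mulrDr scalAr ext_lam_lin.
- by rewrite ext_lam_lin /tact1 (tlift_lin (smul_bal l)).
by rewrite pureKM !ext_lamE /tact1 (tliftE _ _ (smul_bal l)) /lmulact rmorphM mul1r.
Qed.

Lemma ext_counit_bal : balanced (lmulact t) (lmulact ext_s)
  (fun h (y : K) => ext_s (e h) * y).
Proof.
split=> [y a u v|h a u v|l h y].
- by rewrite !linearP mulrDl scalAl.
- by rewrite mulrDr scalAr.
- by rewrite /lmulact lb_e_tM rmorphM -mulrA.
Qed.
Lemma ext_counit x : tlift (fun h y => ext_s (e h) * y) (ext_lam x) = x.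
Proof.
move: x; apply: K_ind => [a u v|//|x w].
  by rewrite ext_lam_lin (tlift_lin ext_counit_bal).
by rewrite ext_lamE (tliftE _ _ ext_counit_bal) lb_e_s pureKM mulr1 mul1r.
Qed.

Local Notation T3 := (tens (lmulact t)
  (fun l => @tact1 _ _ _ _ (lmulact t) (lmulact ext_s) (lmulact s l))).

Lemma ext_coassoc_ball (y : K) : balanced (lmulact t) (lmulact s)
  (fun h1 h2 => h1 \ox (h2 \ox y : T) : T3).
Proof.
have [b1 b2 b3] := bT.
have [c1 c2 c3] := tpure_bal (lmulact t)
  (fun l => @tact1 _ _ _ _ (lmulact t) (lmulact ext_s) (lmulact s l)).
split=> [h2|h1 a u v|l h1 h2]; first exact: c1; first by rewrite b1 c2.
by rewrite c3 /tact1 (tliftE _ _ (smul_bal l)).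
Qed.
Lemma ext_coassoc_bal1 : balanced (lmulact t) (lmulact ext_s)
  (fun h (y : K) => tlift (fun h1 h2 => h1 \ox (h2 \ox y : T) : T3) (lb_D B h)).
Proof.
have [b1 b2 b3] := bT.
have [c1 c2 c3] := tpure_bal (lmulact t)
  (fun l => @tact1 _ _ _ _ (lmulact t) (lmulact ext_s) (lmulact s l)).
split=> [y a u v|h|l h y].
- by rewrite linearP (tlift_lin (ext_coassoc_ball y)).
- by apply: tlift_linf => h1 h2 a u v; rewrite b2 c2.
have := lb_D_bimod B 1 l h; rewrite rmorph1 mul1r /lmulact => ->.
rewrite (lin_tlift _ _ (tlift_lin (ext_coassoc_ball y))); apply: eq_tlift => h1 h2.
by rewrite (tliftE _ _ (ext_coassoc_ball y)) mul1r -b3.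
Qed.
Lemma ext_coassoc_bal2 : balanced (lmulact t) (lmulact ext_s)
  (fun h (y : K) => h \ox ext_lam y : T3).
Proof.
have [c1 c2 c3] := tpure_bal (lmulact t)
  (fun l => @tact1 _ _ _ _ (lmulact t) (lmulact ext_s) (lmulact s l)).
split=> [y|h a u v|l h y]; first exact: c1; first by rewrite ext_lam_lin c2.
by rewrite c3 ext_lamL.
Qed.

Lemma ext_coassoc x :
  tlift (fun h y => tlift (fun h1 h2 => h1 \ox (h2 \ox y)) (lb_D B h)) (ext_lam x)
  = tlift (fun h y => h \ox ext_lam y) (ext_lam x) :> T3.
Proof.
move: x; apply: K_ind => [a u v|a u v|x w].
- by rewrite ext_lam_lin (tlift_lin ext_coassoc_bal1).
- by rewrite ext_lam_lin (tlift_lin ext_coassoc_bal2).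
rewrite ext_lamE (tliftE _ _ ext_coassoc_bal1) (tliftE _ _ ext_coassoc_bal2) ext_lamE rmorph1.
have -> : lb_D B (s x) = s x \ox 1.
  rewrite -[s x]mulr1 lb_DL lb_D1 /tact1 (tliftE _ _ (tact1_bal (regular B) x)).
  by rewrite /lmulact mulr1.
by rewrite (tliftE _ _ (ext_coassoc_ball _)).
Qed.

Lemma ext_mul_bal (c : H) (d : K) : balanced (lmulact t) (lmulact ext_s)
  (fun h (y : K) => (h * c) \ox (y * d) : T).
Proof.
have [b1 b2 b3] := bT; split=> [y a u v|h a u v|l h y].
- by rewrite mulrDl scalAl b1.
- by rewrite mulrDl scalAl b2.
- by rewrite /lmulact -!mulrA b3.
Qed.

Lemma ext_takeuchi x l :
  tlift (fun h y => (h * t l) \ox y) (ext_lam x) =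
  tlift (fun h y => h \ox (y * ext_s l)) (ext_lam x) :> T.
Proof.
have [b1 b2 b3] := bT.
have bal1 := ext_mul_bal (t l) 1; have bal2 := ext_mul_bal 1 (ext_s l).
transitivity (tlift (fun h (y : K) => (h * t l) \ox (y * 1) : T) (ext_lam x)).
  by apply: eq_tlift => h y; rewrite mulr1.
transitivity (tlift (fun h (y : K) => (h * 1) \ox (y * ext_s l) : T) (ext_lam x)); last first.
  by apply: eq_tlift => h y; rewrite mulr1.
move: x; apply: K_ind => [a u v|a u v|x w].
- by rewrite ext_lam_lin (tlift_lin bal1).
- by rewrite ext_lam_lin (tlift_lin bal2).
rewrite ext_lamE (tliftE _ _ bal1) (tliftE _ _ bal2) !mulr1 pureKM mul1r mulr1.
rewrite lb_stC -[t l * s x]/(lmulact t l (s x)) b3 /lmulact.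
by rewrite pureKM mulr1 mul1r.
Qed.

Lemma ext_lam1 : ext_lam 1 = 1 \ox 1.
Proof. by rewrite -pureK1 ext_lamE rmorph1. Qed.

(** With the order of summation exchanged, the product is a lift f of the second factor, balanced by
    [ext_takeuchi] for the first; both arguments can then be reduced to pure tensors. *)
Lemma ext_lamM x y : ext_lam (x * y) = tmul (ext_lam x) (ext_lam y).
Proof.
have [b1 b2 b3] := bT.
pose f (c : H) (d : K) := tlift (fun h z => (h * c) \ox (z * d) : T) (ext_lam x).
have bf : balanced (lmulact t) (lmulact ext_s) f.
  split=> [d|c|l c d].
  - by apply: tlift_linf => h z a u v; rewrite mulrDr scalAr b1.
  - by apply: tlift_linf => h z a u v; rewrite mulrDr scalAr b2.
  have := congr1 (tlift (fun h (y : K) => (h * c) \ox (y * d) : T)) (ext_takeuchi x l).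
  rewrite !(lin_tlift _ _ (tlift_lin (ext_mul_bal c d))) /f => e1.
  transitivity (tlift (fun h (z : K) => tlift (fun h (y : K) => (h * c) \ox (y * d) : T)
     ((h * t l) \ox z : T)) (ext_lam x)).
    by apply: eq_tlift => h z; rewrite (tliftE _ _ (ext_mul_bal c d)) /lmulact mulrA.
  by rewrite e1; apply: eq_tlift => h z; rewrite (tliftE _ _ (ext_mul_bal c d)) /lmulact mulrA.
have -> : tmul (ext_lam x) (ext_lam y) = tlift f (ext_lam y) by exact: tlift_exchange.
move: y; apply: K_ind => [a u v|a u v|x' w'].
- by rewrite mulrDr scalAr ext_lam_lin.
- by rewrite ext_lam_lin (tlift_lin bf).
rewrite ext_lamE (tliftE _ _ bf) /f; move: x {f bf}; apply: K_ind => [a u v|a u v|x w].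
- by rewrite mulrDl scalAl ext_lam_lin.
- by rewrite ext_lam_lin (tlift_lin (ext_mul_bal _ _)).
by rewrite pureKM !ext_lamE (tliftE _ _ (ext_mul_bal _ _)) rmorphM pureKM mulr1.
Qed.

Definition ext_comod : comod_alg B K :=
  @ComodAlg _ _ _ B K ext_s ext_lam ext_lamL ext_counit ext_coassoc ext_takeuchi
    ext_lam1 ext_lamM.

End Coaction.
End ScalarExtension.

(** * Simplicity of L (x) k(X) and absence of finite-dimensional modules *)

Section RationalExtension.
Variables (k : closedFieldType) (L : algType k).
Hypotheses (L_simple : simple_alg L) (L_fin : fin_dim L).
Local Notation W := (ratfun k).

(** A basis b of L is a basis of L (x) k(X) over k(X), with coordinates c; the density operators for
    the same b are kept alongside, to isolate one coordinate inside an ideal. *)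
Lemma ext_coordinates : exists (m : nat) (b : 'I_m -> L) (c : 'I_m -> ext L W -> W),
  [/\ forall i, linear (c i), forall u, u = \sum_i ext_pure (b i) (c i u),
      forall i, exists s, forall j, mulop s (b j) = (j == i)%:R
    & ext_pure 1 1 != 0 :> ext L W].
Proof.
have [m [b [xi [xil bE free]]]] := fin_dim_basis L_fin.
pose g i (x : L) (w : W) : W := xi i x *: w.
have g1 i w : linear (g i ^~ w) by move=> a x y; rewrite /g xil scalerDl scalerA.
have g2 i x : linear (g i x).
  by move=> a u v; rewrite /g scalerDr !scalerA [_ * a]mulrC.
exists m, b, (fun i => ext_lift (g i)); split.
- by move=> i; exact: ext_lift_lin.
- apply: ext_ind => [//|a u v|x w].
    rewrite scaler_sumr -big_split; apply: eq_bigr => i _ /=.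
    by rewrite (ext_lift_lin (g1 i) (g2 i)) ext_pure_linr.
  rewrite {1}(bE x) (linsum (ext_pure_linl w)); apply: eq_bigr => i _.
  by rewrite ext_liftE // /g (linZ (ext_pure_linl _)) (linZ (ext_pure_linr _)).
- exact: mulop_density.
apply/negP => /eqP e0.
have xi0 i : xi i 1 = 0.
  apply/eqP/negPn/negP => ci.
  have := congr1 (ext_lift (g i)) e0; rewrite ext_liftE // (lin0 (ext_lift_lin (g1 i) (g2 i))) /g.
  move=> /(congr1 ( *:%R (xi i 1)^-1)); rewrite scalerA mulVf // scale1r scaler0.
  by apply/eqP; exact: oner_neq0.
have /eqP := bE 1; rewrite big1 ?oner_eq0 // => i _.
by rewrite xi0 scale0r.
Qed.

Lemma ext_nontrivial : ext_pure 1 1 != 0 :> ext L W.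
Proof. by have [m [b [c []]]] := ext_coordinates. Qed.
Local Notation K := (ext_alg ext_nontrivial).

(** A density operator of L carries a nonzero u in I to 1 (x) w, with w a nonzero coordinate of u; w
    is invertible in k(X), so I contains 1. *)
Lemma rational_extension_simple : simple_alg K.
Proof.
move=> I [I0 ID IM]; have [m [b [c [cl uE dens _]]]] := ext_coordinates.
have [[u [Iu nu]]|no] := EM (exists u, I u /\ u != 0); last first.
  by left=> u Iu; apply/eqP/negPn/negP => nu; apply: no; exists u.
right; have [i ci] : exists i, c i u != 0.
  have [//|no] := EM (exists i, c i u != 0); case/eqP: nu.
  rewrite [u]uE big1 // => i _; have [->|h] := eqVneq (c i u) 0; last by case: no; exists i.
  exact: (lin0 (ext_pure_linr _)).
have [s hs] := dens i.
have Iw : I (pureK _ 1 (c i u)).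
  have -> : pureK ext_nontrivial 1 (c i u) =
      \sum_(p <- s) pureK ext_nontrivial p.1 1 * (u : K) * pureK ext_nontrivial p.2 1.
    transitivity (\sum_j pureK ext_nontrivial (mulop s (b j)) (c j u)).
      rewrite (bigD1 i) //= big1 => [|j ne]; rewrite hs ?eqxx ?addr0 //.
      by rewrite (negbTE ne) (lin0 (pureK_linl _ _)).
    have {2}-> : u = \sum_j pureK ext_nontrivial (b j) (c j u) by exact: uE.
    under [RHS]eq_bigr do rewrite mulr_sumr mulr_suml.
    rewrite exchange_big; apply: eq_bigr => j _ /=.
    rewrite (linsum (pureK_linl _ _)); apply: eq_bigr => p _.
    by rewrite !pureKM mul1r mulr1.
  by elim/big_ind: _ => // p _; exact: IM.
move=> x; have := IM (pureK _ 1 (c i u)^-1) _ x Iw.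
by rewrite pureKM mul1r mulVf // pureK1 mul1r.
Qed.

(** The vectors X^n y satisfy a relation, so some nonzero polynomial p(X) kills y; but p(X) is
    invertible in k(X). *)
Lemma rational_extension_modules (Y : amod K) (y : Y) : y = 0.
Proof.
pose u n := mact (pureK ext_nontrivial 1 (ratfun_of 'X ^+ n)) y.
have [p [p0 ps]] := poly_relation u (mact_fin Y).
have e0 : mact (pureK ext_nontrivial 1 (ratfun_of p)) y = 0.
  rewrite -ratfun_horner (linsum (pureK_linr _ _)) (linsum (mact_linl y)) -[RHS]ps.
  by apply: eq_bigr => i _; rewrite (linZ (pureK_linr _ _)) (linZ (mact_linl y)).
rewrite -[y]mact1 -(pureK1 ext_nontrivial) -{1}(mul1r 1) -(mulVf (ratfun_of_neq0 p0)).
by rewrite -pureKM mactM e0 (lin0 (mact_linr _)).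
Qed.

End RationalExtension.

Definition zero_mod (k : fieldType) (A : algType k) : amod A.
Proof.
apply: (@AMod _ A 'rV[k]_0 (fun _ v => v)) => // [v a x y|].
  by rewrite [LHS]thinmx0 [RHS]thinmx0.
exact: fin_dim_vect.
Defined.

Theorem theorem5p8 (k : closedFieldType) (char0 : [pchar k] =i pred0)
    (L R : algType k) (H : falgType k) (HH : hopf_algebroid L R H)
    (L_simple : simple_alg L)
    (M : modcat (rep (ha_l HH))) (M_modcat : module_category M)
    (M_exact : exact_modcat M) (M_indec : indecomposable M) :
  exists (K : algType k) (C : comod_alg (ha_l HH) K),
    H_simple C /\ modcat_equiv M (comod_rep C).
Proof.
have [[A nzA]|zM] := EM (exists A : M, ~ zero_ob A).
  have h := @nonzero_case k L R H HH (simple_left_rigid HH L_simple) M M_modcat M_exact M_indec A nzA. exact: h.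
have {}zM (A : M) : zero_ob A by have [//|nzA] := EM (zero_ob A); case: zM; exists A.
have L_fin := umod_fin HH.
exists (ext_alg (ext_nontrivial L_simple L_fin)), (ext_comod _ (ha_l HH)); split.
  (* All two-sided ideals of this algebra are trivial, in particular the costable ones. *)
  by move=> I Iid _; exact: rational_extension_simple Iid.
have zN (Y : comod_rep (ext_comod (ext_nontrivial L_simple L_fin) (ha_l HH))) : zero_ob Y.
  by apply/zero_ob_idm; apply: ahom_ext => y; exact: rational_extension_modules.
have [[Z _] _ _ _ _] := proj1 M_modcat.
exact: (@modcat_equiv_zero k _ M (comod_rep _) Z (zero_mod _) zM zN).
Qed.
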